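(* Let the problem $\mathcal L=\mathcal L(p,q,a,b,c)$, with complex-valued $p,q\in L_1[0,1]$ and $a,b,c\in\mathbb C$, have only simple eigenvalues and satisfy the separation condition $(\mathcal S)$. Then the data $\{\lambda_n,\gamma_n,\xi_n\}_{n\ge1}$ uniquely determine the data $\{\lambda_n,\Delta_{32}(\lambda_n),\Delta_{42}(\lambda_n)\}_{n\ge1}$ by the formulas $$\Delta_{32}(\lambda_n)=\dot\Delta_{22}(\lambda_n)\,\gamma_n^2,\qquad \Delta_{42}(\lambda_n)=\dot\Delta_{22}(\lambda_n)\,\xi_n\gamma_n,\qquad n\ge1,$$ and vice versa: the data $\{\lambda_n,\Delta_{32}(\lambda_n),\Delta_{42}(\lambda_n)\}_{n\ge1}$ uniquely determine $\{\lambda_n,\gamma_n,\xi_n\}_{n\ge1}$, the pair $(\gamma_n,\xi_n)$ being considered up to a simultaneous change of sign for each $n$. Consequently, within the class of problems with simple eigenvalues satisfying $(\mathcal S)$, the inverse problem of recovering $p,q,a,b,c$ from $\{\lambda_n,\gamma_n,\xi_n\}_{n\ge1}$ and the inverse problem of recovering $p,q,a,b,c$ from the three spectra $\mathfrak S_{12},\mathfrak S_{13},\mathfrak S_{23}$ are equivalent: for two problems $\mathcal L,\tilde{\mathcal L}$ in this class, one has $\lambda_n=\tilde\lambda_n$, $\gamma_n=\tilde\gamma_n$, $\xi_n=\tilde\xi_n$ for all $n\ge1$ if and only if $\mathfrak S_{12}=\tilde{\mathfrak S}_{12}$, $\mathfrak S_{13}=\tilde{\mathfrak S}_{13}$, $\mathfrak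 S_{23}=\tilde{\mathfrak S}_{23}$.
   Context: Setting. For complex-valued $p,q\in L_1[0,1]$ and $a,b,c\in\mathbb C$, put $y^{[j]}:=y^{(j)}$ for $j=0,1,2$, $y^{[3]}:=y'''-py'$, and $\mathcal D:=\{y\in W_1^3[0,1]: y^{[3]}\in W_1^1[0,1]\}$. For $y\in\mathcal D$ put $\ell(y):=y^{(4)}-(py')'+qy$, understood as $(y^{[3]})'+qy$. ''Solution'' means a function $y\in\mathcal D$ satisfying $\ell(y)=\lambda y$ a.e. on $(0,1)$; $\lambda\in\mathbb C$ is the spectral parameter. Define the linear forms $U_1(y)=y''(0)+ay'(0)-by(0)$, $U_2(y)=y^{[3]}(0)+by'(0)+cy(0)$, $U_3(y)=y(0)$, $U_4(y)=y'(0)$, and $V_s(y)=y^{[s-1]}(1)$ for $s=1,2,3,4$. The boundary value problem $\mathcal L=\mathcal L(p,q,a,b,c)$ is $\ell(y)=\lambda y$ with $U_1(y)=U_2(y)=0$, $V_1(y)=V_2(y)=0$. Characteristic functions. Let $C_k(x,\lambda)$, $k=1,\dots,4$, be the solutions of $\ell(y)=\lambda y$ with $U_s(C_k)=\delta_{sk}$, $s=1,\dots,4$. Put $\Delta_{kk}(\lambda):=\det[V_{5-s}(C_r)]_{s,r=k+1}^4$ for $k=1,2,3$, and for $j>k$ let $\Delta_{jk}(\lambda)$ be obtained from $\Delta_{kk}(\lambda)$ by replacing $C_j$ by $C_k$. The dot denotes $d/d\lambda$. The zeros of $\Delta_{22}$ are the eigenvalues $\{\lambda_n\}_{n\ge1}$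 of $\mathcal L$; an eigenvalue is simple if it is a simple zero of $\Delta_{22}$. Separation condition $(\mathcal S)$: for $k=1,2$, the functions $\Delta_{kk}(\lambda)$ and $\Delta_{k+1,k+1}(\lambda)$ have no common zeros. Weight numbers. When the eigenvalues are simple, $y_n(x)$ is the eigenfunction of $\mathcal L$ for $\lambda_n$ normalized by $\int_0^1y_n^2(x)\,dx=1$ (determined up to sign), $\gamma_n:=y_n(0)$, $\xi_n:=y_n'(0)$. Equality of the data of two problems means equality for some numbering of eigenvalues and some choice of normalized eigenfunctions. Three spectra. For $(j,k)\in\{(1,2),(1,3),(2,3)\}$, $\mathfrak S_{jk}$ is the spectrum of $\ell(y)=\lambda y$ with boundary conditions $U_j(y)=U_k(y)=0$, $V_1(y)=V_2(y)=0$, eigenvalues being counted with multiplicities, i.e. as zeros of the characteristic function $U_j(S_3)U_k(S_4)-U_k(S_3)U_j(S_4)$, where $S_k(x,\lambda)$ are the solutions of $\ell(y)=\lambda y$ with $V_s(S_k)=\delta_{sk}$, $s=1,\dots,4$. Objects with a tilde are the analogous objects for $\tilde{\mathcal L}$. *)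

(* Defs.v *)
From HB Require Import structures.
From mathcomp Require Import all_boot all_order all_algebra.
From mathcomp Require Import complex.
From mathcomp Require Import all_classical all_reals all_analysis.
Set Implicit Arguments.
Unset Strict Implicit.
Unset Printing Implicit Defensive.
Import Order.TTheory GRing.Theory Num.Theory.
Import numFieldNormedType.Exports.
Local Open Scope ring_scope.
Local Open Scope complex_scope.
Local Open Scope classical_set_scope.

(* R[i]^o is the normed module over itself that [derive1] asks for, so these
   are complex derivatives. *)
Definition cderive (R : realType) (f : R[i] -> R[i]) : R[i] -> R[i] :=
  derive1 (f : R[i] -> R[i]^o).

Definition cderiven (R : realType) (n : nat) (f : R[i] -> R[i]) :
    R[i] -> R[i] :=
  derive1n n (f : R[i] -> R[i]^o).

(* The library integral is real-valued: complex functions are integrated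
   through their real and imaginary parts. *)
Definition cintegrable (R : realType) (A : set R) (f : R -> R[i]) : Prop :=
  (@lebesgue_measure R).-integrable A (fun x => (complex.Re (f x))%:E) /\
  (@lebesgue_measure R).-integrable A (fun x => (complex.Im (f x))%:E).

Definition cintegral (R : realType) (A : set R) (f : R -> R[i]) : R[i] :=
  Rintegral (@lebesgue_measure R) A (fun x => complex.Re (f x)) +i*
  Rintegral (@lebesgue_measure R) A (fun x => complex.Im (f x)).

Definition ae_eq01 (R : realType) (f g : R -> R[i]) : Prop :=
  {ae @lebesgue_measure R, forall x, `[0, 1] x -> f x = g x}.

(* f is (the absolutely continuous representative of) an element of
   W_1^1[0,1], and f' = g almost everywhere. *)
Definition W11_deriv (R : realType) (f g : R -> R[i]) : Prop :=
  cintegrable `[0, 1] g /\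
  forall x, `[0, 1] x -> f x = f 0 + cintegral `[0, x] g.

Record problem (R : realType) := Problem {
  coef_p : R -> R[i];
  coef_q : R -> R[i];
  coef_a : R[i];
  coef_b : R[i];
  coef_c : R[i];
  coef_p_L1 : cintegrable `[0, 1] coef_p;
  coef_q_L1 : cintegrable `[0, 1] coef_q }.

(* A function y of the domain D is carried together with its
   quasi-derivatives: Y j = y^[j] for j <= 3 (Y j is irrelevant for j > 3).
   The third derivative y''' is only an L_1 function, whereas y^[3] is the
   absolutely continuous function that agrees a.e. with y''' - p y'; this is
   what gives a meaning to y^[3](0) and y^[3](1). *)
Definition qderivs (R : realType) (L : problem R) (Y : nat -> R -> R[i]) :
    Prop :=
  [/\ W11_deriv (Y 0%N) (Y 1%N),
      W11_deriv (Y 1%N) (Y 2%N),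
      exists2 y3, W11_deriv (Y 2%N) y3 &
        ae_eq01 (Y 3%N) (fun x => y3 x - coef_p L x * Y 1%N x) &
      exists g, W11_deriv (Y 3%N) g].

Definition is_solution (R : realType) (L : problem R) (lam : R[i])
    (Y : nat -> R -> R[i]) : Prop :=
  qderivs L Y /\
  exists2 g, W11_deriv (Y 3%N) g &
    ae_eq01 (fun x => g x + coef_q L x * Y 0%N x) (fun x => lam * Y 0%N x).

(* The indices of U, V, C, S and Delta start from 1, as in the usual
   notation; the value outside 1..4 is irrelevant. *)
Definition formU (R : realType) (L : problem R) (s : nat)
    (Y : nat -> R -> R[i]) : R[i] :=
  match s with
  | 1 => Y 2%N 0 + coef_a L * Y 1%N 0 - coef_b L * Y 0%N 0
  | 2 => Y 3%N 0 + coef_b L * Y 1%N 0 + coef_c L * Y 0%N 0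
  | 3 => Y 0%N 0
  | 4 => Y 1%N 0
  | _ => 0
  end.

Definition formV (R : realType) (s : nat) (Y : nat -> R -> R[i]) : R[i] :=
  Y s.-1 1.

Definition solC (R : realType) (L : problem R) (k : nat) (lam : R[i]) :
    nat -> R -> R[i] :=
  xget (fun _ _ => 0)
    [set Y | is_solution L lam Y /\
      forall s, (1 <= s <= 4)%N -> formU L s Y = (s == k)%:R].

Definition solS (R : realType) (L : problem R) (k : nat) (lam : R[i]) :
    nat -> R -> R[i] :=
  xget (fun _ _ => 0)
    [set Y | is_solution L lam Y /\
      forall s, (1 <= s <= 4)%N -> formV s Y = (s == k)%:R].

(* Delta_jk: rows s = k+1..4, columns r = k+1..4, with C_j replaced by C_k.
   For j = k no column is replaced. *)
Definition Delta (R : realType) (L : problem R) (j k : nat) (lam : R[i]) :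
    R[i] :=
  \det (\matrix_(s < (4 - k)%N, r < (4 - k)%N)
          formV (5 - (k.+1 + s))%N
            (solC L (if (k.+1 + r == j)%N then k else (k.+1 + r)%N) lam)).

Definition simple_eigenvalues (R : realType) (L : problem R) : Prop :=
  forall mu, Delta L 2 2 mu = 0 -> cderive (Delta L 2 2) mu != 0.

Definition separation (R : realType) (L : problem R) : Prop :=
  forall k, (1 <= k <= 2)%N ->
    forall mu, ~ (Delta L k k mu = 0 /\ Delta L k.+1 k.+1 mu = 0).

(* lam numbers the zeros of Delta_22 (from 0), each one occurring once. *)
Definition numbering (R : realType) (L : problem R) (lam : nat -> R[i]) :
    Prop :=
  injective lam /\ range lam = [set mu | Delta L 2 2 mu = 0].

Definition normalized_eigenfunction (R : realType) (L : problem R)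
    (mu : R[i]) (Y : nat -> R -> R[i]) : Prop :=
  [/\ is_solution L mu Y,
      formU L 1 Y = 0 /\ formU L 2 Y = 0,
      formV 1 Y = 0 /\ formV 2 Y = 0 &
      cintegral `[0, 1] (fun x => Y 0%N x ^+ 2) = 1].

Definition normalized_eigenfunctions (R : realType) (L : problem R)
    (lam : nat -> R[i]) (Y : nat -> nat -> R -> R[i]) : Prop :=
  forall n, normalized_eigenfunction L (lam n) (Y n).

Definition weight_gamma (R : realType) (Y : nat -> nat -> R -> R[i])
    (n : nat) : R[i] :=
  Y n 0%N 0.

Definition weight_xi (R : realType) (Y : nat -> nat -> R -> R[i])
    (n : nat) : R[i] :=
  Y n 1%N 0.

Definition same_weight_data (R : realType) (L L' : problem R) : Prop :=
  exists lam Y lam' Y',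
    [/\ numbering L lam /\ normalized_eigenfunctions L lam Y,
        numbering L' lam' /\ normalized_eigenfunctions L' lam' Y' &
        forall n, [/\ lam n = lam' n,
                      weight_gamma Y n = weight_gamma Y' n &
                      weight_xi Y n = weight_xi Y' n]].

Definition spectrum_char (R : realType) (L : problem R) (j k : nat)
    (lam : R[i]) : R[i] :=
  formU L j (solS L 3 lam) * formU L k (solS L 4 lam) -
  formU L k (solS L 3 lam) * formU L j (solS L 4 lam).

(* The multiset of zeros, encoded as a set of labelled copies: a zero mu of
   multiplicity m contributes (mu, 0), ..., (mu, m - 1). *)
Definition spectrum (R : realType) (L : problem R) (j k : nat) :
    set (R[i] * nat) :=
  [set z | forall i, (i <= z.2)%N ->
           cderiven i (spectrum_char L j k) z.1 = 0].

(* Main.v *)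
(* With z = Delta_32 C_3 + Delta_42 C_4 - Delta_22 C_2, Lagrange's identity for z at lam
   and an eigenfunction y at lam_n gives y(0) Delta_22 (lam) = (lam - lam_n) int y z,
   while z at lam_n is a multiple of y by separation.  Dividing by lam - lam_n yields the
   two formulas, which determine (gamma_n, xi_n) up to a common sign once Delta_22 is known.
   The spectra S_12, S_13, S_23 are the zeros of Delta_22, Delta_32, Delta_42, by the
   symplectic duality between the C_k and the S_k.

   It remains to recover these functions from their zeros, or from their values at the
   zeros of Delta_22.  They are 2x2 minors of solutions, so they come from a first-order
   linear system of dimension 5; weighted Picard iteration shows that they are entire of
   order 1/4, in the form of a rate of polynomial approximation, and on the ray
   lam = - tau^4 / 4 they are asymptotic to their values for p = q = 0, which grow like
   exp tau up to powers of tau.  If F and G are such functions, F / G is entire and F / G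
   tends to 0 on the ray, then F / G has order less than 1/3: the approximating polynomials
   bound |G| below on large circles.  Phragmen-Lindelof, applied after w^3 = z in the sector
   |arg w| <= pi/3 whose two sides map to the negative ray, bounds F / G, and Liouville
   gives F = 0. *)

Require Import Defs.
From HB Require Import structures.
From mathcomp Require Import all_boot all_order all_algebra.
From mathcomp Require Import complex.
From mathcomp Require Import all_classical all_reals all_analysis.
From mathcomp Require Import cyclic separable cyclotomic measurable_realfun ring lra.
Import Order.TTheory GRing.Theory Num.Theory.
Import numFieldNormedType.Exports.
Local Open Scope ring_scope.
Local Open Scope complex_scope.
Local Open Scope classical_set_scope.
Set Implicit Arguments.
Unset Strict Implicit.
Unset Printing Implicit Defensive.

(** The problem is not self-adjoint: neither reality of the eigenvalues nor positivity of the
    integral of [y ^+ 2] is available. This integral is nonzero because the eigenvalue is simple.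

    On lam = - tau^4 / 4 the fourth roots of lam are tau (+-1 +- i) / 2. Single solutions oscillate
    there while growing like exp (tau / 2). The sums of two roots are tau, - tau, i tau, - i tau, 0,
    0, so the minors have a single dominant exponent, the real number tau, and the three
    determinants do not vanish far out. This explains both the choice of the ray and the passage to
    minors.

    Contour integrals are avoided: analytic at a point means uniformly approximable by polynomials
    on a disc around it. The mean over the n-th roots of unity is exact for polynomials of degree
    below n, which yields the maximum principle; applied to quotients by z - z0, it takes the place
    of the Cauchy estimates. Picard iterates fit this view, being polynomials in lam. The degree
    needed for a good approximation is of order |lam|^(1/4), and the minimum modulus of a polynomial
    costs a constant to the power of its degree. *)

Notation cmod := (@Normc.normc _).

(** * The modulus and bounded measurable functions on [0,1] *)

Section Modulus.
Context {R : realType}.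
Implicit Types z w : R[i].

(** Estimates are kept in the real-valued modulus, where the order is total and [lra] applies; the
    norm of the type [R[i]] takes values in [R[i]] itself. *)
Lemma cmodE z : `|z| = (cmod z)%:C.
Proof. by rewrite normc_def; case: z. Qed.

Lemma cmod_ge0 z : 0 <= cmod z.
Proof. by case: z => a b; exact: sqrtr_ge0. Qed.

Lemma cmodD z w : cmod (z + w) <= cmod z + cmod w.
Proof. exact: le_normcD. Qed.

Lemma cmodN z : cmod (- z) = cmod z.
Proof. exact: normcN. Qed.

Lemma cmodB z w : cmod (z - w) <= cmod z + cmod w.
Proof. by rewrite -(cmodN w) cmodD. Qed.

Lemma cmod_distC z w : cmod (z - w) = cmod (w - z).
Proof. by rewrite -cmodN opprB. Qed.

Lemma cmodM z w : cmod (z * w) = cmod z * cmod w.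
Proof. exact: Normc.normcM. Qed.

Lemma cmod0 : cmod (0 : R[i]) = 0.
Proof. exact: Normc.normc0. Qed.

Lemma cmod1 : cmod (1 : R[i]) = 1.
Proof. exact: Normc.normc1. Qed.

Lemma cmodV z : cmod z^-1 = (cmod z)^-1.
Proof. exact: Normc.normcV. Qed.

Lemma cmod_eq0 z : (cmod z == 0) = (z == 0).
Proof. by apply/eqP/eqP => [/Normc.eq0_normc//|->]; rewrite cmod0. Qed.

Lemma cmod_gt0 z : (0 < cmod z) = (z != 0).
Proof. by rewrite lt0r cmod_eq0 cmod_ge0 andbT. Qed.

Lemma cmodX z n : cmod (z ^+ n) = cmod z ^+ n.
Proof. by elim: n => [|n IH]; rewrite ?cmod1// !exprS cmodM IH. Qed.

Lemma cmod_sum I (r : seq I) (P : pred I) (F : I -> R[i]) :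
  cmod (\sum_(i <- r | P i) F i) <= \sum_(i <- r | P i) cmod (F i).
Proof.
elim/big_ind2: _ => [|x1 x2 y1 y2 h1 h2|//]; first by rewrite cmod0.
by apply: le_trans (cmodD _ _) _; exact: lerD.
Qed.

Lemma cmod_real (x : R) : cmod x%:C = `|x|.
Proof. by rewrite /= expr0n /= addr0 sqrtr_sqr. Qed.

Lemma cmod_nat n : cmod (n%:R : R[i]) = n%:R.
Proof. by rewrite -(rmorph_nat (real_complex R)) cmod_real normr_nat. Qed.

Lemma cmod_Re z : `|complex.Re z| <= cmod z.
Proof. by have := normc_ge_Re z; rewrite cmodE lecR. Qed.

Lemma cmod_Im z : `|complex.Im z| <= cmod z.
Proof.
case: z => a b /=; rewrite -sqrtr_sqr ler_wsqrtr// lerDr sqr_ge0//.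
Qed.

Lemma cmod_le z : cmod z <= `|complex.Re z| + `|complex.Im z|.
Proof.
rewrite {1}(complexE z) (le_trans (cmodD _ _))// cmodM !cmod_real lerD2l.
by rewrite /= expr0n expr1n add0r sqrtr1 mul1r.
Qed.

Lemma cmod_sub_ge z w : cmod z - cmod w <= cmod (z - w).
Proof. by rewrite lerBlDr -{1}(subrK w z) cmodD. Qed.

Lemma cmod_dist_trans u z w : cmod (z - w) <= cmod (z - u) + cmod (u - w).
Proof. by have := cmodD (z - u) (u - w); rewrite addrA subrK. Qed.

Lemma ReD z w : complex.Re (z + w) = complex.Re z + complex.Re w.
Proof. by case: z => a b; case: w. Qed.
Lemma ImD z w : complex.Im (z + w) = complex.Im z + complex.Im w.
Proof. by case: z => a b; case: w. Qed.
Lemma ReB z w : complex.Re (z - w) = complex.Re z - complex.Re w.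
Proof. by case: z => a b; case: w. Qed.
Lemma ImB z w : complex.Im (z - w) = complex.Im z - complex.Im w.
Proof. by case: z => a b; case: w. Qed.
Lemma ReM z w : complex.Re (z * w) =
  complex.Re z * complex.Re w - complex.Im z * complex.Im w.
Proof. by case: z => a b; case: w. Qed.
Lemma ImM z w : complex.Im (z * w) =
  complex.Re z * complex.Im w + complex.Im z * complex.Re w.
Proof. by case: z => a b; case: w. Qed.

Lemma complex_ext z w : complex.Re z = complex.Re w ->
  complex.Im z = complex.Im w -> z = w.
Proof. by case: z => a b; case: w => c d /= -> ->. Qed.

Lemma polarization z : exists2 u, cmod u = 1 & u * z = (cmod z)%:C.
Proof.
have [->|z0] := eqVneq z 0; first by exists 1; rewrite ?cmod1// mul1r cmod0.
exists ((cmod z)%:C / z); last by rewrite divfK.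
by rewrite cmodM cmodV cmod_real ger0_norm ?cmod_ge0// divff// cmod_eq0.
Qed.

(** On real sequences the supremum of the numbers [y n - e n] is the limit, because every
    [y n + e n] is an upper bound for them. The factor 2 comes from adding the real and imaginary
    errors. The explicit rate is what the later estimates use. *)
Lemma cauchy_limit (x : nat -> R[i]) (e : nat -> R) :
  (forall eps, 0 < eps -> exists n, e n < eps) ->
  (forall m n, cmod (x m - x n) <= e m + e n) ->
  exists l, forall n, cmod (x n - l) <= 2 * e n.
Proof.
move=> e0 xc.
have real_case (y : nat -> R) : (forall m n, `|y m - y n| <= e m + e n) ->
    exists l, forall n, `|y n - l| <= e n.
  move=> yc; pose A := [set y n - e n | n in [set: nat]].
  have hA n : ubound A (y n + e n).
    move=> _ [m _ <-]; have := yc m n; rewrite ler_norml => /andP[_ h]; lra.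
  have sA : has_sup A.
    by split; [exists (y 0%N - e 0%N), 0%N|exists (y 0%N + e 0%N); exact: hA].
  exists (sup A) => n; rewrite ler_norml; apply/andP; split.
    have : sup A <= y n + e n by apply: ge_sup; [case: sA|exact: hA].
    lra.
  have : y n - e n <= sup A by apply: ub_le_sup; [case: sA|exists n].
  lra.
have [|a ha] := real_case (fun n => complex.Re (x n)).
  by move=> m n; rewrite -ReB (le_trans (cmod_Re _)).
have [|b hb] := real_case (fun n => complex.Im (x n)).
  by move=> m n; rewrite -ImB (le_trans (cmod_Im _)).
exists (a +i* b) => n; apply: le_trans (cmod_le _) _.
rewrite ReB ImB /=; have := ha n; have := hb n; lra.
Qed.

End Modulus.

(* Locked: unification would otherwise unfold the Lebesgue integral. *)
HB.lock Definition rI (R : realType) (x y : R) (f : R -> R) : R :=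
  Rintegral (@lebesgue_measure R) `[x, y] f.

HB.lock Definition cI (R : realType) (x y : R) (f : R -> R[i]) : R[i] :=
  cintegral `[x, y] f.

(** * Integrals of real and complex functions over subintervals of [0,1] *)

Section Integration.
Context {R : realType}.
Notation mu := (@lebesgue_measure R).
Notation C := R[i].
Implicit Types (x y : R).

(** Two classes suffice: integrable functions for the coefficients, bounded measurable ones for the
    solutions. A product of one of each kind is again integrable. *)
Definition rL1 (f : R -> R) : Prop := mu.-integrable `[0, 1] (EFin \o f).
Definition cL1 (f : R -> C) : Prop := cintegrable `[0, 1] f.
Definition rbm (f : R -> R) : Prop := measurable_fun (`[0, 1] : set R) f /\
  exists M : R, forall x, 0 <= x <= 1 -> `|f x| <= M.
Definition cbm (f : R -> C) : Prop :=
  rbm (fun x => complex.Re (f x)) /\ rbm (fun x => complex.Im (f x)).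

Lemma in01 x : (`[0, 1]%classic : set R) x = (0 <= x <= 1) :> Prop.
Proof. by rewrite /= in_itv. Qed.

Lemma rL1_eq f g : (forall x, 0 <= x <= 1 -> f x = g x) -> rL1 f -> rL1 g.
Proof.
move=> fg; apply: eq_integrable => //= x; rewrite inE in01 => /fg h /=.
by rewrite h.
Qed.

Lemma rL1D f g : rL1 f -> rL1 g -> rL1 (fun x => f x + g x).
Proof. by move=> hf hg; exact: (@integrableD _ _ _ mu _ _ _ _ hf hg). Qed.

Lemma rL1Z k f : rL1 f -> rL1 (fun x => k * f x).
Proof. by move=> hf; exact: (@integrableZl _ _ _ mu _ _ k _ hf). Qed.

Lemma rL1N f : rL1 f -> rL1 (fun x => - f x).
Proof. by move=> /(rL1Z (-1)); apply: rL1_eq => x _; rewrite mulN1r. Qed.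

Lemma rL1B f g : rL1 f -> rL1 g -> rL1 (fun x => f x - g x).
Proof. by move=> hf /rL1N; exact: rL1D. Qed.

Lemma rL1_abs f : rL1 f -> rL1 (fun x => `|f x|).
Proof. by move=> hf; exact: (integrable_norm hf). Qed.

Lemma rbm_bounded f : rbm f -> [bounded f x | x in (`[0, 1] : set R)].
Proof.
move=> [_ [M hM]]; exists M; split; first exact: num_real.
by move=> B MB x; rewrite in01 => /hM h; exact: le_trans h (ltW MB).
Qed.

Lemma rbm_L1 f : rbm f -> rL1 f.
Proof.
move=> hf; apply: measurable_bounded_integrable => //.
- by rewrite /= lebesgue_measure_itv/= lte01 -EFinD ltry.
- by case: hf.
- exact: rbm_bounded.
Qed.

Lemma rL1M h g : rbm h -> rL1 g -> rL1 (fun x => h x * g x).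
Proof.
move=> hh hg; apply: (integrableMr _ _ _ hg) => //; first by case: hh.
exact: rbm_bounded.
Qed.

Lemma rbm_eq f g : (forall x, 0 <= x <= 1 -> f x = g x) -> rbm f -> rbm g.
Proof.
move=> fg [mf [M hM]]; split.
  by apply: eq_measurable_fun mf => x; rewrite inE in01 => /fg.
by exists M => x x01; rewrite -fg ?hM.
Qed.

Lemma rbm_cst k : rbm (fun=> k).
Proof. by split; [exact: measurable_cst|exists `|k|]. Qed.

Lemma rbmD f g : rbm f -> rbm g -> rbm (fun x => f x + g x).
Proof.
move=> [mf [M hM]] [mg [N hN]]; split; first exact: measurable_funD.
exists (M + N) => x x01; rewrite (le_trans (ler_normD _ _))// lerD ?hM ?hN//.
Qed.

Lemma rbmM f g : rbm f -> rbm g -> rbm (fun x => f x * g x).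
Proof.
move=> [mf [M hM]] [mg [N hN]]; split; first exact: measurable_funM.
by exists (M * N) => x x01; rewrite normrM ler_pM ?hM ?hN.
Qed.

Lemma rbmN f : rbm f -> rbm (fun x => - f x).
Proof.
by move=> /(rbmM (rbm_cst (-1))); apply: rbm_eq => x _; rewrite mulN1r.
Qed.

Lemma rbmB f g : rbm f -> rbm g -> rbm (fun x => f x - g x).
Proof. by move=> hf /rbmN; exact: rbmD. Qed.

Lemma rbm_continuous (f : R -> R) : {within `[0, 1], continuous f} -> rbm f.
Proof.
move=> cf; split; first exact: subspace_continuous_measurable_fun.
have [c _ hc] := EVT_max ler01 (fun x => cvg_norm (cf x)).
by exists `|f c| => x x01; apply: hc; rewrite in_itv.
Qed.

Lemma rL1_sub f x y : rL1 f -> 0 <= x -> y <= 1 ->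
  mu.-integrable `[x, y] (EFin \o f).
Proof.
move=> hf x0 y1; apply: integrableS hf => //.
by apply: subset_itv; rewrite bnd_simp.
Qed.

Lemma rID f g x y : rL1 f -> rL1 g -> 0 <= x -> y <= 1 ->
  rI x y (fun s => f s + g s) = rI x y f + rI x y g.
Proof. by move=> hf hg x0 y1; rewrite rI.unlock; apply: RintegralD => //; exact: rL1_sub. Qed.

Lemma rIZ k f x y : rL1 f -> 0 <= x -> y <= 1 ->
  rI x y (fun s => k * f s) = k * rI x y f.
Proof. by move=> hf x0 y1; rewrite rI.unlock; apply: RintegralZl => //; exact: rL1_sub. Qed.

Lemma eq_rI f g x y : (forall s, x <= s <= y -> f s = g s) ->
  rI x y f = rI x y g.
Proof. by move=> fg; rewrite rI.unlock; apply: eq_Rintegral => s; rewrite inE/= in_itv => /fg. Qed.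

Lemma rIB f g x y : rL1 f -> rL1 g -> 0 <= x -> y <= 1 ->
  rI x y (fun s => f s - g s) = rI x y f - rI x y g.
Proof. by move=> hf hg x0 y1; rewrite rI.unlock; apply: RintegralB => //; exact: rL1_sub. Qed.

Lemma rI_le f g x y : rL1 f -> rL1 g -> 0 <= x -> y <= 1 ->
  (forall s, x <= s <= y -> f s <= g s) -> rI x y f <= rI x y g.
Proof.
by move=> hf hg x0 y1 fg; rewrite rI.unlock; apply: le_Rintegral => //; exact: rL1_sub.
Qed.

Lemma rI_ge0 f x y : (forall s, x <= s <= y -> 0 <= f s) -> 0 <= rI x y f.
Proof. by move=> h; rewrite rI.unlock; apply: Rintegral_ge0 => s; rewrite /= in_itv => /h. Qed.

Lemma rI_split f x y : rL1 f -> 0 <= x -> x <= y -> y <= 1 ->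
  rI 0 y f = rI 0 x f + rI x y f.
Proof.
move=> hf x0 xy y1; suff <- : rI 0 y f - rI 0 x f = rI x y f by rewrite subrKC.
have hf' := rL1_sub hf (lexx 0) y1.
rewrite rI.unlock -[RHS]Rintegral_itv_obnd_cbnd.
  by apply: Rintegral_itvB => //; rewrite bnd_simp.
by apply: integrableS hf' => //; apply: subset_itv; rewrite bnd_simp.
Qed.

Lemma rIcst k x y : x <= y -> rI x y (fun=> k) = k * (y - x).
Proof.
move=> xy; rewrite rI.unlock Rintegral_cst//= lebesgue_measure_itv/= lte_fin.
case: ltP => [//|yx] /=.
by have -> : x = y; [lra|rewrite subrr].
Qed.

Lemma rIxx f x : rI x x f = 0.
Proof. by rewrite rI.unlock set_itv1 Rintegral_set1. Qed.

Lemma rI_continuous (f : R -> R) : rL1 f -> {within `[0, 1], continuous (fun t => rI 0 t f)}.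
Proof. by rewrite rI.unlock; exact: parameterized_integral_continuous. Qed.

Lemma rbm_rI f : rL1 f -> rbm (fun t => rI 0 t f).
Proof. by move=> /rI_continuous; exact: rbm_continuous. Qed.

Lemma cL1_eq f g : (forall x, 0 <= x <= 1 -> f x = g x) -> cL1 f -> cL1 g.
Proof. by move=> fg [h1 h2]; split; [move: h1|move: h2]; apply: rL1_eq => x /fg->. Qed.

Lemma cL1D f g : cL1 f -> cL1 g -> cL1 (fun x => f x + g x).
Proof.
move=> [f1 f2] [g1 g2]; split; [have := rL1D f1 g1|have := rL1D f2 g2];
by apply: rL1_eq => x _; rewrite ?ReD ?ImD.
Qed.

Lemma cL1N f : cL1 f -> cL1 (fun x => - f x).
Proof.
move=> [f1 f2]; split; [have := rL1N f1|have := rL1N f2];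
by apply: rL1_eq => x _; case: (f x).
Qed.

Lemma cL1B f g : cL1 f -> cL1 g -> cL1 (fun x => f x - g x).
Proof. by move=> hf /cL1N; exact: cL1D. Qed.

Lemma cL1M h g : cbm h -> cL1 g -> cL1 (fun x => h x * g x).
Proof.
move=> [h1 h2] [g1 g2]; split.
  have := rL1B (rL1M h1 g1) (rL1M h2 g2).
  by apply: rL1_eq => x _; rewrite ReM.
have := rL1D (rL1M h1 g2) (rL1M h2 g1).
by apply: rL1_eq => x _; rewrite ImM.
Qed.

Lemma cbm_eq f g : (forall x, 0 <= x <= 1 -> f x = g x) -> cbm f -> cbm g.
Proof. by move=> fg [h1 h2]; split; [move: h1|move: h2]; apply: rbm_eq => x /fg->. Qed.

Lemma cbm_cst k : cbm (fun=> k).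
Proof. by split; exact: rbm_cst. Qed.

Lemma cbmD f g : cbm f -> cbm g -> cbm (fun x => f x + g x).
Proof.
move=> [f1 f2] [g1 g2]; split; [have := rbmD f1 g1|have := rbmD f2 g2];
by apply: rbm_eq => x _; rewrite ?ReD ?ImD.
Qed.

Lemma cbmM f g : cbm f -> cbm g -> cbm (fun x => f x * g x).
Proof.
move=> [h1 h2] [g1 g2]; split.
  have := rbmB (rbmM h1 g1) (rbmM h2 g2).
  by apply: rbm_eq => x _; rewrite ReM.
have := rbmD (rbmM h1 g2) (rbmM h2 g1).
by apply: rbm_eq => x _; rewrite ImM.
Qed.

Lemma cbmZ k f : cbm f -> cbm (fun x => k * f x).
Proof. by move=> hf; apply: cbmM => //; exact: cbm_cst. Qed.

Lemma cbmN f : cbm f -> cbm (fun x => - f x).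
Proof. by move=> /(cbmZ (-1)); apply: cbm_eq => x _; rewrite mulN1r. Qed.

Lemma cbmB f g : cbm f -> cbm g -> cbm (fun x => f x - g x).
Proof. by move=> hf /cbmN; exact: cbmD. Qed.

Lemma cbm_real f : rbm f -> cbm (fun x => (f x)%:C).
Proof. by move=> hf; split => //=; exact: rbm_cst. Qed.

Lemma cL1_real f : rL1 f -> cL1 (fun x => (f x)%:C).
Proof. by move=> hf; split => //=; exact: rbm_L1 (rbm_cst 0). Qed.

Lemma cbm_L1 f : cbm f -> cL1 f.
Proof. by move=> [h1 h2]; split; exact: rbm_L1. Qed.

Lemma cL1Z k f : cL1 f -> cL1 (fun x => k * f x).
Proof. by move=> hf; apply: cL1M => //; exact: cbm_cst. Qed.

Lemma cL1_sum (I : Type) (r : seq I) (P : pred I) (F : I -> R -> C) :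
  (forall i, P i -> cL1 (F i)) -> cL1 (fun x => \sum_(i <- r | P i) F i x).
Proof.
move=> h; elim: r => [|i r IH].
  apply: (cL1_eq _ (cbm_L1 (cbm_cst 0))) => x _; by rewrite big_nil.
case Pi: (P i); last by apply: cL1_eq IH => x _; rewrite big_cons Pi.
by apply: cL1_eq (cL1D (h _ Pi) IH) => x _; rewrite big_cons Pi.
Qed.

Lemma cbm_bounded f : cbm f -> exists2 M : R, 0 <= M &
  forall x, 0 <= x <= 1 -> cmod (f x) <= M.
Proof.
move=> [[_ [M hM]] [_ [N hN]]]; exists (`|M| + `|N|) => [|x x01].
  by rewrite addr_ge0.
apply: (le_trans (cmod_le _)); apply: lerD.
  exact: le_trans (hM _ x01) (ler_norm _).
exact: le_trans (hN _ x01) (ler_norm _).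
Qed.

Lemma ReI x y f : complex.Re (cI x y f) = rI x y (fun s => complex.Re (f s)).
Proof. by rewrite cI.unlock rI.unlock. Qed.

Lemma ImI x y f : complex.Im (cI x y f) = rI x y (fun s => complex.Im (f s)).
Proof. by rewrite cI.unlock rI.unlock. Qed.

Lemma eq_cI f g x y : (forall s, x <= s <= y -> f s = g s) ->
  cI x y f = cI x y g.
Proof.
by move=> fg; apply: complex_ext; rewrite ?ReI ?ImI; apply: eq_rI => s /fg->.
Qed.

Lemma cID f g x y : cL1 f -> cL1 g -> 0 <= x -> y <= 1 ->
  cI x y (fun s => f s + g s) = cI x y f + cI x y g.
Proof.
move=> [f1 f2] [g1 g2] x0 y1.
apply: complex_ext; rewrite (ReD, ImD) !(ReI, ImI) -rID//.
  by apply: eq_rI => s _; rewrite ReD.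
by apply: eq_rI => s _; rewrite ImD.
Qed.

Lemma cIZ k f x y : cL1 f -> 0 <= x -> y <= 1 ->
  cI x y (fun s => k * f s) = k * cI x y f.
Proof.
move=> [f1 f2] x0 y1; apply: complex_ext.
  rewrite ReM !ReI ImI -!rIZ// -rIB//; try exact: rL1Z.
  by apply: eq_rI => s _; rewrite ReM.
rewrite ImM !ReI !ImI -!rIZ// -rID//; try exact: rL1Z.
by apply: eq_rI => s _; rewrite ImM.
Qed.

Lemma cIB f g x y : cL1 f -> cL1 g -> 0 <= x -> y <= 1 ->
  cI x y (fun s => f s - g s) = cI x y f - cI x y g.
Proof.
move=> hf hg x0 y1; rewrite -[- cI x y g]mulN1r -cIZ// -cID//; last exact: cL1Z.
by apply: eq_cI => s _; rewrite mulN1r.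
Qed.

Lemma cI0 x y : cI x y (fun=> 0) = 0.
Proof.
by apply: complex_ext; rewrite !(ReI, ImI) rI.unlock /Rintegral integral0.
Qed.

Lemma cI_sum (I : Type) (r : seq I) (F : I -> R -> C) x y :
  (forall i, cL1 (F i)) -> 0 <= x -> y <= 1 ->
  cI x y (fun s => \sum_(i <- r) F i s) = \sum_(i <- r) cI x y (F i).
Proof.
move=> h x0 y1; elim: r => [|i r IH].
  by rewrite big_nil -[RHS](cI0 x y); apply: eq_cI => s _; rewrite big_nil.
rewrite big_cons -IH -cID//; last exact: cL1_sum.
by apply: eq_cI => s _; rewrite big_cons.
Qed.

Lemma cI_split f x y : cL1 f -> 0 <= x -> x <= y -> y <= 1 ->
  cI 0 y f = cI 0 x f + cI x y f.
Proof.
move=> [f1 f2] x0 xy y1; apply: complex_ext; rewrite (ReD, ImD) !(ReI, ImI);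
exact: rI_split.
Qed.

Lemma cIxx f x : cI x x f = 0.
Proof. by apply: complex_ext; rewrite ?ReI ?ImI rIxx. Qed.

Lemma cI_real f x y : cI x y (fun s => (f s)%:C) = (rI x y f)%:C.
Proof.
apply: complex_ext; first by rewrite ReI.
by rewrite ImI rI.unlock /Rintegral /= integral0.
Qed.

Lemma cbm_cI f : cL1 f -> cbm (fun t => cI 0 t f).
Proof.
move=> [/rbm_rI h1 /rbm_rI h2].
by split; [apply: rbm_eq h1|apply: rbm_eq h2] => x _; rewrite !(ReI, ImI).
Qed.

(** Multiplication by a suitable number of modulus 1 makes the integral real and nonnegative, which
    reduces the claim to the comparison of real integrals. *)
Lemma cI_le f g x y : cL1 f -> rL1 g -> 0 <= x -> y <= 1 ->
  (forall s, x <= s <= y -> cmod (f s) <= g s) -> cmod (cI x y f) <= rI x y g.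
Proof.
move=> hf hg x0 y1 fg; have [u u1 hu] := polarization (cI x y f).
have -> : cmod (cI x y f) = complex.Re (u * cI x y f) by rewrite hu.
have huf := cL1Z u hf.
rewrite -cIZ// ReI; apply: rI_le => //; first by case: huf.
move=> s /fg; apply: le_trans; rewrite -[cmod (f s)]mul1r -u1 -cmodM.
by rewrite (le_trans (ler_norm _))// cmod_Re.
Qed.

Lemma cI_ae f g x y : cL1 f -> cL1 g -> ae_eq01 f g -> 0 <= x -> y <= 1 ->
  cI x y f = cI x y g.
Proof.
move=> [f1 f2] [g1 g2] fg x0 y1.
have aux (F G : R -> R) : rL1 F -> rL1 G ->
   {ae mu, forall x, (`[0, 1]%classic : set R) x -> F x = G x} ->
   rI x y F = rI x y G.
  move=> hF hG FG; rewrite rI.unlock; congr fine; apply: ae_eq_integral => //.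
  - by have /integrableP[] := rL1_sub hF x0 y1.
  - by have /integrableP[] := rL1_sub hG x0 y1.
  - apply: (@filterS _ _ (ae_filter_ringOfSetsType mu)) FG => s h; rewrite /= in_itv/= => /andP[xs sy]; congr EFin.
    by apply: h; rewrite in01 (le_trans x0 xs) (le_trans sy y1).
apply: complex_ext; rewrite !(ReI, ImI); apply: aux => //;
by apply: (@filterS _ _ (ae_filter_ringOfSetsType mu)) fg => s h /h ->.
Qed.

End Integration.

(** * Product and chain rules for absolutely continuous functions *)

Section AbsolutelyContinuous.
Context {R : realType}.
Notation C := R[i].

(** This is the form in which limits are taken throughout: an error halved at each step forces the
    quantity to be nonpositive. *)
Lemma le0_halving (a c : R) : (forall n, a <= c / 2 ^+ n) -> a <= 0.
Proof.
move=> h; rewrite leNgt; apply/negP => a0.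
have c0 : 0 < c by have := h 0%N; rewrite expr0 divr1; apply: lt_le_trans.
have [n _ hn] : \forall n \near \oo, c / a < n%:R by exact: nbhs_infty_gtr.
have {}hn := hn n (leqnn n).
have hn2 : n%:R <= (2 : R) ^+ n by rewrite -natrX ler_nat ltnW// ltn_expl.
have := h n; rewrite ler_pdivlMr ?exprn_gt0// leNgt => /negP; apply.
by rewrite mulrC -ltr_pdivrMr// (lt_le_trans hn).
Qed.

Lemma halving_small (c eps : R) : 0 < eps -> exists N, c / 2 ^+ N < eps.
Proof.
move=> eps0; apply: contrapT => h; suff : eps <= 0 by rewrite leNgt eps0.
apply: (@le0_halving _ c) => N; rewrite leNgt; apply/negP => hN.
by apply: h; exists N.
Qed.

(* An increment bound that is quadratic in a continuous function improves by a
   factor 2 at each bisection, so the increment vanishes. *)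
Lemma quadratic_increment_const (Phi : R -> C) (A : R -> R) (K : R) :
  {within `[0, 1], continuous A} ->
  (forall x y : R, 0 <= x -> x <= y -> y <= 1 -> A x <= A y) ->
  (forall x y : R, 0 <= x -> x <= y -> y <= 1 ->
     cmod (Phi y - Phi x) <= K * (A y - A x) ^+ 2) ->
  forall x : R, 0 <= x <= 1 -> Phi x = Phi 0.
Proof.
move=> cA mA hPhi x /andP[x0 x1].
suff h n : forall x y : R, 0 <= x -> x <= y -> y <= 1 ->
    cmod (Phi y - Phi x) <= K * (A y - A x) ^+ 2 / 2 ^+ n.
  apply/eqP; rewrite -subr_eq0 -cmod_eq0 eq_le cmod_ge0 andbT; apply/eqP.
  by apply/eqP/(@le0_halving _ (K * (A x - A 0) ^+ 2)) => n; exact: h.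
elim: n => [|n IH] {x x0 x1} x y x0 xy y1; first by rewrite expr0 divr1 hPhi.
have cAxy : {within `[x, y], continuous A}.
  apply: continuous_subspaceW cA.
  by apply: subset_itv; rewrite bnd_simp.
(* The cut is made where [A] takes the mean of its two end values, so that each half carries a
   quarter of the square. *)
have [|c + hc] := @IVT _ A x y ((A x + A y) / 2) xy cAxy.
  have := mA _ _ x0 xy y1; rewrite minElt maxElt; case: ltP => ? ?; lra.
rewrite in_itv /= => /andP[xc cy].
have -> : Phi y - Phi x = (Phi y - Phi c) + (Phi c - Phi x).
  by rewrite addrA subrK.
apply: le_trans (cmodD _ _) _.
have h1 := IH _ _ (le_trans x0 xc) cy y1.
have h2 := IH _ _ x0 xc (le_trans cy y1).
apply: le_trans (lerD h1 h2) _; rewrite -mulrDl -mulrDr hc.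
rewrite le_eqVlt; apply/orP; left; apply/eqP; rewrite [2 ^+ n.+1]exprS.
have : (2 : R) ^+ n != 0 by rewrite expf_neq0.
by move: (2 ^+ n) => P P0; field.
Qed.

(** A majorant of the modulus, without square root, whose integrability is immediate from that of
    the real and imaginary parts. *)
Definition absmaj (f : R -> C) (s : R) : R :=
  `|complex.Re (f s)| + `|complex.Im (f s)|.

Lemma absmaj_L1 f : cL1 f -> rL1 (absmaj f).
Proof. by move=> [h1 h2]; apply: rL1D; exact: rL1_abs. Qed.

Lemma absmaj_ge0 f s : 0 <= absmaj f s.
Proof. by rewrite addr_ge0. Qed.

Lemma cmod_absmaj f s : cmod (f s) <= absmaj f s.
Proof. exact: cmod_le. Qed.

Lemma rI_mono (k : R -> R) x y : rL1 k -> (forall s, 0 <= k s) ->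
  0 <= x -> x <= y -> y <= 1 -> rI 0 x k <= rI 0 y k.
Proof. by move=> hk k0 x0 xy y1; rewrite (rI_split hk x0 xy y1) lerDl rI_ge0. Qed.

Lemma W11P (f g : R -> C) : W11_deriv f g <->
  cL1 g /\ forall x : R, 0 <= x <= 1 -> f x = f 0 + cI 0 x g.
Proof.
rewrite cI.unlock.
by split=> -[hg h]; split => // x x01; apply: h; move: x01; rewrite in01.
Qed.

Lemma W11_L1 (f g : R -> C) : W11_deriv f g -> cL1 g.
Proof. by case. Qed.

Lemma W11_incr (f g : R -> C) (x y : R) : W11_deriv f g -> 0 <= x -> x <= y -> y <= 1 ->
  f y - f x = cI x y g.
Proof.
move=> /W11P[hg hf] x0 xy y1.
rewrite (hf x) ?x0 ?(le_trans xy)// (hf y) ?y1 ?(le_trans x0)//.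
by rewrite (cI_split hg x0 xy y1); ring.
Qed.

Lemma W11_bm (f g : R -> C) : W11_deriv f g -> cbm f.
Proof.
move=> /W11P[hg hf]; apply: cbm_eq (cbmD (cbm_cst (f 0)) (cbm_cI hg)) => x x01.
by rewrite (hf x x01).
Qed.

Lemma W11_ext (f g f1 g1 : R -> C) :
  (forall x : R, 0 <= x <= 1 -> f x = f1 x) ->
  (forall x : R, 0 <= x <= 1 -> g x = g1 x) ->
  W11_deriv f g -> W11_deriv f1 g1.
Proof.
move=> ff gg /W11P[hg hf]; apply/W11P; split; first exact: cL1_eq gg hg.
move=> x x01; rewrite -!ff ?lexx ?ler01// hf//.
congr (_ + _); apply: (@eq_cI _ _ _ 0 x) => s /andP[s0 sx].
by apply: gg; rewrite s0; case/andP: x01 => _; exact: le_trans.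
Qed.

(** Let Phi be the defect in the product rule. Its increment over [x, y] is the integral of (g y - g
    s) f' s minus the integral of (f s - f x) g' s. Each is at most the square of the integral of
    [k] over [x, y], so the quadratic increment criterion makes Phi constant, without any exchange
    of integrals. *)
Lemma W11M (f f' g g' : R -> C) : W11_deriv f f' -> W11_deriv g g' ->
  W11_deriv (fun x => f x * g x) (fun x => g x * f' x + f x * g' x).
Proof.
move=> hf hg; have [f1 g1] := (W11_L1 hf, W11_L1 hg).
have bf := W11_bm hf; have bg := W11_bm hg.
have hgf := cL1M bg f1; have hfg := cL1M bf g1.
have h1 := cL1D hgf hfg; apply/W11P; split => // t t01.
pose Phi t := f t * g t - cI 0 t (fun x => g x * f' x + f x * g' x).
suff : Phi t = Phi 0.
  by rewrite /Phi cIxx subr0 => /eqP; rewrite subr_eq => /eqP.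
pose k s := absmaj f' s + absmaj g' s.
have hk : rL1 k by apply: rL1D; exact: absmaj_L1.
have k0 s : 0 <= k s by rewrite addr_ge0 ?absmaj_ge0.
apply: (@quadratic_increment_const Phi (fun t => rI 0 t k) 2) t01.
- exact: rI_continuous.
- by move=> x y; exact: rI_mono.
move=> {t} x y x0 xy y1; have -> : rI 0 y k - rI 0 x k = rI x y k by rewrite (rI_split hk x0 xy y1); lra.
set dA := rI x y k.
have incr (u u' : R -> C) (a b : R) : W11_deriv u u' -> (forall s, absmaj u' s <= k s) ->
   x <= a -> a <= b -> b <= y -> cmod (u b - u a) <= dA.
  move=> hu uk xa ab by'.
  rewrite (W11_incr hu) ?(le_trans x0)// ?(le_trans by')//.
  have hu1 := W11_L1 hu.
  apply: (@le_trans _ _ (rI a b k)).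
    apply: cI_le => //; [exact: le_trans xa|exact: le_trans y1|].
    by move=> s _; exact: le_trans (cmod_absmaj _ _) (uk s).
  have E1 := rI_split hk (le_trans x0 xa) ab (le_trans by' y1).
  have E2 := rI_split hk x0 xy y1.
  have := rI_mono hk k0 x0 xa (le_trans ab (le_trans by' y1)).
  have := rI_mono hk k0 (le_trans x0 (le_trans xa ab)) by' y1.
  rewrite /dA; lra.
have uk1 s : absmaj f' s <= k s by rewrite lerDl absmaj_ge0.
have uk2 s : absmaj g' s <= k s by rewrite lerDr absmaj_ge0.
have -> : Phi y - Phi x = cI x y (fun s => (g y - g s) * f' s) -
    cI x y (fun s => (f s - f x) * g' s).
  have -> : cI x y (fun s => (g y - g s) * f' s) =
            g y * (f y - f x) - cI x y (fun s => g s * f' s).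
    rewrite (W11_incr hf)// -cIZ// -cIB//; last exact: cL1Z.
    by apply: eq_cI => s _; rewrite mulrBl.
  have -> : cI x y (fun s => (f s - f x) * g' s) =
            cI x y (fun s => f s * g' s) - f x * (g y - g x).
    rewrite (W11_incr hg)// -cIZ// -cIB//; last exact: cL1Z.
    by apply: eq_cI => s _; rewrite mulrBl.
  by rewrite /Phi (cI_split h1 x0 xy y1) (cID hgf hfg x0 y1); ring.
have bound (u v : R -> C) : cbm u -> cL1 v -> (forall s, absmaj v s <= k s) ->
    (forall s, x <= s <= y -> cmod (u s) <= dA) ->
    cmod (cI x y (fun s => u s * v s)) <= dA ^+ 2.
  move=> hu hv vk hud; rewrite expr2 -(rIZ _ hk)//.
  apply: cI_le => //; [exact: cL1M|exact: rL1Z|move=> s sxy].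
  rewrite cmodM ler_pM ?cmod_ge0 ?hud//.
  exact: le_trans (cmod_absmaj _ _) (vk s).
apply: le_trans (cmodB _ _) _; rewrite mulr2n mulrDl !mul1r lerD//.
  apply: bound => //; first exact: cbmB (cbm_cst _) bg.
  by move=> s /andP[xs sy]; exact: incr hg uk2 xs sy (lexx y).
apply: bound => //; first exact: cbmB bf (cbm_cst _).
by move=> s /andP[xs sy]; exact: incr hf uk1 (lexx x) xs sy.
Qed.

Lemma W11D (f f' g g' : R -> C) : W11_deriv f f' -> W11_deriv g g' ->
  W11_deriv (fun x => f x + g x) (fun x => f' x + g' x).
Proof.
move=> /W11P[f1 hf] /W11P[g1 hg]; apply/W11P; split; first exact: cL1D.
move=> x x01; rewrite hf// hg//; case/andP: x01 => x0 x1.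
by rewrite (cID f1 g1)// addrACA.
Qed.

Lemma W11Z a (f f' : R -> C) : W11_deriv f f' ->
  W11_deriv (fun x => a * f x) (fun x => a * f' x).
Proof.
move=> /W11P[f1 hf]; apply/W11P; split; first exact: cL1Z.
move=> x x01; rewrite hf//; case/andP: x01 => x0 x1.
by rewrite (cIZ _ f1)// mulrDr.
Qed.

Lemma W11B (f f' g g' : R -> C) : W11_deriv f f' -> W11_deriv g g' ->
  W11_deriv (fun x => f x - g x) (fun x => f' x - g' x).
Proof.
move=> hf /(W11Z (-1)) hg; have := W11D hf hg.
by apply: W11_ext => x _; rewrite mulN1r.
Qed.

Lemma rbm_exp_rI (k : R -> R) : rL1 k -> rbm (fun t => expR (rI 0 t k)).
Proof.
move=> hk; have [mk [M hM]] := rbm_rI hk; split.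
  exact: measurableT_comp mk.
exists (expR M) => x x01; rewrite ger0_norm ?expR_ge0// ler_expR.
exact: le_trans (ler_norm _) (hM _ x01).
Qed.

(** Chain rule for an absolutely continuous exponent K. With d the increment of K over [x, y], both
    the increment of exp K and the integral lie between exp (K x) d and exp (K y) d. They differ by
    at most exp (K 1) d^2, and the quadratic increment criterion applies. *)
Lemma rI_expR (k : R -> R) t : rL1 k -> (forall s, 0 <= k s) -> 0 <= t <= 1 ->
  rI 0 t (fun s => expR (rI 0 s k) * k s) = expR (rI 0 t k) - 1.
Proof.
move=> hk k0 t01; have hE := rbm_exp_rI hk; have hEk := rL1M hE hk.
pose K s := rI 0 s k.
pose Phi t : C := (expR (K t) - rI 0 t (fun s => expR (K s) * k s))%:C.
suff : Phi t = Phi 0 by case; rewrite /K !rIxx expR0; lra.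
apply: (@quadratic_increment_const Phi K (expR (K 1))) t01.
- exact: rI_continuous.
- by move=> x y; exact: rI_mono.
move=> {t} x y x0 xy y1; have Kxy := rI_mono hk k0 x0 xy y1.
rewrite -rmorphB cmod_real (rI_split hEk x0 xy y1).
have E1 := rI_split hk x0 xy y1.
have d0 : 0 <= K y - K x by rewrite subr_ge0.
have I1 : expR (K x) * (K y - K x) <= rI x y (fun s => expR (K s) * k s).
  have -> : K y - K x = rI x y k by rewrite /K; lra.
  rewrite -(rIZ (expR (K x)) hk x0 y1); apply: rI_le => //; first exact: rL1Z.
  move=> s /andP[xs sy]; rewrite ler_wpM2r// ler_expR.
  exact: rI_mono (le_trans sy y1).
have I2 : rI x y (fun s => expR (K s) * k s) <= expR (K y) * (K y - K x).
  have -> : K y - K x = rI x y k by rewrite /K; lra.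
  rewrite -(rIZ (expR (K y)) hk x0 y1); apply: rI_le => //; first exact: rL1Z.
  move=> s /andP[xs sy]; rewrite ler_wpM2r// ler_expR.
  by apply: rI_mono => //; exact: le_trans xs.
have J1 : expR (K x) * (K y - K x) <= expR (K y) - expR (K x).
  have -> : expR (K y) = expR (K x) * expR (K y - K x) by rewrite -expRD subrKC.
  rewrite -[X in _ <= _ - X]mulr1 -mulrBr ler_pM2l ?expR_gt0// lerBrDl.
  exact: expR_ge1Dx.
have J2 : expR (K y) - expR (K x) <= expR (K y) * (K y - K x).
  have -> : expR (K x) = expR (K y) * expR (K x - K y) by rewrite -expRD subrKC.
  rewrite -[X in X - _ <= _]mulr1 -mulrBr ler_pM2l ?expR_gt0// lerBlDr -lerBlDl.
  by have := expR_ge1Dx (K x - K y); lra.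
have J3 : expR (K y) <= expR (K 1).
  by rewrite ler_expR; apply: rI_mono => //; exact: le_trans xy.
have J4 : (expR (K y) - expR (K x)) * (K y - K x) <=
   expR (K 1) * (K y - K x) ^+ 2.
  rewrite expr2 mulrA ler_wpM2r// (le_trans J2)// ler_wpM2r//.
rewrite mulrBl in J4; rewrite ler_norml -/(K y) -/(K x).
set a := expR (K y) * _ in J2 I2 J4; set b := expR (K x) * _ in J1 I1 J4.
by set c := expR (K 1) * _ in J4 *; apply/andP; split; lra.
Qed.

End AbsolutelyContinuous.

(** * Linear systems of integral equations *)

Section LinearSystems.
Context {R : realType}.
Notation C := R[i].
Implicit Types (s t x y : R).

Lemma rL1_sum (I : Type) (r : seq I) (F : I -> R -> R) :
  (forall i, rL1 (F i)) -> rL1 (fun x => \sum_(i <- r) F i x).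
Proof.
move=> h; elim: r => [|i r IH].
  by apply: (rL1_eq _ (rbm_L1 (rbm_cst 0))) => x _; rewrite big_nil.
by apply: rL1_eq (rL1D (h i) IH) => x _; rewrite big_cons.
Qed.

(** Integration against [k] gains a factor 1 / th on the weight exp (th K). All contraction
    estimates below rest on this gain. *)
Lemma rI_expRM (th : R) (k : R -> R) t : rL1 k -> (forall s, 0 <= k s) ->
  0 < th -> 0 <= t <= 1 ->
  rI 0 t (fun s => k s * expR (th * rI 0 s k)) = (expR (th * rI 0 t k) - 1) / th.
Proof.
move=> hk k0 th0 /andP[t0 t1].
have hk2 := rL1Z th hk.
have k20 s : 0 <= th * k s by exact: mulr_ge0 (ltW th0) (k0 s).
have Es s : 0 <= s <= t -> rI 0 s (fun u => th * k u) = th * rI 0 s k.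
  by move=> /andP[s0 st]; rewrite rIZ// (le_trans st).
have := @rI_expR _ _ t hk2 k20; rewrite t0 t1 Es ?t0 ?lexx// => /(_ isT) <-.
have hE := rL1M (rbm_exp_rI hk2) hk2.
rewrite mulrC -(rIZ th^-1 hE)//; apply: eq_rI => s s0t; rewrite (Es _ s0t).
by field; rewrite gt_eqF.
Qed.

Lemma rbm_expM (th : R) (k : R -> R) : rL1 k ->
  rbm (fun t => expR (th * rI 0 t k)).
Proof.
move=> hk; apply: rbm_eq (rbm_exp_rI (rL1Z th hk)) => x /andP[x0 x1].
by rewrite rIZ.
Qed.

Section Comparison.
Variables (n : nat) (A : nat -> nat -> R -> C) (a : nat -> nat -> R -> R).
Hypothesis A_L1 : forall i j, cL1 (A i j).
Hypothesis a_L1 : forall i j, rL1 (a i j).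
Hypothesis A_le : forall i j s, cmod (A i j s) <= a i j s.

Let a_ge0 i j s : 0 <= a i j s.
Proof. exact: le_trans (cmod_ge0 _) (A_le _ _ _). Qed.

Let AY_L1 (Y : nat -> R -> C) i : (forall j, (j < n)%N -> cbm (Y j)) ->
  cL1 (fun s => \sum_(j < n) A i j s * Y j s).
Proof.
move=> hY; apply: cL1_sum => j _.
by apply: cL1_eq (cL1M (hY j (ltn_ord j)) (A_L1 i j)) => s _; rewrite mulrC.
Qed.

Let aZ_L1 (Z : nat -> R -> R) i : (forall j, (j < n)%N -> rbm (Z j)) ->
  rL1 (fun s => \sum_(j < n) a i j s * Z j s).
Proof.
move=> hZ; apply: rL1_sum => j.
by apply: rL1_eq (rL1M (hZ j (ltn_ord j)) (a_L1 i j)) => s _; rewrite mulrC.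
Qed.

(** A supersolution [Z] of the majorant system dominates every bounded solution. One starts from the
    crude bound Z + M E with E = exp (2 K), where K is the integral of all the majorants; inserting
    a bound into the equation halves its excess over [Z], because integration against [k] gains 1/2
    on E. *)
Lemma volterra_comparison (Y : nat -> R -> C) (c : nat -> C) (h : nat -> R -> C)
    (b Z : nat -> R -> R) :
  (forall i, (i < n)%N -> cbm (Y i)) ->
  (forall i, (i < n)%N -> rbm (Z i)) ->
  (forall i, cL1 (h i)) -> (forall i, rL1 (b i)) ->
  (forall i s, cmod (h i s) <= b i s) ->
  (forall i s, (i < n)%N -> 0 <= s <= 1 -> 0 <= Z i s) ->
  (forall i t, (i < n)%N -> 0 <= t <= 1 -> Y i t =
    c i + cI 0 t (fun s => \sum_(j < n) A i j s * Y j s + h i s)) ->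
  (forall i t, (i < n)%N -> 0 <= t <= 1 ->
    cmod (c i) + rI 0 t (fun s => \sum_(j < n) a i j s * Z j s + b i s) <= Z i t) ->
  forall i t, (i < n)%N -> 0 <= t <= 1 -> cmod (Y i t) <= Z i t.
Proof.
move=> hY hZ h1 b1 hb Z0 eY eZ i t iN t01.
pose k s := \sum_(i < n) \sum_(j < n) a i j s.
have hk : rL1 k by apply: rL1_sum => ?; exact: rL1_sum.
have k0 s : 0 <= k s by rewrite sumr_ge0// => ? _; rewrite sumr_ge0.
have akn (i' : 'I_n) s : \sum_(j < n) a i' j s <= k s.
  by rewrite /k [leRHS](bigD1 i')//= lerDl sumr_ge0// => ? _; rewrite sumr_ge0.
have [M M0 hM] : exists2 M : R, 0 <= M & forall i s, (i < n)%N -> 0 <= s <= 1 ->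
    cmod (Y i s) <= M.
  have hex : forall i : 'I_n, exists M : R, 0 <= M /\
      forall s, 0 <= s <= 1 -> cmod (Y i s) <= M.
    by move=> j; have [M ? ?] := cbm_bounded (hY j (ltn_ord j)); exists M.
  have [M hM] := choice hex; exists (\sum_j M j).
    by rewrite sumr_ge0// => j _; case: (hM j).
  move=> j s jn s01; have [_ /(_ s s01) h'] := hM (Ordinal jn).
  rewrite (le_trans h')// (bigD1 (Ordinal jn))//= lerDl sumr_ge0// => j' _.
  by case: (hM j').
pose E s := expR (2 * rI 0 s k).
have bE : rbm E by exact: rbm_expM.
have E1 s : 0 <= s <= 1 -> 1 <= E s.
  by move=> /andP[s0 s1]; rewrite -expR0 ler_expR mulr_ge0// rI_ge0.
have step m : forall i t, (i < n)%N -> 0 <= t <= 1 ->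
    cmod (Y i t) <= Z i t + M * E t / 2 ^+ m.
  elim: m => [|m IH] {}i {}t {}iN {}t01.
    rewrite expr0 divr1 (le_trans (hM _ _ iN t01))//.
    by have := Z0 i t iN t01; have := E1 t t01; nra.
  have /andP[t0 t1] := t01; rewrite (eY i t iN t01).
  pose W j s := Z j s + M * E s / 2 ^+ m.
  have bME : rbm (fun s => M * E s / 2 ^+ m).
    by apply: rbmM (rbmM (rbm_cst _) bE) (rbm_cst _).
  have bW j : (j < n)%N -> rbm (W j) by move=> jn; apply: rbmD => //; exact: hZ.
  have hWb := rL1D (aZ_L1 i bW) (b1 i).
  have hZb := rL1D (aZ_L1 i hZ) (b1 i).
  have hEk := rL1M bE hk.
  have J1 : cmod (cI 0 t (fun s => \sum_(j < n) A i j s * Y j s + h i s)) <=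
      rI 0 t (fun s => \sum_(j < n) a i j s * W j s + b i s).
    apply: cI_le => //; first by apply: cL1D => //; exact: AY_L1.
    move=> s /andP[s0 st]; have s1 := le_trans st t1.
    apply: le_trans (cmodD _ _) (lerD _ (hb _ _)).
    apply: le_trans (cmod_sum _ _ _) _; apply: ler_sum => j _.
    by rewrite cmodM ler_pM ?cmod_ge0// IH// s0.
  have J2 : rI 0 t (fun s => \sum_(j < n) a i j s * W j s + b i s) <=
     rI 0 t (fun s => (\sum_(j < n) a i j s * Z j s + b i s) +
        (M / 2 ^+ m) * (k s * E s)).
    apply: rI_le => //.
      by apply: rL1D => //; apply: rL1Z; apply: rL1_eq hEk => s _; rewrite mulrC.
    move=> s /andP[s0 st]; rewrite addrAC lerD2r.
    under eq_bigr do rewrite mulrDr; rewrite big_split/= lerD2l -mulr_suml.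
    have := akn (Ordinal iN) s => /= hak.
    have -> : M / 2 ^+ m * (k s * E s) = k s * (M * E s / 2 ^+ m) by ring.
    by rewrite ler_wpM2r// !mulr_ge0 ?invr_ge0 ?exprn_ge0// expR_ge0.
  have J3 : rI 0 t (fun s => (\sum_(j < n) a i j s * Z j s + b i s) +
        (M / 2 ^+ m) * (k s * E s)) =
     rI 0 t (fun s => \sum_(j < n) a i j s * Z j s + b i s) +
     M / 2 ^+ m * ((E t - 1) / 2).
    have hkE : rL1 (fun s => k s * E s) by apply: rL1_eq hEk => s _; rewrite mulrC.
    by rewrite (rID hZb (rL1Z _ hkE))// (rIZ _ hkE)// rI_expRM.
  have J4 : M / 2 ^+ m * ((E t - 1) / 2) <= M * E t / 2 ^+ m.+1.
    rewrite [2 ^+ m.+1]exprS -subr_ge0.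
    have P0 : 0 < (2 : R) ^+ m by rewrite exprn_gt0.
    have -> : M * E t / (2 * 2 ^+ m) - M / 2 ^+ m * ((E t - 1) / 2) =
              M / 2 ^+ m / 2.
      by move: P0; move: (2 ^+ m) => P P0; field; rewrite gt_eqF.
    by rewrite !divr_ge0// ltW.
  have := eZ i t iN t01; have := cmodD (c i) (cI 0 t (fun s => \sum_(j < n) A i j s * Y j s + h i s)).
  move: J1 J2 J4; rewrite J3; lra.
suff : cmod (Y i t) - Z i t <= 0 by rewrite subr_le0.
by apply: (@le0_halving _ _ (M * E t)) => m; have := step m i t iN t01; lra.
Qed.

Definition linsol (c : nat -> C) (Y : nat -> R -> C) : Prop :=
  forall i, (i < n)%N -> cbm (Y i) /\ forall t, 0 <= t <= 1 ->
    Y i t = c i + cI 0 t (fun s => \sum_(j < n) A i j s * Y j s).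

Fixpoint picard (c : nat -> C) (N : nat) (i : nat) (t : R) : C :=
  if N is N'.+1 then c i + cI 0 t (fun s => \sum_(j < n) A i j s * picard c N' j s)
  else 0.

Lemma picard_bm c N i : cbm (picard c N i).
Proof.
elim: N i => [|N IH] i /=; first exact: cbm_cst.
by apply: cbmD; [exact: cbm_cst|apply: cbm_cI; exact: AY_L1].
Qed.

Section Weights.
Variables (w : nat -> R) (k : R -> R) (M : R) (c : nat -> C).
Hypothesis w0 : forall i, 0 < w i.
Hypothesis k_L1 : rL1 k.
Hypothesis k0 : forall s, 0 <= k s.
Hypothesis aw : forall i s, (i < n)%N -> \sum_(j < n) a i j s * w j <= w i * k s.
Hypothesis M0 : 0 <= M.
Hypothesis cM : forall i, (i < n)%N -> cmod (c i) <= M * w i.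

Let Mw i : 0 <= M * w i.
Proof. exact: mulr_ge0 M0 (ltW (w0 i)). Qed.

(** In the norm with weights [w] the matrix is bounded by the scalar [k], and the factor exp (th K)
    turns one integration into a gain of 1 / th. The weights serve to balance components of
    different orders in the spectral parameter. *)
Let weighted_step (th : R) (U : nat -> R -> C) i t N : 1 <= th ->
  (forall j, (j < n)%N -> cbm (U j)) -> (i < n)%N -> 0 <= t <= 1 ->
  (forall j s, (j < n)%N -> 0 <= s <= 1 ->
     cmod (U j s) <= M * w j * expR (th * rI 0 s k) / th ^+ N) ->
  cmod (cI 0 t (fun s => \sum_(j < n) A i j s * U j s)) <=
    M * w i * (expR (th * rI 0 t k) - 1) / th ^+ N.+1.
Proof.
move=> th1 hU iN t01 hb; have /andP[t0 t1] := t01.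
have th0 : 0 < th by apply: lt_le_trans th1.
have bE := rbm_expM th k_L1.
have hkE : rL1 (fun s => k s * expR (th * rI 0 s k)).
  by apply: rL1_eq (rL1M bE k_L1) => s _; rewrite mulrC.
have -> : M * w i * (expR (th * rI 0 t k) - 1) / th ^+ N.+1 =
    rI 0 t (fun s => (M * w i / th ^+ N) * (k s * expR (th * rI 0 s k))).
  rewrite (rIZ _ hkE)// rI_expRM// exprS.
  have := expf_neq0 N (lt0r_neq0 th0); move: (th ^+ N) => P P0; field.
  by rewrite P0 gt_eqF.
apply: cI_le => //; [exact: AY_L1|exact: rL1Z|move=> s /andP[s0 st]].
have s1 := le_trans st t1.
apply: le_trans (cmod_sum _ _ _) _.
apply: (@le_trans _ _ (\sum_(j < n) (a i j s * w j) *
          (M * expR (th * rI 0 s k) / th ^+ N))).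
  apply: ler_sum => j _; rewrite cmodM.
  apply: (@le_trans _ _ (a i j s * (M * w j * expR (th * rI 0 s k) / th ^+ N))).
    by rewrite ler_pM ?cmod_ge0// hb// s0.
  by rewrite le_eqVlt; apply/orP; left; apply/eqP; ring.
rewrite -mulr_suml.
have -> : M * w i / th ^+ N * (k s * expR (th * rI 0 s k)) =
  (w i * k s) * (M * expR (th * rI 0 s k) / th ^+ N) by ring.
by rewrite ler_wpM2r ?aw// !mulr_ge0 ?expR_ge0// invr_ge0 exprn_ge0// ltW.
Qed.

(** The function M w_i exp (th K) is a supersolution as soon as [th >= 1]. *)
Lemma linsol_bound Y (th : R) : 1 <= th -> linsol c Y ->
  forall i t, (i < n)%N -> 0 <= t <= 1 ->
  cmod (Y i t) <= M * w i * expR (th * rI 0 t k).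
Proof.
move=> th1 hY; have th0 : 0 < th by apply: lt_le_trans th1.
have bE := rbm_expM th k_L1.
have hkE : rL1 (fun s => k s * expR (th * rI 0 s k)).
  by apply: rL1_eq (rL1M bE k_L1) => s _; rewrite mulrC.
apply: (@volterra_comparison Y c (fun _ _ => 0) (fun _ _ => 0)
  (fun i t => M * w i * expR (th * rI 0 t k))).
- by move=> i /hY[].
- by move=> i _; apply: rbmM (rbm_cst _) bE.
- by move=> _; exact: cbm_L1 (cbm_cst 0).
- by move=> _; exact: rbm_L1 (rbm_cst 0).
- by move=> _ s; rewrite cmod0.
- by move=> i s _ _; rewrite !mulr_ge0 ?expR_ge0// ltW.
- move=> i t iN t01; have [_ ->//] := hY i iN; congr (_ + _).
  by apply: eq_cI => s _; rewrite addr0.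
move=> i t iN t01; have /andP[t0 t1] := t01.
apply: (@le_trans _ _ (M * w i +
   rI 0 t (fun s => (M * w i) * (k s * expR (th * rI 0 s k))))).
  apply: lerD; first exact: cM.
  apply: rI_le => //; [|exact: rL1Z|].
    apply: rL1D (rbm_L1 (rbm_cst 0)).
    apply: (@aZ_L1 (fun j s => M * w j * expR (th * rI 0 s k))) => j _.
    exact: rbmM (rbm_cst _) bE.
  move=> s _; rewrite addr0.
  have -> : M * w i * (k s * expR (th * rI 0 s k)) =
    (w i * k s) * (M * expR (th * rI 0 s k)) by ring.
  apply: (@le_trans _ _ ((\sum_(j < n) a i j s * w j) * (M * expR (th * rI 0 s k)))).
    rewrite mulr_suml; apply: ler_sum => j _.
    by rewrite le_eqVlt; apply/orP; left; apply/eqP; ring.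
  by rewrite ler_wpM2r ?aw// mulr_ge0 ?expR_ge0.
rewrite (rIZ _ hkE)// rI_expRM//.
have E1 : 1 <= expR (th * rI 0 t k).
  by rewrite -expR0 ler_expR mulr_ge0 ?rI_ge0// ltW.
have hle : (expR (th * rI 0 t k) - 1) / th <= expR (th * rI 0 t k) - 1.
  by rewrite ler_pdivrMr// ler_peMr// subr_ge0.
apply: le_trans (lerD (lexx _) (ler_wpM2l (Mw i) hle)) _; lra.
Qed.

(** Leaving [th] free makes this a whole family of rates: a larger [th] gives faster geometric decay
    at the price of a larger exponential. The minimum modulus estimate chooses [th] only at the
    end. *)
Lemma picard_error Y (th : R) N : 1 <= th -> linsol c Y ->
  forall i t, (i < n)%N -> 0 <= t <= 1 ->
  cmod (Y i t - picard c N i t) <= M * w i * expR (th * rI 0 t k) / th ^+ N.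
Proof.
move=> th1 hY; have th0 : 0 < th by apply: lt_le_trans th1.
elim: N => [|N IH] i t iN t01 /=.
  by rewrite subr0 expr0 divr1; exact: linsol_bound.
have /andP[t0 t1] := t01; have [_ ->//] := hY i iN.
rewrite opprD addrACA subrr add0r -cIB//; last 2 first.
- by apply: AY_L1 => j /hY[].
- by apply: AY_L1 => j _; exact: picard_bm.
have -> : cI 0 t (fun s => \sum_(j < n) A i j s * Y j s -
     \sum_(j < n) A i j s * picard c N j s) =
   cI 0 t (fun s => \sum_(j < n) A i j s * (Y j s - picard c N j s)).
  by apply: eq_cI => s _; rewrite -sumrB; apply: eq_bigr => j _; rewrite mulrBr.
apply: le_trans (@weighted_step th (fun j s => Y j s - picard c N j s) i t N th1 _ iN t01 IH) _.
  by move=> j /hY[hj _]; apply: cbmB hj (picard_bm _ _ _).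
apply: ler_wpM2r; first by rewrite invr_ge0 exprn_ge0// ltW.
by apply: ler_wpM2l => //; rewrite gerBl.
Qed.

(** With [th] equal to 2, successive iterates differ by a geometric sequence, uniformly in [t]. The
    limit is therefore bounded and measurable, and the integral equation passes to it. *)
Lemma linsol_exists : exists Y, linsol c Y.
Proof.
pose E t := expR (2 * rI 0 t k).
have th1 : (1 : R) <= 2 by lra.
have bE : rbm E := rbm_expM 2 k_L1.
have hstep N : forall i t, (i < n)%N -> 0 <= t <= 1 ->
    cmod (picard c N.+1 i t - picard c N i t) <= M * w i * E t / 2 ^+ N.
  elim: N => [|N IH] i t iN t01.
    rewrite subr0 expr0 divr1.
    have -> : picard c 1 i t = c i.
      rewrite /= [X in _ + X](_ : _ = 0) ?addr0// -[RHS](cI0 0 t).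
      by apply: eq_cI => s _; rewrite big1// => j _; rewrite mulr0.
    apply: le_trans (cM iN) _; rewrite ler_peMr//.
    by rewrite -expR0 ler_expR mulr_ge0// rI_ge0.
  have /andP[t0 t1] := t01.
  have -> : picard c N.+2 i t - picard c N.+1 i t =
    cI 0 t (fun s => \sum_(j < n) A i j s * (picard c N.+1 j s - picard c N j s)).
    rewrite [picard c N.+2 i t]/= [picard c N.+1 i t]/= opprD addrACA subrr add0r -cIB//;
      [|exact: (@AY_L1 (picard c N.+1) i (fun j _ => picard_bm c N.+1 j))
       |exact: (@AY_L1 (picard c N) i (fun j _ => picard_bm c N j))].
    by apply: eq_cI => s _; rewrite -sumrB; apply: eq_bigr => j _; rewrite mulrBr.
  apply: le_trans (@weighted_step 2 (fun j s => picard c N.+1 j s - picard c N j s) i t N th1 _ iN t01 IH) _.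
    by move=> j _; exact: cbmB (picard_bm _ _ _) (picard_bm _ _ _).
  apply: ler_wpM2r; first by rewrite invr_ge0 exprn_ge0.
  by apply: ler_wpM2l => //; rewrite gerBl.
(* This is the tail of the geometric series of increments, so that the bounds telescope. *)
pose e i t N := 2 * (M * w i * E t) / 2 ^+ N.
have ME0 i t : 0 <= M * w i * E t by rewrite !mulr_ge0 ?expR_ge0// ltW.
have hcauchy i t m N : (i < n)%N -> 0 <= t <= 1 ->
    cmod (picard c (N + m) i t - picard c N i t) <= e i t N - e i t (N + m)%N.
  move=> iN t01; elim: m => [|m IH]; first by rewrite addn0 !subrr cmod0.
  apply: le_trans (cmod_dist_trans (picard c (N + m) i t) _ _) _.
  apply: le_trans (lerD _ IH) _; first by rewrite addnS; exact: hstep.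
  rewrite /e addnS [2 ^+ (N + m).+1]exprS.
  have := expf_neq0 (N + m) (lt0r_neq0 (ltr0n R 2)).
  set B := M * w i * E t; move: (2 ^+ (N + m)) => P P0.
  suff -> : B / P = 2 * B / P - 2 * B / (2 * P) by lra.
  by field.
have hlim i : (i < n)%N -> forall t, 0 <= t <= 1 ->
    exists l, forall N, cmod (picard c N i t - l) <= 2 * e i t N.
  move=> iN t t01; apply: cauchy_limit.
    by move=> eps eps0; exact: halving_small.
  move=> m N; wlog mN : m N / (N <= m)%N => [hw|].
    have [|/ltnW] := leqP N m; first exact: hw.
    by rewrite cmod_distC [e i t m + _]addrC => /hw.
  have := hcauchy i t (m - N)%N N iN t01; rewrite subnKC// => h'.
  have : 0 <= e i t m by rewrite /e divr_ge0 ?exprn_ge0// mulr_ge0.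
  by move: h'; lra.
have hY : forall it : nat * R, exists l, (it.1 < n)%N -> 0 <= it.2 <= 1 ->
    forall N, cmod (picard c N it.1 it.2 - l) <= 2 * e it.1 it.2 N.
  move=> [i t] /=; have [iN|] := pselect (i < n)%N; last by exists 0.
  have [t01|] := pselect (0 <= t <= 1); last by exists 0.
  by have [l hl] := hlim i iN t t01; exists l.
have [Y0 hY0] := choice hY; pose Y i t := Y0 (i, t).
have {hY0} hY0 i t N : (i < n)%N -> 0 <= t <= 1 ->
    cmod (Y i t - picard c N i t) <= 2 * e i t N.
  by move=> iN t01; rewrite cmod_distC; exact: (hY0 (i, t)).
have [ME hME] : exists ME : R, forall i t, (i < n)%N -> 0 <= t <= 1 ->
    4 * (M * w i * E t) <= ME.
  pose W : R := \sum_(j < n) w j; have [_ [B hB]] := bE; exists (4 * (M * W * B)) => i t iN t01.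
  have wW : w i <= W.
    by rewrite /W (bigD1 (Ordinal iN))//= lerDl sumr_ge0// => j _; exact: ltW.
  rewrite ler_pM2l// ler_pM ?expR_ge0//.
    by rewrite ler_wpM2l.
  exact: le_trans (ler_norm _) (hB _ t01).
have {hY0} hY0 i t N : (i < n)%N -> 0 <= t <= 1 ->
    cmod (Y i t - picard c N i t) <= ME / 2 ^+ N.
  move=> iN t01; apply: le_trans (hY0 _ _ N iN t01) _.
  rewrite /e mulrA ler_wpM2r ?invr_ge0 ?exprn_ge0//.
  by apply: le_trans (hME _ _ iN t01); lra.
have bY i : (i < n)%N -> cbm (Y i).
  move=> iN.
  have aux (p : C -> R) : (forall z z', p (z - z') = p z - p z') ->
      (forall z, `|p z| <= cmod z) ->
      (forall N, rbm (fun x => p (picard c N i x))) -> rbm (fun x => p (Y i x)).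
    move=> pB ple hp; split.
      apply: (@measurable_fun_cvg _ _ _ _ (fun N x => p (picard c N i x))).
        by move=> N; case: (hp N).
      move=> x; rewrite in01 => x01; apply/cvgrPdist_le => eps eps0.
      have [N0 /ltW hN0] := halving_small ME eps0.
      exists N0 => // N /= N0N; rewrite -pB (le_trans (ple _))//.
      rewrite (le_trans (hY0 _ _ N iN x01))// (le_trans _ hN0)//.
      have ME0' : 0 <= ME by rewrite (le_trans _ (hME _ _ iN x01))// mulr_ge0.
      by rewrite ler_wpM2l// lef_pV2 ?posrE ?exprn_gt0// ler_weXn2l.
    exists ME => x x01; apply: le_trans (ple _) _.
    by have := hY0 _ _ 0%N iN x01; rewrite subr0 expr0 divr1.
  split; apply: aux; try exact: ReB; try exact: ImB; try exact: cmod_Re;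
    try exact: cmod_Im; by move=> N; have [] := picard_bm c N i.
exists Y => i iN; split; first exact: bY.
move=> t t01; have /andP[t0 t1] := t01.
apply/eqP; rewrite -subr_eq0 -cmod_eq0 eq_le cmod_ge0 andbT.
pose ka s := \sum_(j < n) a i j s.
have hka : rL1 ka by exact: rL1_sum.
apply: (@le0_halving _ _ (ME + rI 0 t ka * ME)) => N.
apply: le_trans (cmod_dist_trans (picard c N.+1 i t) _ _) _.
rewrite mulrDl; apply: lerD.
  apply: le_trans (hY0 _ _ N.+1 iN t01) _.
  have ME0' : 0 <= ME by rewrite (le_trans _ (hME _ _ iN t01))// mulr_ge0.
  by rewrite ler_wpM2l// lef_pV2 ?posrE ?exprn_gt0// ler_weXn2l.
rewrite /= opprD addrACA subrr add0r -cIB//; last 2 first.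
- by apply: AY_L1 => j _; exact: picard_bm.
- by apply: AY_L1.
rewrite -mulrA [X in _ <= X]mulrC -(rIZ _ hka)//; apply: cI_le => //.
- by apply: cL1B; apply: AY_L1 => // j _; exact: picard_bm.
- exact: rL1Z.
move=> s /andP[s0 st]; have s1 := le_trans st t1.
rewrite -sumrB; apply: le_trans (cmod_sum _ _ _) _.
rewrite mulr_sumr; apply: ler_sum => j _.
rewrite -mulrBr cmodM mulrC ler_pM ?cmod_ge0// cmod_distC.
by apply: hY0 => //; rewrite s0.
Qed.

End Weights.
End Comparison.

(** The matrix is affine in [lam] and the iteration starts from zero, so the [N]-th iterate has
    degree less than [N] in [lam]. Its coefficients are obtained by collecting the powers of [lam]
    in one Picard step. *)
Lemma picard_poly n (A0 A1 : nat -> nat -> R -> C) (c : nat -> C) :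
  (forall i j, cL1 (A0 i j)) -> (forall i j, cL1 (A1 i j)) ->
  forall N, exists d : nat -> nat -> R -> C,
  [/\ forall i l, cbm (d i l), forall i l t, (N <= l)%N -> d i l t = 0 &
   forall lam i t, 0 <= t <= 1 ->
   picard n (fun i j s => A0 i j s + lam * A1 i j s) c N i t =
     \sum_(l < N) lam ^+ l * d i l t].
Proof.
move=> h0 h1; elim => [|N [d [bd d0 hd]]].
  exists (fun _ _ _ => 0); split=> //; first by move=> *; exact: cbm_cst.
  by move=> lam i t _; rewrite big_ord0.
pose g i l s := \sum_(j < n) (A0 i j s * d j l s +
   if l is l'.+1 then A1 i j s * d j l' s else 0).
have Ad (A : nat -> nat -> R -> C) i j l : (forall i j, cL1 (A i j)) ->
    cL1 (fun s => A i j s * d j l s).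
  by move=> hA; apply: cL1_eq (cL1M (bd j l) (hA i j)) => s _; rewrite mulrC.
have hg i l : cL1 (g i l).
  apply: cL1_sum => j _; apply: cL1D; first exact: Ad.
  by case: l => [|l]; [exact: cbm_L1 (cbm_cst 0)|exact: Ad].
exists (fun i l t => (if l is 0%N then c i else 0) + cI 0 t (g i l)); split.
- by move=> i l; apply: cbmD; [exact: cbm_cst|exact: cbm_cI].
- move=> i [//|l] t Nl; rewrite add0r -[RHS](cI0 0 t); apply: eq_cI => s _.
  rewrite /g big1// => j _; rewrite !d0 ?mulr0 ?addr0//; exact: ltnW.
move=> lam i t t01; have /andP[t0 t1] := t01.
have -> : \sum_(l < N.+1) lam ^+ l * ((if l : nat is 0%N then c i else 0) + cI 0 t (g i l))
   = c i + \sum_(l < N.+1) lam ^+ l * cI 0 t (g i l).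
  under eq_bigr do rewrite mulrDr; rewrite big_split/=; congr (_ + _).
  by rewrite big_ord_recl/= expr0 mul1r big1 ?addr0// => l _; rewrite mulr0.
have -> : \sum_(l < N.+1) lam ^+ l * cI 0 t (g i l) =
   cI 0 t (fun s => \sum_(l < N.+1) lam ^+ l * g i l s).
  rewrite cI_sum//; first by apply: eq_bigr => l _; rewrite cIZ.
  by move=> l; exact: cL1Z.
rewrite /=; congr (_ + _); apply: eq_cI => s /andP[s0 st].
have s01 : 0 <= s <= 1 by rewrite s0 (le_trans st).
rewrite /g; under [RHS]eq_bigr do rewrite mulr_sumr.
rewrite exchange_big/=; apply: eq_bigr => j _; rewrite hd// mulrDl.
under [RHS]eq_bigr do rewrite mulrDr; rewrite big_split/=; congr (_ + _).
  rewrite big_ord_recr/= d0// !mulr0 addr0 mulr_sumr.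
  by apply: eq_bigr => l _; rewrite mulrCA.
rewrite big_ord_recl/= mulr0 add0r mulr_sumr; apply: eq_bigr => l _ /=.
by rewrite /bump leq0n add1n exprS; ring.
Qed.

End LinearSystems.

(** * The fourth-order equation and its second compound *)

Section FourthOrder.
Context {R : realType}.
Notation C := R[i].
Implicit Types (s t x y : R) (L : problem R) (lam mu : C).

Lemma W11_ae (f g g1 : R -> C) : W11_deriv f g -> cL1 g1 -> ae_eq01 g g1 ->
  W11_deriv f g1.
Proof.
move=> /W11P[hg hf] hg1 gg; apply/W11P; split => // x x01.
by rewrite hf//; congr (_ + _); case/andP: x01 => ? ?; exact: cI_ae.
Qed.

Definition sys4 L lam (Y : nat -> R -> C) : Prop :=
  [/\ W11_deriv (Y 0%N) (Y 1%N), W11_deriv (Y 1%N) (Y 2%N),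
   W11_deriv (Y 2%N) (fun x => Y 3%N x + coef_p L x * Y 1%N x) &
   W11_deriv (Y 3%N) (fun x => (lam - coef_q L x) * Y 0%N x)].

(** Integrals do not see null sets: in [W11_deriv] the derivative may be replaced by any integrable
    function equal to it almost everywhere. Both almost-everywhere conditions thereby become part of
    a first-order system. *)
Lemma is_solutionP L lam Y : is_solution L lam Y <-> sys4 L lam Y.
Proof.
have pL := coef_p_L1 L; have qL := coef_q_L1 L.
have ae_of_all (P : R -> Prop) : (forall x, P x) -> {ae @lebesgue_measure R, forall x, P x}.
  by move=> h; apply: (@filterE _ _ (ae_filter_ringOfSetsType lebesgue_measure)).
split.
  move=> [[h0 h1 [y3 h2 e3] [g h3]] [g' h3' e4]].
  split => //.
    have b1 := W11_bm h1; have b3 := W11_bm h3.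
    apply: (W11_ae h2).
      apply: cL1D (cbm_L1 b3) _.
      by apply: cL1_eq (cL1M b1 pL) => x _; rewrite mulrC.
    apply: (@filterS _ _ (ae_filter_ringOfSetsType lebesgue_measure)) e3.
    by move=> x hx /hx ->; rewrite subrK.
  have b0 := W11_bm h0.
  apply: (W11_ae h3').
    have := cL1B (cbm_L1 (cbmZ lam b0)) (cL1M b0 qL).
    by apply: cL1_eq => x _; ring.
  apply: (@filterS _ _ (ae_filter_ringOfSetsType lebesgue_measure)) e4.
  by move=> x hx /hx /eqP; rewrite -subr_eq0 => /eqP h; apply/eqP;
    rewrite -subr_eq0 -h; apply/eqP; ring.
move=> [h0 h1 h2 h3]; split.
  split => //; last by exists (fun x => (lam - coef_q L x) * Y 0%N x).
  exists (fun x => Y 3%N x + coef_p L x * Y 1%N x) => //.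
  by apply: ae_of_all => x _; rewrite addrK.
exists (fun x => (lam - coef_q L x) * Y 0%N x) => //.
by apply: ae_of_all => x _; ring.
Qed.

Definition A4 L lam (i j : nat) (s : R) : C :=
  match i, j with
  | 0, 1 => 1 | 1, 2 => 1 | 2, 3 => 1
  | 2, 1 => coef_p L s
  | 3, 0 => lam - coef_q L s
  | _, _ => 0
  end.

Lemma A4_L1 L lam i j : cL1 (A4 L lam i j).
Proof.
have pL := coef_p_L1 L; have qL := coef_q_L1 L.
have h (z : C) : cL1 (fun=> z) by exact: cbm_L1 (cbm_cst z).
by case: i => [|[|[|[|i]]]]; case: j => [|[|[|[|j]]]];
  first [exact: h|exact: pL|exact: cL1B].
Qed.

Lemma A4E L lam i (Y : nat -> R -> C) s : (i < 4)%N ->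
  \sum_(j < 4) A4 L lam i j s * Y j s =
  match i with
  | 0 => Y 1%N s | 1 => Y 2%N s | 2 => Y 3%N s + coef_p L s * Y 1%N s
  | _ => (lam - coef_q L s) * Y 0%N s
  end.
Proof.
by case: i => [|[|[|[|]]]] // _; rewrite !big_ord_recl big_ord0 /=; ring.
Qed.

Lemma sys4_linsol L lam Y : sys4 L lam Y ->
  linsol 4 (A4 L lam) (fun i => Y i 0) Y.
Proof.
move=> [h0 h1 h2 h3] i iN; split.
  by case: i iN => [|[|[|[|]]]] // _;
    [exact: W11_bm h0|exact: W11_bm h1|exact: W11_bm h2|exact: W11_bm h3].
move=> t t01; have E : cI 0 t (fun s => \sum_(j < 4) A4 L lam i j s * Y j s) =
    cI 0 t (fun s => match i with
  | 0 => Y 1%N s | 1 => Y 2%N s | 2 => Y 3%N s + coef_p L s * Y 1%N s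
  | _ => (lam - coef_q L s) * Y 0%N s end).
  by apply: eq_cI => s _; exact: A4E.
rewrite E; case: i iN {E} => [|[|[|[|]]]] // _;
by [case/W11P: h0 => _ ->|case/W11P: h1 => _ ->|case/W11P: h2 => _ ->|case/W11P: h3 => _ ->].
Qed.

Lemma linsol_sys4 L lam c Y : linsol 4 (A4 L lam) c Y ->
  sys4 L lam Y /\ forall i, (i < 4)%N -> Y i 0 = c i.
Proof.
move=> h.
have Y0 i : (i < 4)%N -> Y i 0 = c i.
  by move=> iN; have [_ ->] := h i iN; rewrite ?cIxx ?addr0// lexx ler01.
split => //.
have hb i : (i < 4)%N -> cbm (Y i) by move=> /h[].
have W i f : (i < 4)%N -> cL1 f ->
    (forall s, \sum_(j < 4) A4 L lam i j s * Y j s = f s) -> W11_deriv (Y i) f.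
  move=> iN hf hE; apply/W11P; split => // x x01.
  rewrite Y0//; have [_ ->//] := h i iN; congr (_ + _).
  by apply: eq_cI => s _; exact: hE.
have pL := coef_p_L1 L; have qL := coef_q_L1 L.
split; apply: W => //; try (by move=> s; rewrite A4E).
- exact: cbm_L1 (hb 1%N isT).
- exact: cbm_L1 (hb 2%N isT).
- apply: cL1D (cbm_L1 (hb 3%N isT)) _.
  by apply: cL1_eq (cL1M (hb 1%N isT) pL) => x _; rewrite mulrC.
have := cL1M (hb 0%N isT) (cL1B (cbm_L1 (cbm_cst lam)) qL).
by apply: cL1_eq => x _; rewrite mulrC.
Qed.

(** It exceeds every row sum of [a4] by at least 1. This margin absorbs the source term in
    [sys4_lipschitz]. *)
Definition k4 L (B : R) (s : R) : R :=
  4 + B + absmaj (coef_p L) s + absmaj (coef_q L) s.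

Definition a4 L (B : R) (i j : nat) (s : R) : R :=
  match i, j with
  | 0, 1 => 1 | 1, 2 => 1 | 2, 3 => 1
  | 2, 1 => absmaj (coef_p L) s
  | 3, 0 => B + absmaj (coef_q L) s
  | _, _ => 0
  end.

Lemma k4_L1 L B : rL1 (k4 L B).
Proof.
have pL := absmaj_L1 (coef_p_L1 L); have qL := absmaj_L1 (coef_q_L1 L).
by apply: rL1D => //; apply: rL1D => //; exact: rbm_L1 (rbm_cst _).
Qed.

Lemma k4_ge1 L B s : 0 <= B -> 1 <= k4 L B s.
Proof.
have := absmaj_ge0 (coef_p L) s; have := absmaj_ge0 (coef_q L) s.
by rewrite /k4; lra.
Qed.

Lemma a4_L1 L B i j : rL1 (a4 L B i j).
Proof.
have pL := absmaj_L1 (coef_p_L1 L); have qL := absmaj_L1 (coef_q_L1 L).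
have h (z : R) : rL1 (fun=> z) by exact: rbm_L1 (rbm_cst z).
by case: i => [|[|[|[|i]]]]; case: j => [|[|[|[|j]]]];
  first [exact: h|exact: pL|exact: rL1D].
Qed.

Lemma A4_le L B lam i j s : cmod lam <= B -> cmod (A4 L lam i j s) <= a4 L B i j s.
Proof.
move=> lamB; case: i => [|[|[|[|i]]]]; case: j => [|[|[|[|j]]]];
  rewrite /A4 /a4 ?cmod0 ?cmod1 ?cmod_absmaj//.
by apply: le_trans (cmodB _ _) _; rewrite lerD ?cmod_absmaj.
Qed.

Lemma a4_le L B i s : 0 <= B -> (i < 4)%N ->
  \sum_(j < 4) a4 L B i j s <= k4 L B s - 1.
Proof.
move=> B0; have := absmaj_ge0 (coef_p L) s; have := absmaj_ge0 (coef_q L) s.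
by case: i => [|[|[|[|]]]] // ? ? _; rewrite !big_ord_recl big_ord0 /= /k4; lra.
Qed.

Lemma k4_ge0 L B s : 0 <= B -> 0 <= k4 L B s.
Proof. by move=> /(k4_ge1 L s); apply: le_trans. Qed.

Lemma sys4_exists L lam (c : nat -> C) :
  exists Y, sys4 L lam Y /\ forall i, (i < 4)%N -> Y i 0 = c i.
Proof.
have B0 := cmod_ge0 lam.
have [||||||Y hY] := @linsol_exists _ 4 (A4 L lam) (a4 L (cmod lam)) (A4_L1 L lam)
  (a4_L1 L _) (fun i j s => A4_le L i j s (lexx _)) (fun=> 1) (k4 L (cmod lam))
  (\sum_(i < 4) cmod (c i)) c.
- by [].
- exact: k4_L1.
- by move=> s; exact: k4_ge0.
- move=> i s iN; under eq_bigr do rewrite mulr1; rewrite mul1r.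
  by apply: le_trans (a4_le L s B0 iN) _; lra.
- by rewrite sumr_ge0// => i _; exact: cmod_ge0.
- move=> i iN; rewrite mulr1 (bigD1 (Ordinal iN))//= lerDl sumr_ge0// => j _.
  exact: cmod_ge0.
by exists Y; exact: linsol_sys4 hY.
Qed.

Lemma sys4_lin L lam Y Z (al be : C) : sys4 L lam Y -> sys4 L lam Z ->
  sys4 L lam (fun i x => al * Y i x + be * Z i x).
Proof.
move=> [y0 y1 y2 y3] [z0 z1 z2 z3]; split.
- exact: W11D (W11Z al y0) (W11Z be z0).
- exact: W11D (W11Z al y1) (W11Z be z1).
- by apply: W11_ext (W11D (W11Z al y2) (W11Z be z2)) => x _ //; ring.
- by apply: W11_ext (W11D (W11Z al y3) (W11Z be z3)) => x _ //; ring.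
Qed.

(** The difference of the two solutions solves the system at [lam0] with zero initial data and the
    source (lam - lam0) Y_0 in the last equation; the comparison principle then gives a bound
    proportional to this source. *)
Lemma sys4_lipschitz L (c : nat -> C) lam0 : exists2 B : R, 0 <= B &
  forall lam Y Y0, cmod (lam - lam0) <= 1 ->
  sys4 L lam Y -> sys4 L lam0 Y0 ->
  (forall i, (i < 4)%N -> Y i 0 = c i /\ Y0 i 0 = c i) ->
  forall i t, (i < 4)%N -> 0 <= t <= 1 ->
  cmod (Y i t - Y0 i t) <= cmod (lam - lam0) * B.
Proof.
pose b := cmod lam0 + 1; have b0 : 0 <= b by rewrite addr_ge0 ?cmod_ge0.
pose k := k4 L b; have hk : rL1 k := k4_L1 L b.
have k0 s : 0 <= k s by exact: k4_ge0.
pose M : R := \sum_(i < 4) cmod (c i).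
have M0 : 0 <= M by rewrite sumr_ge0// => i _; exact: cmod_ge0.
pose E := expR (1 * rI 0 1 k).
have leE t : 0 <= t <= 1 -> expR (1 * rI 0 t k) <= E.
  by move=> /andP[t0 t1]; rewrite ler_expR !mul1r rI_mono.
exists (M * E * E) => [|lam Y Y0 lam1 hY hY0 hc i t iN t01].
  by rewrite !mulr_ge0// expR_ge0.
have lamb : cmod lam <= b.
  by have := cmodD (lam - lam0) lam0; rewrite subrK /b; lra.
have lam0b : cmod lam0 <= b by rewrite lerDl.
have bdY j s : (j < 4)%N -> 0 <= s <= 1 -> cmod (Y j s) <= M * E.
  move=> jN s01; have := @linsol_bound _ 4 (A4 L lam) (a4 L b) (A4_L1 L lam)
    (a4_L1 L _) (fun i j s => A4_le L i j s lamb) (fun=> 1) k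
    M (fun i => Y i 0) _ hk k0 _ M0 _ Y 1 (lexx _) (sys4_linsol hY) j s jN s01.
  move=> h; apply: le_trans (h _ _ _) _ => //.
  - move=> i' s' iN'; under eq_bigr do rewrite mulr1; rewrite mul1r.
    by apply: le_trans (a4_le L s' b0 iN') _; rewrite gerBl.
  - move=> i' iN'; rewrite mulr1 /M (bigD1 (Ordinal iN'))//=.
    have [-> _] := hc _ iN'; rewrite lerDl sumr_ge0// => j' _.
    exact: cmod_ge0.
  - by rewrite mulr1; apply: ler_wpM2l => //; exact: leE.
set d := cmod (lam - lam0).
have d0 : 0 <= d := cmod_ge0 _.
have ME0 : 0 <= d * (M * E) by rewrite !mulr_ge0// expR_ge0.
apply: (@le_trans _ _ (d * (M * E) * expR (1 * rI 0 t k))); last first.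
  by rewrite -!mulrA !ler_wpM2l// ?expR_ge0// leE.
have [sY sY0] := (sys4_linsol hY, sys4_linsol hY0).
have bE := rbm_expM 1 hk.
have E1 s : 0 <= s <= 1 -> 1 <= expR (1 * rI 0 s k).
  by move=> /andP[s0 s1]; rewrite -{1}expR0 ler_expR mul1r rI_ge0.
have hs3 : cL1 (fun s => (lam - lam0) * Y 0%N s).
  by apply/cbm_L1/cbmZ; have [] := sY 0%N isT.
(* The source is cut off outside [0,1], since the comparison asks for its majorant at every real
   [s]. *)
pose h (i : nat) s := if i == 3%N then
   (if (0 <= s <= 1) then (lam - lam0) * Y 0%N s else 0) else 0.
apply: (@volterra_comparison _ 4 (A4 L lam0) (a4 L b) (A4_L1 L lam0)
    (a4_L1 L _) (fun i j s => A4_le L i j s lam0b)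
    (fun i t => Y i t - Y0 i t) (fun=> 0) h (fun _ _ => d * (M * E))
    (fun i t => d * (M * E) * expR (1 * rI 0 t k))) => //.
- by move=> j jN; have [hj _] := sY j jN; have [hj0 _] := sY0 j jN; exact: cbmB.
- by move=> j _; apply: rbmM (rbm_cst _) bE.
- move=> j; rewrite /h; case: eqP => _; last exact: cbm_L1 (cbm_cst _).
  by apply: cL1_eq hs3 => s ->.
- by move=> _; exact: rbm_L1 (rbm_cst _).
- move=> j s; rewrite /h; case: eqP => _; last by rewrite cmod0.
  case: ifP => s01; last by rewrite cmod0.
  by rewrite cmodM ler_wpM2l// bdY.
- by move=> j s _ _; rewrite mulr_ge0// expR_ge0.
- move=> j {}t jN {}t01; have /andP[t0 t1] := t01.
  have [_ ->//] := sY j jN; have [_ ->//] := sY0 j jN.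
  have [-> ->] := hc j jN; rewrite opprD addrACA subrr !add0r -cIB//; last 2 first.
  + apply: cL1_sum => l _; have [hl _] := sY l (ltn_ord l).
    by apply: cL1_eq (cL1M hl (A4_L1 L lam j l)) => s _; rewrite mulrC.
  + apply: cL1_sum => l _; have [hl _] := sY0 l (ltn_ord l).
    by apply: cL1_eq (cL1M hl (A4_L1 L lam0 j l)) => s _; rewrite mulrC.
  apply: eq_cI => s /andP[s0 st].
  have -> : \sum_(j0 < 4) A4 L lam0 j j0 s * (Y j0 s - Y0 j0 s) =
     \sum_(j0 < 4) A4 L lam0 j j0 s * Y j0 s - \sum_(j0 < 4) A4 L lam0 j j0 s * Y0 j0 s.
    by rewrite -sumrB; apply: eq_bigr => l _; rewrite mulrBr.
  rewrite !A4E// /h s0 (le_trans st t1); case: j jN => [|[|[|[|]]]] //= _; rewrite ?addr0//; ring.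
move=> j {}t jN {}t01; have /andP[t0 t1] := t01; rewrite cmod0 add0r.
have hkE : rL1 (fun s => k s * expR (1 * rI 0 s k)).
  by apply: rL1_eq (rL1M bE hk) => s _; rewrite mulrC.
apply: (@le_trans _ _ (rI 0 t (fun s => d * (M * E) * (k s * expR (1 * rI 0 s k))))).
  apply: rI_le => //; [|exact: rL1Z|].
    apply: rL1D (rbm_L1 (rbm_cst _)); apply: rL1_sum => l.
    apply: rL1_eq (rL1M (rbmM (rbm_cst (d * (M * E))) bE) (a4_L1 L b j l)) => s _.
    by rewrite mulrC.
  move=> s /andP[s0 st]; rewrite -mulr_suml.
  have := a4_le L s b0 jN; have := E1 s; rewrite s0 (le_trans st t1) => /(_ isT).
  rewrite -/k; set e := expR _; set S := \sum_(_ < _) _ => e1 Sk.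
  apply: (@le_trans _ _ ((k s - 1) * (d * (M * E) * e) + d * (M * E) * e)).
    apply: lerD; first by rewrite ler_wpM2r// mulr_ge0// (le_trans ler01).
    by rewrite ler_peMr.
  by rewrite le_eqVlt; apply/orP; left; apply/eqP; ring.
rewrite (rIZ _ hkE)// rI_expRM// divr1 ler_wpM2l//; lra.
Qed.

Lemma sys4_unique L lam Y Y0 : sys4 L lam Y -> sys4 L lam Y0 ->
  (forall i, (i < 4)%N -> Y i 0 = Y0 i 0) ->
  forall i t, (i < 4)%N -> 0 <= t <= 1 -> Y i t = Y0 i t.
Proof.
move=> hY hY0 h i t iN t01.
have [B _ hB] := sys4_lipschitz L (fun i => Y i 0) lam.
apply/eqP; rewrite -subr_eq0 -cmod_eq0 eq_le cmod_ge0 andbT.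
have := hB lam Y Y0 _ hY hY0 _ i t iN t01; rewrite subrr cmod0 mul0r; apply => //.
by move=> j jN; rewrite h.
Qed.

(** The boundary form of the differential expression: a symplectic form on the vector of the four
    quasi-derivatives. *)
Definition bracket (Y Z : nat -> R -> C) (x : R) : C :=
  Y 3%N x * Z 0%N x - Y 0%N x * Z 3%N x - Y 2%N x * Z 1%N x + Y 1%N x * Z 2%N x.

(** In the derivative of the bracket the terms with p, those with q and the mixed derivatives
    cancel; only the difference of the spectral parameters survives. *)
Lemma lagrange_identity L lam mu Y Z : sys4 L lam Y -> sys4 L mu Z ->
  bracket Y Z 1 = bracket Y Z 0 +
    (lam - mu) * cI 0 1 (fun x => Y 0%N x * Z 0%N x).
Proof.
move=> [y0 y1 y2 y3] [z0 z1 z2 z3].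
have := W11D (W11B (W11B (W11M y3 z0) (W11M y0 z3)) (W11M y2 z1)) (W11M y1 z2).
have b0 := cbmM (W11_bm y0) (W11_bm z0).
move=> /(@W11_ext _ _ _ (bracket Y Z) (fun x => (lam - mu) * (Y 0%N x * Z 0%N x))).
case=> [//|x _|]; first by ring.
move=> _ /(_ 1); rewrite in01 ler01 lexx => /(_ isT) ->; congr (_ + _).
by rewrite -[cintegral _ _]/(cintegral _ _) -(cIZ _ (cbm_L1 b0))// cI.unlock.
Qed.

End FourthOrder.

(** * The system for the 2x2 minors and its entire dependence on the spectral parameter *)

Section Compound.
Context {R : realType}.
Notation C := R[i].
Implicit Types (s t x y tau rho th : R) (L : problem R) (lam mu z : C).

(* Entire functions of order at most 1/4, measured by polynomial approximation:
   on the disc of radius rho^4 the distance to polynomials of degree less than N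
   is at most M exp(theta B rho) / theta^N, for every theta. *)
Definition ord4 (F : C -> C) : Prop :=
  exists M B : R, [/\ 0 <= M, 0 <= B & forall N, exists P : {poly C},
    (size P <= N)%N /\ forall th rho z, 1 <= th -> 1 <= rho ->
      cmod z <= rho ^+ 4 -> cmod (F z - P.[z]) <= M * expR (th * (B * rho)) / th ^+ N].

(* The 2x2 minors m_jk of (Y, Z), except that m_03 and m_12, whose difference is
   the constant bracket, are replaced by their mean. *)
Definition minors (Y Z : nat -> R -> C) (i : nat) (x : R) : C :=
  let m j k := Y j x * Z k x - Y k x * Z j x in
  match i with
  | 0 => m 0%N 1%N | 1 => m 0%N 2%N | 2 => (m 0%N 3%N + m 1%N 2%N) / 2
  | 3 => m 1%N 3%N | _ => m 2%N 3%N
  end.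

(** The second additive compound of [A4], restricted to the five combinations in [minors]. *)
Definition A5 L lam (i j : nat) (s : R) : C :=
  match i, j with
  | 0, 1 => 1 | 1, 0 => coef_p L s | 1, 2 => 2 | 2, 3 => 1
  | 3, 0 => coef_q L s - lam | 3, 4 => 1
  | 4, 1 => coef_q L s - lam | 4, 3 => coef_p L s
  | _, _ => 0
  end.

Lemma A5_L1 L lam i j : cL1 (A5 L lam i j).
Proof.
have pL := coef_p_L1 L; have qL := coef_q_L1 L.
have h (z : C) : cL1 (fun=> z) by exact: cbm_L1 (cbm_cst z).
by case: i => [|[|[|[|[|i]]]]]; case: j => [|[|[|[|[|j]]]]];
  first [exact: h|exact: pL|exact: cL1B].
Qed.

Lemma A5E L lam i (Y : nat -> R -> C) s : (i < 5)%N ->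
  \sum_(j < 5) A5 L lam i j s * Y j s =
  match i with
  | 0 => Y 1%N s | 1 => coef_p L s * Y 0%N s + 2 * Y 2%N s | 2 => Y 3%N s
  | 3 => (coef_q L s - lam) * Y 0%N s + Y 4%N s
  | _ => (coef_q L s - lam) * Y 1%N s + coef_p L s * Y 3%N s
  end.
Proof.
by case: i => [|[|[|[|[|]]]]] // _; rewrite !big_ord_recl big_ord0 /=; ring.
Qed.

(** The minors m_03 and m_12 have the same derivative m_13, and m_02 contributes their sum; hence
    their mean closes the system, with the entry 2 in the second row. *)
Lemma minors_linsol L lam Y Z : sys4 L lam Y -> sys4 L lam Z ->
  linsol 5 (A5 L lam) (fun i => minors Y Z i 0) (minors Y Z).
Proof.
move=> [y0 y1 y2 y3] [z0 z1 z2 z3].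
have m01 := W11B (W11M y0 z1) (W11M y1 z0).
have m02 := W11B (W11M y0 z2) (W11M y2 z0).
have m03 := W11B (W11M y0 z3) (W11M y3 z0).
have m12 := W11B (W11M y1 z2) (W11M y2 z1).
have m13 := W11B (W11M y1 z3) (W11M y3 z1).
have m23 := W11B (W11M y2 z3) (W11M y3 z2).
have mw := W11Z (2^-1) (W11D m03 m12).
suff W : forall i, (i < 5)%N -> W11_deriv (minors Y Z i)
    (fun s => \sum_(j < 5) A5 L lam i j s * minors Y Z j s).
  move=> i iN; have w := W i iN; split; first exact: W11_bm w.
  by case/W11P: w.
move=> i iN; case: i iN => [|[|[|[|[|]]]]] // _.
- by apply: W11_ext m01 => x _; rewrite ?A5E//= /minors; ring.
- by apply: W11_ext m02 => x _; rewrite ?A5E//= /minors; field.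
- by apply: W11_ext mw => x _; rewrite ?A5E//= /minors; field.
- by apply: W11_ext m13 => x _; rewrite ?A5E//= /minors; ring.
- by apply: W11_ext m23 => x _; rewrite ?A5E//= /minors; ring.
Qed.

Definition a5 L (B : R) (i j : nat) (s : R) : R :=
  match i, j with
  | 0, 1 => 1 | 1, 0 => absmaj (coef_p L) s | 1, 2 => 2 | 2, 3 => 1
  | 3, 0 => absmaj (coef_q L) s + B | 3, 4 => 1
  | 4, 1 => absmaj (coef_q L) s + B | 4, 3 => absmaj (coef_p L) s
  | _, _ => 0
  end.

Lemma a5_L1 L B i j : rL1 (a5 L B i j).
Proof.
have pL := absmaj_L1 (coef_p_L1 L); have qL := absmaj_L1 (coef_q_L1 L).
have h (z : R) : rL1 (fun=> z) by exact: rbm_L1 (rbm_cst z).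
by case: i => [|[|[|[|[|i]]]]]; case: j => [|[|[|[|[|j]]]]];
  first [exact: h|exact: pL|exact: rL1D].
Qed.

Lemma A5_le L B lam i j s : cmod lam <= B -> cmod (A5 L lam i j s) <= a5 L B i j s.
Proof.
have c2 : cmod (2 : C) = 2 by rewrite cmod_nat.
move=> lamB; case: i => [|[|[|[|[|i]]]]]; case: j => [|[|[|[|[|j]]]]];
  rewrite /A5 /a5 ?cmod0 ?cmod1 ?cmod_absmaj ?c2//;
by apply: le_trans (cmodB _ _) _; rewrite lerD ?cmod_absmaj.
Qed.

Lemma a5E L B i (Y : nat -> R) s : (i < 5)%N ->
  \sum_(j < 5) a5 L B i j s * Y j =
  match i with
  | 0 => Y 1%N | 1 => absmaj (coef_p L) s * Y 0%N + 2 * Y 2%N | 2 => Y 3%N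
  | 3 => (absmaj (coef_q L) s + B) * Y 0%N + Y 4%N
  | _ => (absmaj (coef_q L) s + B) * Y 1%N + absmaj (coef_p L) s * Y 3%N
  end.
Proof.
by case: i => [|[|[|[|[|]]]]] // _; rewrite !big_ord_recl big_ord0 /=; ring.
Qed.

(** The approximating polynomial is the [N]-th Picard iterate at the end point 1. Since the initial
    minors do not depend on [lam], the same polynomial serves for all radii and all [th]. *)
Lemma minors_ord4 L (Y Z : C -> nat -> R -> C) (c : nat -> C) :
  (forall lam, [/\ sys4 L lam (Y lam), sys4 L lam (Z lam) &
     forall i, (i < 5)%N -> minors (Y lam) (Z lam) i 0 = c i]) ->
  ord4 (fun lam => minors (Y lam) (Z lam) 0 1).
Proof.
move=> hYZ.
have pL := absmaj_L1 (coef_p_L1 L); have qL := absmaj_L1 (coef_q_L1 L).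
pose g s := absmaj (coef_p L) s + absmaj (coef_q L) s.
have hg : rL1 g by exact: rL1D.
have g0 s : 0 <= g s by rewrite addr_ge0 ?absmaj_ge0.
have G0 : 0 <= rI 0 1 g by rewrite rI_ge0.
pose M : R := \sum_(i < 5) cmod (c i).
have M0 : 0 <= M by rewrite sumr_ge0// => i _; exact: cmod_ge0.
exists M, (2 + rI 0 1 g); split => //; first by rewrite addr_ge0.
move=> N.
have h1 (i j : nat) : cL1 (fun _ : R => (A5 L 1 i j 0 - A5 L 0 i j 0 : C)).
  exact: cbm_L1 (cbm_cst _).
(* The slope in [lam] does not depend on [s], so it may be evaluated at 0. *)
have AE lam : A5 L lam = fun i j s => A5 L 0 i j s + lam * (A5 L 1 i j 0 - A5 L 0 i j 0).
  apply/funext => i; apply/funext => j; apply/funext => s.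
  by case: i => [|[|[|[|[|i]]]]]; case: j => [|[|[|[|[|j]]]]] /=; ring.
have [d [bd d0 hd]] := picard_poly 5 c (A5_L1 L 0) h1 N.
exists (\poly_(l < N) d 0%N l 1); split; first exact: size_poly.
move=> th rho z th1 rho1 zrho.
have hZ := hYZ z; case: hZ => sY sZ hc.
have hm := minors_linsol sY sZ.
have -> : (\poly_(l < N) d 0%N l 1).[z] =
    picard 5 (A5 L z) (fun i => minors (Y z) (Z z) i 0) N 0 1.
  have -> : picard 5 (A5 L z) (fun i => minors (Y z) (Z z) i 0) N 0 1 =
            picard 5 (A5 L z) c N 0 1.
    have : forall i, (i < 5)%N -> forall t, picard 5 (A5 L z) (fun i => minors (Y z) (Z z) i 0) N i t =
            picard 5 (A5 L z) c N i t; last by apply.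
    elim: N {d bd d0 hd} => [//|N IH] i iN t /=; rewrite hc//; congr (_ + _).
    by apply: eq_cI => s _; apply: eq_bigr => j _; rewrite IH.
  rewrite AE hd ?ler01 ?lexx// horner_poly; apply: eq_bigr => l _.
  by rewrite mulrC.
have rho0 : 0 < rho by apply: lt_le_trans rho1.
(* The parameter [lam], of size rho^4, feeds component 0 into component 3 and component 1 into
   component 4, three levels down. With weights rho^i every entry therefore costs about [rho], the
   fourth root of the radius. The division by rho^4 is compensated in the constant [M * rho ^+ 4],
   so that component 0 ends with the plain constant [M]. *)
pose w i := rho ^+ i / rho ^+ 4.
pose k s := 2 * rho + g s.
have hk : rL1 k by apply: rL1D => //; exact: rbm_L1 (rbm_cst _).
have k0 s : 0 <= k s by rewrite addr_ge0// mulr_ge0// ltW.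
have w0 i : 0 < w i by rewrite divr_gt0 ?exprn_gt0.
have rho4 : 1 <= rho ^+ 4 by rewrite exprn_ege1.
apply: (@le_trans _ _ (M * rho ^+ 4 * w 0%N * expR (th * rI 0 1 k) / th ^+ N)).
  apply: (@picard_error _ 5 (A5 L z) (a5 L (rho ^+ 4)) (A5_L1 L z) (a5_L1 L _)
   (fun i j s => A5_le L i j s zrho) w k (M * rho ^+ 4)
   (fun i => minors (Y z) (Z z) i 0)) => //.
  - move=> i s iN; rewrite a5E//.
    have p0 := absmaj_ge0 (coef_p L) s; have q0 := absmaj_ge0 (coef_q L) s.
    rewrite /k /g /w; set p := absmaj (coef_p L) s in p0 *.
    set q := absmaj (coef_q L) s in q0 *.
    have r4 : rho ^+ 4 != 0 by rewrite expf_neq0// gt_eqF.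
    case: i iN => [|[|[|[|[|]]]]] // _.
    + rewrite [leRHS]mulrAC ler_wpM2r ?invr_ge0 ?exprn_ge0 ?(ltW rho0)//.
      by rewrite expr0 expr1; lra.
    + have -> : p * (rho ^+ 0 / rho ^+ 4) + 2 * (rho ^+ 2 / rho ^+ 4) =
        (p + 2 * rho ^+ 2) / rho ^+ 4 by field; rewrite gt_eqF.
      rewrite [leRHS]mulrAC ler_wpM2r ?invr_ge0 ?exprn_ge0 ?(ltW rho0)//.
      rewrite expr1 expr2; nra.
    + rewrite [leRHS]mulrAC ler_wpM2r ?invr_ge0 ?exprn_ge0 ?(ltW rho0)//.
      rewrite [_ ^+ 3]exprS; have : 0 < rho ^+ 2 by rewrite exprn_gt0.
      by move: (rho ^+ 2) => r2 r20; nra.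
    + have -> : (q + rho ^+ 4) * (rho ^+ 0 / rho ^+ 4) + rho ^+ 4 / rho ^+ 4 =
        (q + 2 * rho ^+ 4) / rho ^+ 4 by field; rewrite gt_eqF.
      rewrite [leRHS]mulrAC ler_wpM2r ?invr_ge0 ?exprn_ge0 ?(ltW rho0)//.
      have r3 : 1 <= rho ^+ 3 by rewrite exprn_ege1.
      by rewrite [_ ^+ 4]exprS; move: (rho ^+ 3) r3 => r3 r31; nra.
    + have -> : (q + rho ^+ 4) * (rho ^+ 1 / rho ^+ 4) + p * (rho ^+ 3 / rho ^+ 4) =
        (q * rho + rho * rho ^+ 4 + p * rho ^+ 3) / rho ^+ 4 by field; rewrite gt_eqF.
      rewrite [leRHS]mulrAC ler_wpM2r ?invr_ge0 ?exprn_ge0 ?(ltW rho0)//.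
      have r3 : 1 <= rho ^+ 3 by rewrite exprn_ege1.
      have r34 : rho ^+ 3 <= rho ^+ 4 by rewrite ler_weXn2l.
      have r14 : rho <= rho ^+ 4 by rewrite -{1}(expr1 rho) ler_weXn2l.
      by move: (rho ^+ 3) (rho ^+ 4) r3 r34 r14 rho4 => x3 x4 *; nra.
  - by rewrite mulr_ge0// ltW// exprn_gt0.
  - move=> i iN; rewrite hc//.
    apply: (@le_trans _ _ M).
      rewrite /M (bigD1 (Ordinal iN))//= lerDl sumr_ge0// => j _; exact: cmod_ge0.
    rewrite /w -mulrA ler_peMr// mulrCA divff ?mulr1 ?exprn_ege1//.
    by rewrite expf_neq0// gt_eqF.
  - by rewrite ler01 lexx.
have -> : M * rho ^+ 4 * w 0%N = M.
  by rewrite /w expr0 mul1r mulfK// expf_neq0// gt_eqF.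
have th0 : 0 <= th by apply: le_trans th1.
rewrite ler_wpM2r ?invr_ge0 ?exprn_ge0// ler_wpM2l// ler_expR ler_wpM2l//.
rewrite rID ?rIcst ?ler01//; last exact: rbm_L1 (rbm_cst _).
by rewrite subr0 mulr1; nra.
Qed.

End Compound.

(** * Asymptotics on the negative ray *)

Section Ray.
Context {R : realType}.
Notation C := R[i].
Implicit Types (s t x y tau rho th : R) (L : problem R) (lam mu z : C).

Lemma rI_FTC (f F : R -> R) t : (forall x : R, is_derive x 1 F (f x)) ->
  continuous f -> 0 <= t <= 1 -> rI 0 t f = F t - F 0.
Proof.
move=> dF cf /andP[]; rewrite le_eqVlt => /predU1P[<- _|t0 t1].
  by rewrite rIxx subrr.
have cF : continuous F.
  by move=> x; apply/differentiable_continuous/derivable1_diffP; have [] := dF x.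
rewrite rI.unlock /Rintegral (@continuous_FTC2 _ f F 0 t t0) //.
- exact: continuous_subspaceT.
- split.
  + by move=> x _; have [] := dF x.
  + exact: cvg_at_right_filter (cF 0).
  + exact: cvg_at_left_filter (cF t).
- by move=> x _; rewrite derive1E; have [_ ->] := dF x.
Qed.

(* E_j(x) is the sum of x^n / n! over n congruent to j modulo 4. *)
Definition E0 (tau t : R) : R := (expR (tau * t) + expR (- tau * t)) / 4 + cos (tau * t) / 2.
Definition E1 (tau t : R) : R := (expR (tau * t) - expR (- tau * t)) / 4 + sin (tau * t) / 2.
Definition E2 (tau t : R) : R := (expR (tau * t) + expR (- tau * t)) / 4 - cos (tau * t) / 2.
Definition E3 (tau t : R) : R := (expR (tau * t) - expR (- tau * t)) / 4 - sin (tau * t) / 2.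

Let is_derive_E (a b : R) tau (trig dtrig : R -> R) x :
  (forall x : R, is_derive x 1 trig (dtrig x)) ->
  is_derive x 1 (fun t => (expR (tau * t) + a * expR (- tau * t)) / 4 + b * trig (tau * t))
    (tau * ((expR (tau * x) - a * expR (- tau * x)) / 4 + b * dtrig (tau * x))).
Proof.
move=> htrig.
have h1 : is_derive x 1 (fun t => expR (tau * t)) (tau * expR (tau * x)).
  have := @is_derive1_comp R (@expR R) (fun t => tau * t) x (expR (tau * x)) tau.
  move=> h; rewrite mulrC; apply: h.
  by apply: is_derive_eq; rewrite /GRing.scale/= mulr1.
have h2 : is_derive x 1 (fun t => expR (- tau * t)) (- tau * expR (- tau * x)).
  have := @is_derive1_comp R (@expR R) (fun t => - tau * t) x (expR (- tau * x)) (- tau).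
  move=> h; rewrite mulrC; apply: h.
  by apply: is_derive_eq; rewrite /GRing.scale/= mulr1.
have h3 : is_derive x 1 (fun t => trig (tau * t)) (tau * dtrig (tau * x)).
  have := @is_derive1_comp R trig (fun t => tau * t) x (dtrig (tau * x)) tau.
  move=> h; rewrite mulrC; apply: h.
  by apply: is_derive_eq; rewrite /GRing.scale/= mulr1.
have h4 := is_deriveD (is_deriveZ (4^-1) (is_deriveD h1 (is_deriveZ a h2))) (is_deriveZ b h3).
have -> : (fun t => (expR (tau * t) + a * expR (- tau * t)) / 4 + b * trig (tau * t)) =
   (4^-1 \*: ((fun t => expR (tau * t)) + a \*: (fun t => expR (- tau * t))) +
   b \*: (fun t => trig (tau * t))).
  by apply/funext => t; rewrite [X in X + _]mulrC.
by apply: is_derive_eq; rewrite /GRing.scale/=; field.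
Qed.

Let continuousE (a b : R) tau (trig dtrig : R -> R) :
  (forall x : R, is_derive x 1 trig (dtrig x)) ->
  continuous (fun t => (expR (tau * t) + a * expR (- tau * t)) / 4 + b * trig (tau * t)).
Proof.
move=> ct x; apply/differentiable_continuous/derivable1_diffP.
by have [] := is_derive_E a b tau x ct.
Qed.

Let E_forms tau : [/\
  E0 tau = (fun t => (expR (tau * t) + 1 * expR (- tau * t)) / 4 + 2^-1 * cos (tau * t)),
  E1 tau = (fun t => (expR (tau * t) + (-1) * expR (- tau * t)) / 4 + 2^-1 * sin (tau * t)),
  E2 tau = (fun t => (expR (tau * t) + 1 * expR (- tau * t)) / 4 + (- 2^-1) * cos (tau * t)) &
  E3 tau = (fun t => (expR (tau * t) + (-1) * expR (- tau * t)) / 4 + (- 2^-1) * sin (tau * t))].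
Proof.
by split; apply/funext => t; rewrite /E0 /E1 /E2 /E3; field.
Qed.

Lemma continuous_E tau : [/\ continuous (E0 tau), continuous (E1 tau),
  continuous (E2 tau) & continuous (E3 tau)].
Proof.
have [-> -> -> ->] := E_forms tau.
by split; apply: continuousE; (exact: is_derive_cos || exact: is_derive_sin).
Qed.

Lemma E_at0 tau : [/\ E0 tau 0 = 1, E1 tau 0 = 0, E2 tau 0 = 0 & E3 tau 0 = 0].
Proof. by rewrite /E0 /E1 /E2 /E3 !mulr0 expR0 cos0 sin0; split; lra. Qed.

Let rI_E (f F : R -> R) tau t : continuous f ->
  (forall x : R, is_derive x 1 F (tau * f x)) -> 0 <= t <= 1 ->
  tau * rI 0 t f = F t - F 0.
Proof.
move=> cf dF t01; rewrite -(rI_FTC dF)//.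
  have hf : rL1 f by apply/rbm_L1/rbm_continuous/continuous_subspaceT.
  by case/andP: t01 => ? ?; rewrite rIZ.
by move=> x; apply: continuousM; [exact: cst_continuous|exact: cf].
Qed.

Let is_derive_cos' x : is_derive x 1 (@cos R) (- sin x).
Proof. exact: is_derive_cos. Qed.

Lemma rI_Ej tau t : 0 <= t <= 1 ->
  [/\ tau * rI 0 t (E0 tau) = E1 tau t, tau * rI 0 t (E1 tau) = E2 tau t,
   tau * rI 0 t (E2 tau) = E3 tau t & tau * rI 0 t (E3 tau) = E0 tau t - 1].
Proof.
move=> t01; have [c0 c1 c2 c3] := continuous_E tau.
have [e0 e1 e2 e3] := E_at0 tau; have [f0 f1 f2 f3] := E_forms tau.
split.
- rewrite -[RHS]subr0 -{2}e1; apply: rI_E => // x.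
  rewrite f1; apply: is_derive_eq (is_derive_E _ _ _ _ (@is_derive_sin R)) _.
  by rewrite f0; congr (_ * _); ring.
- rewrite -[RHS]subr0 -{2}e2; apply: rI_E => // x.
  rewrite f2; apply: is_derive_eq (is_derive_E _ _ _ _ is_derive_cos') _.
  by rewrite f1; congr (_ * _); ring.
- rewrite -[RHS]subr0 -{2}e3; apply: rI_E => // x.
  rewrite f3; apply: is_derive_eq (is_derive_E _ _ _ _ (@is_derive_sin R)) _.
  by rewrite f2; congr (_ * _); ring.
rewrite -[X in _ - X]e0; apply: rI_E => // x.
rewrite f0; apply: is_derive_eq (is_derive_E _ _ _ _ is_derive_cos') _.
by rewrite f3; congr (_ * _); ring.
Qed.

Lemma E_bounds tau t : 0 <= tau -> 0 <= t ->
  [/\ `|E0 tau t| <= expR (tau * t), `|E1 tau t| <= expR (tau * t),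
   `|E2 tau t| <= expR (tau * t) & `|E3 tau t| <= expR (tau * t)].
Proof.
move=> tau0 t0.
have p : 1 <= expR (tau * t) by rewrite -{1}expR0 ler_expR mulr_ge0.
have n1 : expR (- tau * t) <= 1 by rewrite -[leRHS]expR0 ler_expR mulNr oppr_le0 mulr_ge0.
have n0 := expR_ge0 (- tau * t).
have := cos_le1 (tau * t); have := cos_geN1 (tau * t).
have := sin_le1 (tau * t); have := sin_geN1 (tau * t).
by split; rewrite ler_norml /E0 /E1 /E2 /E3; apply/andP; split; lra.
Qed.

(** The worst case is E_3, at least (exp tau - 1) / 4 - 1 / 2; this exceeds exp tau / 8 exactly when
    exp tau is at least 6. *)
Lemma E_lower tau : 0 <= tau -> 6 <= expR tau ->
  [/\ expR tau / 8 <= E0 tau 1, expR tau / 8 <= E2 tau 1 & expR tau / 8 <= E3 tau 1].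
Proof.
move=> tau0 t6; rewrite /E0 /E2 /E3 !mulr1.
have n1 : expR (- tau) <= 1 by rewrite -[leRHS]expR0 ler_expR oppr_le0.
have n0 := expR_ge0 (- tau).
have := cos_le1 tau; have := cos_geN1 tau.
have := sin_le1 tau; have := sin_geN1 tau.
by split; lra.
Qed.

(** The positive eigenvector, for the eigenvalue [tau], of the majorant matrix [a5] with p = q = 0
    and |lam| = tau^4 / 4. Being exact, it loses nothing in the exponent, which the comparison with
    exp tau requires. *)
Definition wray tau (i : nat) : R :=
  match i with
  | 0 => 2 / tau ^+ 4 | 1 => 2 / tau ^+ 3 | 2 => 1 / tau ^+ 2 | 3 => 1 / tau | _ => 1 / 2
  end.

(** The integrated system [A5] for p = q = 0 on the ray. There - lam = tau^4 / 4 is positive, so the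
    matrix is real and nonnegative and coincides with its majorant. *)
Definition free_solution tau (c0 : nat -> R) (m0 : nat -> R -> R) : Prop :=
  (forall i, (i < 5)%N -> continuous (m0 i)) /\
  forall t, 0 <= t <= 1 ->
  [/\ m0 0%N t = c0 0%N + rI 0 t (m0 1%N),
   m0 1%N t = c0 1%N + 2 * rI 0 t (m0 2%N),
   m0 2%N t = c0 2%N + rI 0 t (m0 3%N),
   m0 3%N t = c0 3%N + tau ^+ 4 / 4 * rI 0 t (m0 0%N) + rI 0 t (m0 4%N) &
   m0 4%N t = c0 4%N + tau ^+ 4 / 4 * rI 0 t (m0 1%N)].

(** The three closed-form solutions correspond to the leading initial minors, up to orientation:
    m_01 = 1 for Delta_22, m_13 = 1 for Delta_32, and m_03 = 1, hence mean 1/2, for Delta_42. The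
    initial minors that involve a, b, c are of lower order when measured against [wray]. *)
Definition free22 tau (i : nat) (t : R) : R :=
  match i with
  | 0 => 1 / 2 + E0 tau t / 2 | 1 => tau / 2 * E3 tau t
  | 2 => tau ^+ 2 / 4 * E2 tau t | 3 => tau ^+ 3 / 4 * E1 tau t
  | _ => tau ^+ 4 / 8 * (E0 tau t - 1)
  end.

Definition free32 tau (i : nat) (t : R) : R :=
  match i with
  | 0 => 2 / tau ^+ 3 * E3 tau t | 1 => 2 / tau ^+ 2 * E2 tau t
  | 2 => 1 / tau * E1 tau t | 3 => E0 tau t
  | _ => tau / 2 * E3 tau t
  end.

Definition free42 tau (i : nat) (t : R) : R :=
  match i with
  | 0 => 1 / tau ^+ 2 * E2 tau t | 1 => 1 / tau * E1 tau t
  | 2 => 1 / 2 * E0 tau t | 3 => tau / 2 * E3 tau t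
  | _ => tau ^+ 2 / 4 * E2 tau t
  end.

Let rIZE k (f : R -> R) t : continuous f -> 0 <= t <= 1 ->
  rI 0 t (fun s => k * f s) = k * rI 0 t f.
Proof.
move=> cf /andP[t0 t1]; apply: rIZ => //.
exact/rbm_L1/rbm_continuous/continuous_subspaceT.
Qed.

Let rI_affE k (f : R -> R) t : continuous f -> 0 <= t <= 1 ->
  rI 0 t (fun s => 1 / 2 + k * f s) = t / 2 + k * rI 0 t f.
Proof.
move=> cf /andP[t0 t1].
have hf : rL1 f by apply/rbm_L1/rbm_continuous/continuous_subspaceT.
rewrite (rID (rbm_L1 (rbm_cst _)) (rL1Z _ hf))// rIZ// rIcst//; lra.
Qed.

Lemma free_solutions tau : tau != 0 ->
  [/\ free_solution tau (fun i => (i == 0%N)%:R) (free22 tau),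
   free_solution tau (fun i => (i == 3%N)%:R) (free32 tau) &
   free_solution tau (fun i => (i == 2%N)%:R / 2) (free42 tau)].
Proof.
move=> tau0; have [c0 c1 c2 c3] := continuous_E tau.
have [e0 e1 e2 e3] := E_at0 tau.
have cZ k (f : R -> R) : continuous f -> continuous (fun s : R => k * f s : R).
  by move=> cf x; apply: continuousM; [exact: cst_continuous|exact: cf].
have cD k (f : R -> R) : continuous f -> continuous (fun s : R => k + f s : R).
  by move=> cf x; apply: continuousD; [exact: cst_continuous|exact: cf].
have J t : 0 <= t <= 1 -> [/\ rI 0 t (E0 tau) = E1 tau t / tau,
   rI 0 t (E1 tau) = E2 tau t / tau, rI 0 t (E2 tau) = E3 tau t / tau &
   rI 0 t (E3 tau) = (E0 tau t - 1) / tau].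
  by move=> /(rI_Ej tau)[<- <- <- <-]; rewrite ![tau * _]mulrC !mulfK.
have F22_0 : free22 tau 0%N = fun s => 1 / 2 + 2^-1 * E0 tau s.
  by apply/funext => s /=; rewrite [2^-1 * _]mulrC.
have F22_4 : free22 tau 4%N = fun s => tau ^+ 4 / 8 * (- 1 + E0 tau s).
  by apply/funext => s /=; rewrite [-1 + _]addrC.
split; (split; [move=> i iN|move=> t t01; have [j0 j1 j2 j3] := J t t01]).
- case: i iN => [|[|[|[|[|]]]]] // _; rewrite ?F22_0 ?F22_4; do ?[exact: cZ|exact: cD].
  + exact/cD/cZ.
  + exact/cZ/cD.
- have k4 : rI 0 t (free22 tau 4%N) = tau ^+ 4 / 8 * (E1 tau t / tau - t).
    rewrite F22_4 rIZE//; last exact: cD.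
    case/andP: t01 => t0 t1.
    rewrite (@rID _ (fun=> -1)) ?rIcst ?j0//; [by congr (_ * _); ring|exact: rbm_L1 (rbm_cst _)|].
    exact/rbm_L1/rbm_continuous/continuous_subspaceT.
  rewrite k4 F22_0 rI_affE// !rIZE// j0 j1 j2 j3 /=; split; rewrite ?eqxx/=; by field.
- by case: i iN => [|[|[|[|[|]]]]] // _; do ?[exact: cZ].
- rewrite /free32 !rIZE// j0 j1 j2 j3 /=; split; by field.
- by case: i iN => [|[|[|[|[|]]]]] // _; do ?[exact: cZ].
- rewrite /free42 !rIZE// j0 j1 j2 j3 /=; split; by field.
Qed.

End Ray.

(** * Comparison with the free system on the negative ray *)

Section RayComparison.
Context {R : realType}.
Notation C := R[i].
Implicit Types (s t x y tau rho th : R) (L : problem R) (lam mu z : C).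

Definition lray tau : C := (- (tau ^+ 4 / 4))%:C.

(** After division by [tau] this bounds the effect of p and q in the norm weighted by [wray]. The
    factors 2 and 4 are dictated by the last row, where p meets w_3 / w_4 = 2 / tau and q meets w_1
    / w_4 = 4 / tau^3. *)
Definition kray L (s : R) : R := 2 * absmaj (coef_p L) s + 4 * absmaj (coef_q L) s.

Lemma kray_L1 L : rL1 (kray L).
Proof.
have pL := absmaj_L1 (coef_p_L1 L); have qL := absmaj_L1 (coef_q_L1 L).
by apply: rL1D; exact: rL1Z.
Qed.

Lemma kray_ge0 L s : 0 <= kray L s.
Proof. by rewrite addr_ge0// mulr_ge0 ?absmaj_ge0. Qed.

Lemma wray_gt0 tau i : 0 < tau -> 0 < wray tau i.
Proof.
by move=> t0; case: i => [|[|[|[|i]]]] /=; rewrite divr_gt0// exprn_gt0.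
Qed.

Lemma a5_wray L tau i s : 1 <= tau -> (i < 5)%N ->
  \sum_(j < 5) a5 L (tau ^+ 4 / 4) i j s * wray tau j <=
  wray tau i * (tau + kray L s / tau).
Proof.
move=> t1 iN; have t0 : 0 < tau by apply: lt_le_trans t1.
rewrite (@a5E _ L (tau ^+ 4 / 4) i (wray tau) s iN) /kray.
have := absmaj_ge0 (coef_q L) s; have := absmaj_ge0 (coef_p L) s.
set p := absmaj _ _; set q := absmaj _ _ => p0 q0.
have tn : tau != 0 by rewrite gt_eqF.
have V n : 0 < 1 / tau ^+ n by rewrite divr_gt0// exprn_gt0.
have V1 : 1 / tau ^+ 4 <= 1 / tau ^+ 2.
  by rewrite !div1r lef_pV2 ?posrE ?exprn_gt0// ler_weXn2l.
have V2 : 1 / tau ^+ 3 <= 1 / tau.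
  by rewrite !div1r lef_pV2 ?posrE ?exprn_gt0// -{1}(expr1 tau) ler_weXn2l.
have qV4 : 0 <= q * (1 / tau ^+ 4) by rewrite mulr_ge0// ltW.
have pV4 : 0 <= p * (1 / tau ^+ 4) by rewrite mulr_ge0// ltW.
have pV5 : 0 <= p * (1 / tau ^+ 5) by rewrite mulr_ge0// ltW.
have qV5 : 0 <= q * (1 / tau ^+ 5) by rewrite mulr_ge0// ltW.
have pV3 : 0 <= p * (1 / tau ^+ 3) by rewrite mulr_ge0// ltW.
have qV3 : 0 <= q * (1 / tau ^+ 3) by rewrite mulr_ge0// ltW.
have pV2 : 0 <= p * (1 / tau ^+ 2) by rewrite mulr_ge0// ltW.
rewrite -subr_ge0; case: i iN => [|[|[|[|[|]]]]] // _; rewrite /wray.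
- rewrite (_ : _ - _ = 4 * (p * (1 / tau ^+ 5)) + 8 * (q * (1 / tau ^+ 5))); first lra.
  by field.
- rewrite (_ : _ - _ = 2 * (p * (1 / tau ^+ 4)) + 8 * (q * (1 / tau ^+ 4))); first lra.
  by field.
- rewrite (_ : _ - _ = 2 * (p * (1 / tau ^+ 3)) + 4 * (q * (1 / tau ^+ 3))); first lra.
  by field.
- rewrite (_ : _ - _ = 2 * (p * (1 / tau ^+ 2)) + 2 * (q * (1 / tau ^+ 2)) +
    2 * (q * (1 / tau ^+ 2 - 1 / tau ^+ 4))).
    have : 0 <= q * (1 / tau ^+ 2 - 1 / tau ^+ 4) by rewrite mulr_ge0// subr_ge0.
    by have : 0 <= q * (1 / tau ^+ 2) by [rewrite mulr_ge0// ltW]; lra.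
  by field.
rewrite (_ : _ - _ = 2 * (q * (1 / tau - 1 / tau ^+ 3))).
  by rewrite mulr_ge0// mulr_ge0// subr_ge0.
by field.
Qed.

(** The difference from the free solution solves the full system with p and q times the free
    solution as source. The size of this source is governed by [kray L / tau], and [eta] measures
    the discrepancy of the initial data. *)
Lemma ray_comparison L tau (c : nat -> C) m c0 m0 (A eta : R) :
  1 <= tau -> linsol 5 (A5 L (lray tau)) c m -> free_solution tau c0 m0 ->
  0 <= A -> 0 <= eta ->
  (forall i t, (i < 5)%N -> 0 <= t <= 1 ->
     `|m0 i t| <= A * wray tau i * expR (tau * t)) ->
  (forall i, (i < 5)%N -> cmod (c i - (c0 i)%:C) <= eta * wray tau i) ->
  cmod (m 0%N 1 - (m0 0%N 1)%:C) <=
   wray tau 0 * ((eta + A) * expR (tau + rI 0 1 (kray L) / tau) - A * expR tau).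
Proof.
move=> tau1 hm [cm0 hm0] A0 eta0 bm0 hc.
have tau0 : 0 < tau by apply: lt_le_trans tau1.
have w0 i : 0 < wray tau i by exact: wray_gt0.
have hk := kray_L1 L.
pose k s := kray L s / tau.
have hk1 : rL1 k by apply: rL1_eq (rL1Z tau^-1 hk) => s _; rewrite mulrC.
have k0 s : 0 <= k s by rewrite divr_ge0 ?kray_ge0// ltW.
pose g s := tau + k s.
have hg : rL1 g by apply: rL1D => //; exact: rbm_L1 (rbm_cst _).
have g0 s : 0 <= g s by rewrite addr_ge0// ltW.
pose e s := expR (tau * s).
have rIone s : 0 <= s -> rI 0 s (fun=> 1 : R) = s by move=> s0; rewrite rIcst// subr0 mul1r.
have one_L1 : rL1 (fun _ : R => 1 : R) by exact: rbm_L1 (rbm_cst _).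
have be : rbm e.
  apply: rbm_eq (rbm_expM tau one_L1) => s /andP[s0 _].
  by rewrite /e rIone.
have rIe t : 0 <= t <= 1 -> rI 0 t (fun s => tau * e s) = e t - 1.
  move=> /andP[t0 t1]; rewrite rIZ//; last exact: rbm_L1.
  have -> : rI 0 t e = rI 0 t (fun s => 1 * expR (tau * rI 0 s (fun=> 1))).
    by apply: eq_rI => s /andP[s0 _]; rewrite mul1r rIone.
  by rewrite rI_expRM ?t0// rIone// mulrC divfK// gt_eqF.
pose E s := expR (1 * rI 0 s g).
have bE : rbm E by exact: rbm_expM.
have rIE t : 0 <= t <= 1 -> rI 0 t (fun s => g s * E s) = E t - 1.
  by move=> t01; rewrite rI_expRM// divr1.
have gE_L1 : rL1 (fun s => g s * E s).
  by apply: rL1_eq (rL1M bE hg) => s _; rewrite mulrC.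
have eE t : 0 <= t <= 1 -> e t <= E t.
  move=> /andP[t0 t1]; rewrite ler_expR mul1r rID//; last exact: rbm_L1 (rbm_cst _).
  by rewrite rIcst// subr0 lerDl rI_ge0.
(* With k = kray / tau and e = exp (tau s), this is the solution of X' = (tau + k) X + k A e with
   X(0) = eta, so the products [wray tau i * X] form a supersolution. *)
pose X s := (eta + A) * E s - A * e s.
have X0 t : 0 <= t <= 1 -> 0 <= X t.
  move=> t01; have := eE t t01; have : 0 <= E t by exact: expR_ge0.
  rewrite /X; move: (E t) (e t) => Et et Et0 h.
  have : 0 <= A * (Et - et) by rewrite mulr_ge0// subr_ge0.
  have : 0 <= eta * Et by rewrite mulr_ge0.
  by lra.
have bX : rbm X by apply: rbmB; apply: rbmM => //; exact: rbm_cst.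
have bm i : (i < 5)%N -> rbm (m0 i).
  by move=> iN; exact/rbm_continuous/continuous_subspaceT/cm0.
have m0L i : (i < 5)%N -> rL1 (m0 i) by move=> iN; exact/rbm_L1/bm.
have cbm0 i : (i < 5)%N -> cbm (fun s => (m0 i s)%:C).
  by move=> iN; exact: cbm_real (bm i iN).
have pL := coef_p_L1 L; have qL := coef_q_L1 L.
pose h0 (i : nat) s : C := match i with
  | 1 => coef_p L s * (m0 0%N s)%:C | 3 => coef_q L s * (m0 0%N s)%:C
  | 4 => coef_q L s * (m0 1%N s)%:C + coef_p L s * (m0 3%N s)%:C | _ => 0 end.
pose h i s := if 0 <= s <= 1 then h0 i s else 0.
have h0L i : cL1 (h0 i).
  have M (f : R -> C) j : cL1 f -> (j < 5)%N -> cL1 (fun s => f s * (m0 j s)%:C).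
    by move=> hf jN; apply: cL1_eq (cL1M (cbm0 j jN) hf) => s _; rewrite mulrC.
  have z0 : cL1 (fun _ : R => 0 : C) by exact: cbm_L1 (cbm_cst _).
  by case: i => [|[|[|[|[|i]]]]]; rewrite /h0;
    first [exact: z0|exact: M|apply: cL1D; exact: M].
have lamE : cmod (lray tau) <= tau ^+ 4 / 4.
  by rewrite cmod_real normrN ger0_norm// divr_ge0// exprn_ge0// ltW.
have -> : wray tau 0 * ((eta + A) * expR (tau + rI 0 1 (kray L) / tau) - A * expR tau)
   = wray tau 0 * X 1.
  rewrite /X /E /e mulr1 mul1r /g rID//; try exact: rbm_L1 (rbm_cst _).
  rewrite rIcst// subr0 mulr1 /k.
  have -> // : rI 0 1 (fun s => kray L s / tau) = rI 0 1 (kray L) / tau.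
  rewrite mulrC -(rIZ _ hk)//; apply: eq_rI => s _; exact: mulrC.
have t11 : 0 <= (1 : R) <= 1 by rewrite ler01 lexx.
apply: (@volterra_comparison _ 5 (A5 L (lray tau)) (a5 L (tau ^+ 4 / 4)) (A5_L1 L _)
  (a5_L1 L _) (fun i j s => A5_le L i j s lamE)
  (fun i s => m i s - (m0 i s)%:C) (fun i => c i - (c0 i)%:C) h
  (fun i s => k s * (A * wray tau i * e s)) (fun i s => wray tau i * X s)) => //.
- by move=> i iN; apply: cbmB; [by have [] := hm i iN|exact: cbm0].
- by move=> i iN; apply: rbmM => //; exact: rbm_cst.
- by move=> i; apply: cL1_eq (h0L i) => s s01; rewrite /h s01.
- move=> i; apply: rL1_eq (rL1M (rbmM (rbm_cst (A * wray tau i)) be) hk1) => s _.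
  by rewrite mulrC.
- move=> i s; rewrite /h; case: ifPn => s01; last first.
    rewrite cmod0; exact: mulr_ge0 (k0 s) (mulr_ge0 (mulr_ge0 A0 (ltW (w0 i))) (expR_ge0 _)).
  have iw (j : nat) : (j < 5)%N -> `|m0 j s| <= wray tau j * (A * e s).
    by move=> jN; apply: le_trans (bm0 j s jN s01) _; rewrite mulrAC mulrC.
  have e0 : 0 <= A * e s by rewrite mulr_ge0// expR_ge0.
  have P1 (f : R -> C) j : (j < 5)%N -> cmod (f s * (m0 j s)%:C) <=
      absmaj f s * wray tau j * (A * e s).
    move=> jN; rewrite cmodM cmod_real -mulrA ler_pM ?cmod_ge0 ?cmod_absmaj//.
    exact: iw.
  suff S : cmod (h0 i s) <= wray tau i * k s * (A * e s).
    by apply: le_trans S _; rewrite le_eqVlt; apply/orP; left; apply/eqP; ring.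
  have iN5 : (5 <= i)%N -> cmod (h0 i s) <= wray tau i * k s * (A * e s).
    by case: i => [|[|[|[|[|i]]]]] // _; rewrite cmod0;
      exact: mulr_ge0 (mulr_ge0 (ltW (w0 _)) (k0 s)) e0.
  have [/iN5//|iN] := leqP 5 i.
  have := a5_wray L s tau1 iN.
  rewrite (@a5E _ L (tau ^+ 4 / 4) i (wray tau) s iN) mulrDr -/(k s) => hw.
  have p0 := absmaj_ge0 (coef_p L) s; have q0 := absmaj_ge0 (coef_q L) s.
  have tn : tau != 0 by rewrite gt_eqF.
  have W1 : tau ^+ 4 / 4 * wray tau 0 = 2^-1 by rewrite /wray; field.
  have W2 : tau ^+ 4 / 4 * wray tau 1 = tau / 2 by rewrite /wray; field.
  have W3 : wray tau 4 * tau = tau / 2 by rewrite /wray; field.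
  have W4 : wray tau 3 * tau = 1 by rewrite /wray; field.
  have W5 : wray tau 1 * tau = 2 * wray tau 2 by rewrite /wray; field.
  case: i iN iN5 hw => [|[|[|[|[|]]]]] // _ _ hw; rewrite /h0 ?cmod0.
  + exact: mulr_ge0 (mulr_ge0 (ltW (w0 _)) (k0 s)) e0.
  + apply: le_trans (P1 _ _ _) _ => //; rewrite ler_wpM2r//; lra.
  + exact: mulr_ge0 (mulr_ge0 (ltW (w0 _)) (k0 s)) e0.
  + apply: le_trans (P1 _ _ _) _ => //; rewrite ler_wpM2r//.
    by rewrite mulrDl W1 W4 /wray in hw *; lra.
  + apply: le_trans (cmodD _ _) (le_trans (lerD (P1 _ _ _) (P1 _ _ _)) _) => //.
    rewrite -mulrDl ler_wpM2r//.
    by rewrite [X in X + _ <= _]mulrDl W2 W3 in hw; lra.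
- by move=> i s _ s01; rewrite mulr_ge0 ?X0// ltW.
- move=> i t iN t01; have [hi ->//] := hm i iN; have [e1 e2 e3 e4 e5] := hm0 t t01.
  have /andP[t0 t1] := t01.
  pose fr (i : nat) s : R := match i with
   | 0 => m0 1%N s | 1 => 2 * m0 2%N s | 2 => m0 3%N s
   | 3 => tau ^+ 4 / 4 * m0 0%N s + m0 4%N s | _ => tau ^+ 4 / 4 * m0 1%N s end.
  have frL : rL1 (fr i).
    case: i iN hi => [|[|[|[|[|]]]]] // _ _; rewrite /fr;
    first [exact: m0L|exact/rL1Z/m0L|apply: rL1D; [exact/rL1Z/m0L|exact: m0L]].
  have -> : m0 i t = c0 i + rI 0 t (fr i).
    case: i iN hi frL => [|[|[|[|[|]]]]] // _ _ _.
    + by rewrite e2 -(rIZ _ (m0L 2%N isT)).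
    + rewrite e4 -(rIZ _ (m0L 0%N isT))// -addrA -rID//; last exact: m0L.
      exact/rL1Z/m0L.
    + by rewrite e5 -(rIZ _ (m0L 1%N isT)).
  have -> : (c0 i + rI 0 t (fr i))%:C = (c0 i)%:C + cI 0 t (fun s => (fr i s)%:C).
    by rewrite cI_real; exact: rmorphD.
  rewrite opprD addrACA -cIB//; last 2 first.
  + apply: cL1_sum => j _; have [hj _] := hm j (ltn_ord j).
    by apply: cL1_eq (cL1M hj (A5_L1 L (lray tau) i j)) => s _; rewrite mulrC.
  + exact: cL1_real.
  congr (_ + _); apply: eq_cI => s /andP[s0 st].
  rewrite /h s0 (le_trans st t1)/= (@A5E _ L _ _ (fun i s => m i s - (m0 i s)%:C))//.
  rewrite A5E// /lray /fr /h0 rmorphN.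
  by case: i iN hi frL => [|[|[|[|[|]]]]] // _ _ _;
    rewrite ?rmorphD ?rmorphM ?rmorph_nat; ring.
move=> i t iN t01; have /andP[t0 t1] := t01.
have AeL : rL1 (fun s => tau * e s) by apply: rL1Z; exact: rbm_L1.
have I1 : wray tau i * eta + rI 0 t (fun s => wray tau i * ((eta + A) * (g s * E s) -
     A * (tau * e s))) = wray tau i * X t.
  have l1 := rL1Z (eta + A) gE_L1; have l2 := rL1Z A AeL.
  rewrite rIZ//; last exact: rL1B.
  by rewrite rIB// rIZ// rIE// rIZ// rIe// /X; ring.
rewrite -I1 [wray tau i * eta]mulrC; apply: lerD; first exact: hc.
apply: rI_le => //.
- apply: rL1D.
    apply: rL1_sum => j.
    apply: rL1_eq (rL1M (rbmM (rbm_cst (wray tau j)) bX) (a5_L1 L (tau ^+ 4 / 4) i j)) => s _.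
    by rewrite mulrC.
  apply: rL1_eq (rL1M (rbmM (rbm_cst (A * wray tau i)) be) hk1) => s _.
  by rewrite mulrC.
- by apply: rL1Z; apply: rL1B; [exact: rL1Z|exact: rL1Z].
move=> s /andP[s0 st]; have s01 : 0 <= s <= 1 by rewrite s0 (le_trans st).
have := a5_wray L s tau1 iN; rewrite -/(k s) -/(g s) => hw.
have := ler_wpM2r (X0 s s01) hw; rewrite mulr_suml => {}hw.
apply: (@le_trans _ _ (wray tau i * g s * X s + k s * (A * wray tau i * e s))).
  rewrite lerD2r; apply: le_trans hw.
  by rewrite le_eqVlt; apply/orP; left; apply/eqP/eq_bigr => j _; ring.
by rewrite le_eqVlt; apply/orP; left; apply/eqP; rewrite /X /g; ring.
Qed.

End RayComparison.

(** * Leading terms of the minors on the negative ray *)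

Section RayAsymptotics.
Context {R : realType}.
Notation C := R[i].
Implicit Types (s t x y tau rho th : R) (L : problem R) (lam mu z : C).

Lemma expRB1_le x : expR x - 1 <= x * expR x.
Proof.
have := expR_ge1Dx (- x); rewrite -(ler_pM2r (expR_gt0 x)) -expRD addNr expR0.
by rewrite mulrDl mul1r mulNr; lra.
Qed.

(** The bound of [ray_comparison] linearized in kap / tau: one part is due to the initial data, the
    other to the coefficients. *)
Let error_bound tau (w eta A kap : R) : 1 <= tau -> 0 <= w -> 0 <= eta -> 0 <= A ->
  0 <= kap ->
  w * ((eta + A) * expR (tau + kap / tau) - A * expR tau) <=
  expR tau * expR kap * (w * eta + w * A * kap / tau).
Proof.
move=> tau1 w0 eta0 A0 k0; have tau0 : 0 < tau by apply: lt_le_trans tau1.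
set kt := kap / tau.
have kt0 : 0 <= kt by rewrite divr_ge0// ltW.
have h1 : expR kt <= expR kap.
  by rewrite ler_expR /kt ler_pdivrMr// ler_peMr.
have h2 : expR kt - 1 <= kt * expR kap.
  by apply: le_trans (expRB1_le kt) _; rewrite ler_wpM2l.
rewrite expRD -subr_ge0.
rewrite (_ : _ - _ = w * expR tau * (eta * (expR kap - expR kt) +
   A * (kt * expR kap - (expR kt - 1)))); last by rewrite /kt; field; rewrite gt_eqF.
rewrite mulr_ge0 ?mulr_ge0 ?expR_ge0// addr_ge0// mulr_ge0// subr_ge0//.
Qed.

(** The prefactor, here and in the two analogues, is the size of the free solution in the norm
    weighted by [wray]; times [wray tau 0] it gives the order 1, 2 / tau^3 or 1 / tau^2 of component
    0. *)
Let free_bound22 tau i t : 1 <= tau -> (i < 5)%N -> 0 <= t <= 1 ->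
  `|free22 tau i t| <= tau ^+ 4 / 2 * wray tau i * expR (tau * t).
Proof.
move=> tau1 iN /andP[t0 t1]; have tau0 : 0 < tau by apply: lt_le_trans tau1.
have tn : tau != 0 by rewrite gt_eqF.
have [b0 b1 b2 b3] := E_bounds (ltW tau0) t0.
have e1 : 1 <= expR (tau * t) by rewrite -{1}expR0 ler_expR mulr_ge0// ltW.
have P n : 0 < tau ^+ n by rewrite exprn_gt0.
have N n : `|tau ^+ n| = tau ^+ n by rewrite gtr0_norm.
case: i iN => [|[|[|[|[|]]]]] // _; rewrite /free22 /wray.
- rewrite (_ : tau ^+ 4 / 2 * (2 / tau ^+ 4) = 1); last by field.
  move: b0; rewrite !ler_norml => /andP[? ?]; apply/andP; split; lra.
- rewrite (_ : tau ^+ 4 / 2 * (2 / tau ^+ 3) = tau); last by field.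
  rewrite normrM normrM gtr0_norm// [`|2^-1|]ger0_norm//.
  by apply: le_trans (ler_wpM2l _ b3) _; [lra|rewrite ler_wpM2r ?expR_ge0//; lra].
- rewrite (_ : tau ^+ 4 / 2 * (1 / tau ^+ 2) = tau ^+ 2 / 2); last by field.
  rewrite normrM normrM N [`|4^-1|]ger0_norm//; have := P 2 => p2.
  by apply: le_trans (ler_wpM2l _ b2) _; [lra|rewrite ler_wpM2r ?expR_ge0//; lra].
- rewrite (_ : tau ^+ 4 / 2 * (1 / tau) = tau ^+ 3 / 2); last by field.
  rewrite normrM normrM N [`|4^-1|]ger0_norm//; have := P 3 => p3.
  by apply: le_trans (ler_wpM2l _ b1) _; [lra|rewrite ler_wpM2r ?expR_ge0//; lra].
rewrite normrM normrM N [`|8^-1|]ger0_norm//; have := P 4 => p4.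
have b : `|E0 tau t - 1| <= 2 * expR (tau * t).
  by move: b0; rewrite !ler_norml => /andP[? ?]; apply/andP; split; lra.
apply: le_trans (ler_wpM2l _ b) _; first lra.
by rewrite mulrA ler_wpM2r ?expR_ge0//; lra.
Qed.

Let free_bound32 tau i t : 1 <= tau -> (i < 5)%N -> 0 <= t <= 1 ->
  `|free32 tau i t| <= tau * wray tau i * expR (tau * t).
Proof.
move=> tau1 iN /andP[t0 t1]; have tau0 : 0 < tau by apply: lt_le_trans tau1.
have tn : tau != 0 by rewrite gt_eqF.
have [b0 b1 b2 b3] := E_bounds (ltW tau0) t0.
have P n : 0 < tau ^+ n by rewrite exprn_gt0.
have Q (k : R) n : 0 <= k -> `|k / tau ^+ n| = k / tau ^+ n.
  by move=> k0; rewrite ger0_norm// divr_ge0// ltW.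
case: i iN => [|[|[|[|[|]]]]] // _; rewrite /free32 /wray.
- rewrite (_ : tau * (2 / tau ^+ 4) = 2 / tau ^+ 3); last by field.
  by rewrite normrM Q// ler_wpM2l// divr_ge0// ltW.
- rewrite (_ : tau * (2 / tau ^+ 3) = 2 / tau ^+ 2); last by field.
  by rewrite normrM Q// ler_wpM2l// divr_ge0// ltW.
- rewrite (_ : tau * (1 / tau ^+ 2) = 1 / tau ^+ 1); last by field.
  by rewrite -{1}(expr1 tau) normrM Q// ler_wpM2l// divr_ge0// ltW.
- by rewrite mul1r divff// mul1r.
rewrite (_ : tau * (1 / 2) = tau / 2); last by field.
have d0 : 0 <= tau / 2 by lra.
by rewrite normrM (ger0_norm d0) ler_wpM2l.
Qed.

Let free_bound42 tau i t : 1 <= tau -> (i < 5)%N -> 0 <= t <= 1 ->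
  `|free42 tau i t| <= tau ^+ 2 / 2 * wray tau i * expR (tau * t).
Proof.
move=> tau1 iN /andP[t0 t1]; have tau0 : 0 < tau by apply: lt_le_trans tau1.
have tn : tau != 0 by rewrite gt_eqF.
have [b0 b1 b2 b3] := E_bounds (ltW tau0) t0.
have P n : 0 < tau ^+ n by rewrite exprn_gt0.
have Q (k : R) n : 0 <= k -> `|k / tau ^+ n| = k / tau ^+ n.
  by move=> k0; rewrite ger0_norm// divr_ge0// ltW.
case: i iN => [|[|[|[|[|]]]]] // _; rewrite /free42 /wray.
- rewrite (_ : tau ^+ 2 / 2 * (2 / tau ^+ 4) = 1 / tau ^+ 2); last by field.
  by rewrite normrM Q// ler_wpM2l// divr_ge0// ltW.
- rewrite (_ : tau ^+ 2 / 2 * (2 / tau ^+ 3) = 1 / tau ^+ 1); last by field.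
  by rewrite -{1}(expr1 tau) normrM Q// ler_wpM2l// divr_ge0// ltW.
- rewrite (_ : tau ^+ 2 / 2 * (1 / tau ^+ 2) = 1 / 2); last by field.
  by rewrite normrM [`|1 / 2|]ger0_norm// ler_wpM2l.
- rewrite (_ : tau ^+ 2 / 2 * (1 / tau) = tau / 2); last by field.
  have d0 : 0 <= tau / 2 by lra.
  by rewrite normrM (ger0_norm d0) ler_wpM2l.
rewrite (_ : tau ^+ 2 / 2 * (1 / 2) = tau ^+ 2 / 4); last by field.
have d0 : 0 <= tau ^+ 2 / 4 by have := P 2%N; lra.
by rewrite normrM (ger0_norm d0) ler_wpM2l.
Qed.

(** Only the first datum is prescribed. Against [wray] the others weigh at most a multiple of tau^3,
    whereas the free solution weighs tau^4 / 2; hence the relative error of order 1 / tau. *)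
Lemma ray22 L (c : nat -> C) : c 0%N = 1 -> exists2 C1 : R, 0 <= C1 &
  forall tau m, 1 <= tau -> linsol 5 (A5 L (lray tau)) c m ->
  cmod (m 0%N 1 - (free22 tau 0 1)%:C) <= C1 * expR tau / tau.
Proof.
move=> c0; pose kap := rI 0 1 (kray L).
have k0 : 0 <= kap by rewrite rI_ge0// => s _; exact: kray_ge0.
pose M : R := 2 * \sum_(i < 5) cmod (c i).
have M0 : 0 <= M by rewrite mulr_ge0// sumr_ge0// => i _; exact: cmod_ge0.
exists (expR kap * (2 * M + kap)) => [|tau m tau1 hm].
  by rewrite mulr_ge0 ?expR_ge0// addr_ge0// mulr_ge0.
have tau0 : 0 < tau by apply: lt_le_trans tau1.
have tn : tau != 0 by rewrite gt_eqF.
have [hf _ _] := free_solutions tn.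
have A0 : 0 <= tau ^+ 4 / 2 by rewrite divr_ge0// exprn_ge0// ltW.
have eta0 : 0 <= M * tau ^+ 3 by rewrite mulr_ge0// exprn_ge0// ltW.
apply: le_trans (ray_comparison tau1 hm hf A0 eta0 (fun i t => @free_bound22 tau i t tau1) _) _.
  move=> i iN.
  have cM : cmod (c i) <= M / 2.
    rewrite /M mulrC mulKf// (bigD1 (Ordinal iN))//= lerDl sumr_ge0// => j _.
    exact: cmod_ge0.
  have t31 n : 1 <= tau ^+ n by rewrite exprn_ege1.
  case: i iN cM => [|[|[|[|[|]]]]] // _ cM; rewrite /wray ?c0 ?subrr ?cmod0 ?subr0.
  - by rewrite mulr_ge0// divr_ge0// exprn_ge0// ltW.
  - rewrite (_ : M * tau ^+ 3 * _ = 2 * M); last by field.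
    lra.
  - rewrite (_ : M * tau ^+ 3 * _ = M * tau); last by field.
    have : M <= M * tau by rewrite ler_peMr.
    lra.
  - rewrite (_ : M * tau ^+ 3 * _ = M * tau ^+ 2); last by field.
    have : M <= M * tau ^+ 2 by rewrite ler_peMr.
    lra.
  have : M <= M * tau ^+ 3 by rewrite ler_peMr.
  lra.
have w0 : 0 <= wray tau 0 by rewrite ltW// wray_gt0.
apply: le_trans (error_bound tau1 w0 eta0 A0 k0) _.
by rewrite le_eqVlt; apply/orP; left; apply/eqP; rewrite /wray; field.
Qed.

(** Only the last datum may differ from the free one. Its weight is 1/2, so it costs 2 |c_4|, to be
    compared with the size [tau] of the free solution. *)
Lemma ray32 L (c : nat -> C) : c 0%N = 0 -> c 1%N = 0 -> c 2%N = 0 -> c 3%N = 1 ->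
  exists2 C1 : R, 0 <= C1 &
  forall tau m, 1 <= tau -> linsol 5 (A5 L (lray tau)) c m ->
  cmod (m 0%N 1 - (free32 tau 0 1)%:C) <= C1 * (expR tau / tau ^+ 3) / tau.
Proof.
move=> c0 c1 c2 c3; pose kap := rI 0 1 (kray L).
have k0 : 0 <= kap by rewrite rI_ge0// => s _; exact: kray_ge0.
pose M : R := 2 * cmod (c 4%N).
have M0 : 0 <= M by rewrite mulr_ge0// cmod_ge0.
exists (expR kap * (2 * M + 2 * kap)) => [|tau m tau1 hm].
  by rewrite mulr_ge0 ?expR_ge0// addr_ge0// mulr_ge0.
have tau0 : 0 < tau by apply: lt_le_trans tau1.
have tn : tau != 0 by rewrite gt_eqF.
have [_ hf _] := free_solutions tn.
apply: le_trans (ray_comparison tau1 hm hf (ltW tau0) M0 (fun i t => @free_bound32 tau i t tau1) _) _.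
  move=> i iN.
  have W : 0 <= M * wray tau i by rewrite mulr_ge0// ltW// wray_gt0.
  case: i iN W => [|[|[|[|[|]]]]] // _ W;
    rewrite ?c0 ?c1 ?c2 ?c3 ?subrr ?cmod0 ?subr0//.
  by rewrite /wray /M; lra.
have w0 : 0 <= wray tau 0 by rewrite ltW// wray_gt0.
apply: le_trans (error_bound tau1 w0 M0 (ltW tau0) k0) _.
by rewrite le_eqVlt; apply/orP; left; apply/eqP; rewrite /wray; field.
Qed.

Lemma ray42 L (c : nat -> C) : c 0%N = 0 -> c 1%N = 0 -> c 2%N = (1 / 2 : R)%:C ->
  c 3%N = 0 -> exists2 C1 : R, 0 <= C1 &
  forall tau m, 1 <= tau -> linsol 5 (A5 L (lray tau)) c m ->
  cmod (m 0%N 1 - (free42 tau 0 1)%:C) <= C1 * (expR tau / tau ^+ 2) / tau.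
Proof.
move=> c0 c1 c2 c3; pose kap := rI 0 1 (kray L).
have k0 : 0 <= kap by rewrite rI_ge0// => s _; exact: kray_ge0.
pose M : R := 2 * cmod (c 4%N).
have M0 : 0 <= M by rewrite mulr_ge0// cmod_ge0.
exists (expR kap * (2 * M + kap)) => [|tau m tau1 hm].
  by rewrite mulr_ge0 ?expR_ge0// addr_ge0// mulr_ge0.
have tau0 : 0 < tau by apply: lt_le_trans tau1.
have tn : tau != 0 by rewrite gt_eqF.
have [_ _ hf] := free_solutions tn.
have A0 : 0 <= tau ^+ 2 / 2 by rewrite divr_ge0// exprn_ge0// ltW.
apply: le_trans (ray_comparison tau1 hm hf A0 M0 (fun i t => @free_bound42 tau i t tau1) _) _.
  move=> i iN.
  have W : 0 <= M * wray tau i by rewrite mulr_ge0// ltW// wray_gt0.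
  case: i iN W => [|[|[|[|[|]]]]] // _ W;
    rewrite ?c0 ?c1 ?c2 ?c3 ?mul0r ?subrr ?cmod0 ?subr0//.
  by rewrite /wray /M; lra.
have w0 : 0 <= wray tau 0 by rewrite ltW// wray_gt0.
apply: le_trans (error_bound tau1 w0 M0 A0 k0) _.
rewrite -subr_ge0 (_ : _ - _ = expR tau * expR kap * (2 * M * (tau - 1)) / tau ^+ 4).
  apply: divr_ge0; last by rewrite exprn_ge0// ltW.
  apply: mulr_ge0; first by rewrite mulr_ge0 ?expR_ge0.
  by apply: mulr_ge0; [exact: mulr_ge0|rewrite subr_ge0].
by rewrite /wray; field.
Qed.

Lemma free_lower tau : 0 < tau -> 6 <= expR tau ->
  [/\ expR tau / 16 <= free22 tau 0 1, expR tau / tau ^+ 3 / 16 <= free32 tau 0 1 &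
   expR tau / tau ^+ 2 / 16 <= free42 tau 0 1].
Proof.
move=> tau0 t6; have [h0 h2 h3] := E_lower (ltW tau0) t6.
have e0 := expR_ge0 tau; have P n : 0 < (tau ^+ n)^-1 by rewrite invr_gt0 exprn_gt0.
rewrite /free22 /free32 /free42; split; first by lra.
  rewrite -subr_ge0 (_ : _ - _ = (2 * E3 tau 1 - expR tau / 16) * (tau ^+ 3)^-1).
    by rewrite mulr_ge0 ?(ltW (P _))//; lra.
  by field; rewrite gt_eqF.
rewrite -subr_ge0 (_ : _ - _ = (E2 tau 1 - expR tau / 16) * (tau ^+ 2)^-1).
  by rewrite mulr_ge0 ?(ltW (P _))//; lra.
by field; rewrite gt_eqF.
Qed.

End RayAsymptotics.

(** * Entire functions *)

Section LocallyAnalytic.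
Context {R : realType}.
Notation C := R[i].
Implicit Types (F G H f g : C -> C) (z w : C) (P Q : {poly C}).

Lemma prim_root_exists n : (0 < n)%N -> exists z : C, n.-primitive_root z.
Proof.
move=> n0; have [s] := closed_field_poly_normal ('X^n - 1 : {poly C}).
have /monicP -> := monicXnsubC (1 : C) n0; rewrite scale1r => E.
have : has n.-primitive_root s.
  apply: has_prim_root => //.
  - apply/allP => z; rewrite -root_prod_XsubC -E unity_rootE rootE !hornerE subr_eq0.
    by [].
  - rewrite -separable_prod_XsubC -E.
    by apply: separable_Xn_sub_1; rewrite pnatr_eq0 -lt0n.
  by rewrite -ltnS -(size_prod_XsubC s idfun) -E size_XnsubC.
by case/hasP => z _ pz; exists z.
Qed.

Lemma cmod_unity n z : (0 < n)%N -> z ^+ n = 1 -> cmod z = 1.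
Proof.
move=> n0 zn; have : cmod z ^+ n = 1 by rewrite -cmodX zn cmod1.
by move/eqP; rewrite pexpr_eq1 ?cmod_ge0// => /eqP.
Qed.

Lemma sum_prim_root n (om : C) j : n.-primitive_root om -> (0 < j < n)%N ->
  \sum_(k < n) om ^+ (k * j) = 0.
Proof.
move=> pr /andP[j0 jn].
have : (om ^+ j) ^+ n - 1 = 0 by rewrite exprAC (prim_expr_order pr) expr1n subrr.
rewrite subrX1 => /eqP; rewrite mulf_eq0 subr_eq0 => /orP[/eqP h|/eqP].
  have : (n %| j)%N by rewrite (prim_order_dvd pr) h.
  by move/(dvdn_leq j0); rewrite leqNgt jn.
by move=> h; rewrite -[RHS]h; apply: eq_bigr => k _; rewrite -exprM mulnC.
Qed.

(** A discrete mean value property. In the Taylor expansion at [z], the sums of the powers of the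
    roots of unity vanish for all exponents strictly between 0 and [n], and no larger exponent
    occurs. *)
Lemma mean_poly n (om : C) P z d : n.-primitive_root om -> (size P <= n)%N ->
  \sum_(k < n) P.[z + d * om ^+ k] = n%:R * P.[z].
Proof.
move=> pr sP; have n0 := prim_order_gt0 pr.
under eq_bigr => k _ do rewrite (nderiv_taylor _ (mulrC _ _)).
rewrite exchange_big/=.
have inner (i : 'I_(size P)) : \sum_(k < n) P^`N(i).[z] * (d * om ^+ k) ^+ i =
    P^`N(i).[z] * d ^+ i * (if i == 0 :> nat then n%:R else 0).
  under eq_bigr => k _ do rewrite exprMn mulrA -exprM.
  rewrite -mulr_sumr; congr (_ * _); case: eqP => [->|/eqP i0].
    by under eq_bigr do rewrite muln0 expr0; rewrite sumr_const card_ord.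
  by rewrite sum_prim_root// lt0n i0 (leq_trans (ltn_ord i)).
under eq_bigr => i _ do rewrite inner.
have [->|P0] := eqVneq P 0; first by rewrite size_poly0 big_ord0 horner0 mulr0.
move: inner => _; have : (0 < size P)%N by rewrite size_poly_gt0.
case: (size P) => // m _; rewrite big_ord_recl/= nderivn0 expr0 mulr1 mulrC.
by rewrite big1 ?addr0// => i _; rewrite mulr0.
Qed.

Lemma cmod_sqr z : cmod z ^+ 2 = complex.Re z ^+ 2 + complex.Im z ^+ 2.
Proof. by case: z => a b /=; rewrite sqr_sqrtr// addr_ge0 ?sqr_ge0. Qed.

(** The mean of the squared modulus over the vertices exceeds its value at the centre by exactly
    d^2; this is the strict gain used in the maximum principle. *)
Lemma mean_cmod_sqr n (om z : C) (d : R) : n.-primitive_root om -> (1 < n)%N ->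
  \sum_(k < n) cmod (z + d%:C * om ^+ k) ^+ 2 = n%:R * (cmod z ^+ 2 + d ^+ 2).
Proof.
move=> pr n1.
have s0 : \sum_(k < n) om ^+ k = 0.
  by rewrite -[RHS](sum_prim_root pr (j := 1)) ?n1//; apply: eq_bigr => k _; rewrite muln1.
have sRe : \sum_(k < n) complex.Re (om ^+ k) = 0.
  transitivity (complex.Re (\sum_(k < n) om ^+ k)); last by rewrite s0.
  by rewrite (big_morph (@complex.Re R) (@ReD R) (erefl : complex.Re (0 : C) = 0)).
have sIm : \sum_(k < n) complex.Im (om ^+ k) = 0.
  transitivity (complex.Im (\sum_(k < n) om ^+ k)); last by rewrite s0.
  by rewrite (big_morph (@complex.Im R) (@ImD R) (erefl : complex.Im (0 : C) = 0)).
have om1 k : complex.Re (om ^+ k) ^+ 2 + complex.Im (om ^+ k) ^+ 2 = 1.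
  rewrite -cmod_sqr cmodX (cmod_unity (prim_order_gt0 pr) (prim_expr_order pr)).
  by rewrite !expr1n.
under eq_bigr => k _.
  rewrite cmod_sqr ReD ImD ReM ImM /= !mul0r subr0 addr0.
  rewrite (_ : _ + _ = (cmod z ^+ 2 + d ^+ 2) + ((2 * d * complex.Re z) * complex.Re (om ^+ k)
    + (2 * d * complex.Im z) * complex.Im (om ^+ k))); last first.
    rewrite cmod_sqr; apply/eqP; rewrite -subr_eq0.
    rewrite (_ : _ - _ = d ^+ 2 * (complex.Re (om ^+ k) ^+ 2 +
      complex.Im (om ^+ k) ^+ 2 - 1)); first by rewrite om1 subrr mulr0.
    by ring.
  over.
rewrite big_split/= sumr_const card_ord big_split/= -!mulr_sumr sRe sIm.
by rewrite !mulr0 !addr0 mulr_natl.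
Qed.

(** Uniform approximability by polynomials on a closed disc serves as the definition of analyticity.
    It is visibly stable under sums, products and uniform limits, and mentions neither derivatives
    nor integrals. *)
Definition papp F z0 (d : R) : Prop := forall eps : R, 0 < eps ->
  exists P, forall z, cmod (z - z0) <= d -> cmod (F z - P.[z]) <= eps.

Definition lanl F z0 : Prop := exists2 d : R, 0 < d & papp F z0 d.

Lemma papp_le F z0 z1 (d d1 : R) : cmod (z1 - z0) + d1 <= d -> papp F z0 d ->
  papp F z1 d1.
Proof.
move=> h hF eps /hF[P hP]; exists P => z hz; apply: hP.
by apply: le_trans (cmod_dist_trans z1 _ _) _; lra.
Qed.

Lemma papp_poly P z0 d : papp (fun z => P.[z]) z0 d.
Proof. by move=> eps e0; exists P => z _; rewrite subrr cmod0 ltW. Qed.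

Lemma poly_bounded P (r : R) : exists2 M : R, 0 <= M &
  forall z, cmod z <= r -> cmod P.[z] <= M.
Proof.
elim/poly_ind: P => [|P c [M M0 hM]].
  by exists 0 => // z _; rewrite horner0 cmod0.
exists (M * `|r| + cmod c) => [|z zr].
  by rewrite addr_ge0 ?cmod_ge0// mulr_ge0.
rewrite !hornerE; apply: le_trans (cmodD _ _) _; rewrite lerD2r cmodM.
by rewrite ler_pM ?cmod_ge0 ?hM// (le_trans zr)// ler_norm.
Qed.

Lemma poly_lipschitz P (r : R) : exists2 L : R, 0 <= L &
  forall z w, cmod z <= r -> cmod w <= r -> cmod (P.[z] - P.[w]) <= L * cmod (z - w).
Proof.
elim/poly_ind: P => [|P c [L L0 hL]].
  by exists 0 => // z w _ _; rewrite !horner0 subrr cmod0 mul0r.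
have [M M0 hM] := poly_bounded P r.
exists (L * `|r| + M) => [|z w zr wr]; first by rewrite addr_ge0// mulr_ge0.
rewrite !hornerE (_ : _ - _ = (P.[z] - P.[w]) * z + P.[w] * (z - w)); last by ring.
apply: le_trans (cmodD _ _) _; rewrite [leRHS]mulrDl !cmodM; apply: lerD.
  rewrite [leRHS]mulrAC ler_pM ?cmod_ge0 ?hL//.
  by rewrite (le_trans zr)// ler_norm.
by rewrite ler_wpM2r ?cmod_ge0// hM.
Qed.

Lemma papp_bounded F z0 d : papp F z0 d -> exists2 M : R, 0 <= M &
  forall z, cmod (z - z0) <= d -> cmod (F z) <= M.
Proof.
move=> /(_ 1 ltr01)[P hP]; have [M M0 hM] := poly_bounded P (cmod z0 + d).
exists (M + 1) => [|z hz]; first by rewrite addr_ge0.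
have h1 := hP z hz; have h2 : cmod P.[z] <= M.
  by apply: hM; have := cmodD (z - z0) z0; rewrite subrK; lra.
by have := cmodD (F z - P.[z]) P.[z]; rewrite subrK; lra.
Qed.

Lemma papp_continuous F z0 d (eps : R) : papp F z0 d -> 0 < eps ->
  exists2 eta : R, 0 < eta & forall z w, cmod (z - z0) <= d -> cmod (w - z0) <= d ->
    cmod (z - w) <= eta -> cmod (F z - F w) <= eps.
Proof.
move=> hF e0; have [|P hP] := hF (eps / 4); first by rewrite divr_gt0.
have [L L0 hL] := poly_lipschitz P (cmod z0 + d).
exists (eps / 2 / (L + 1)) => [|z w hz hw zw]; first by rewrite !divr_gt0// ltr_wpDl.
have bz u : cmod (u - z0) <= d -> cmod u <= cmod z0 + d.
  by move=> hu; have := cmodD (u - z0) z0; rewrite subrK; lra.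
have h1 := hP z hz; have h2 := hP w hw; have h3 := hL z w (bz z hz) (bz w hw).
have h4 : L * cmod (z - w) <= eps / 2.
  apply: le_trans (ler_wpM2l L0 zw) _; rewrite mulrCA ler_piMr//; first lra.
  by rewrite ler_pdivrMr ?ltr_wpDl// mul1r lerDl.
have := cmodD (F z - P.[z]) (P.[z] - P.[w] + (P.[w] - F w)).
have := cmodD (P.[z] - P.[w]) (P.[w] - F w); rewrite [cmod (P.[w] - F w)]cmod_distC.
rewrite (_ : F z - P.[z] + (P.[z] - P.[w] + (P.[w] - F w)) = F z - F w); last by ring.
by lra.
Qed.

Lemma pappD F G z0 d : papp F z0 d -> papp G z0 d -> papp (fun z => F z + G z) z0 d.
Proof.
move=> hF hG eps e0.
have e2 : 0 < eps / 2 by rewrite divr_gt0.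
have [P hP] := hF _ e2; have [Q hQ] := hG _ e2.
exists (P + Q) => z hz; rewrite hornerD opprD addrACA.
by apply: le_trans (cmodD _ _) _; have := hP z hz; have := hQ z hz; lra.
Qed.

Lemma pappM F G z0 d : papp F z0 d -> papp G z0 d -> papp (fun z => F z * G z) z0 d.
Proof.
move=> hF hG eps e0.
have [M M0 hM] := papp_bounded hF; have [N N0 hN] := papp_bounded hG.
pose a : R := Num.min 1 (eps / (M + N + 1)).
have MN : 0 < M + N + 1 by rewrite ltr_wpDl// addr_ge0.
have a0 : 0 < a by rewrite lt_min ltr01 divr_gt0.
have a1 : a <= 1 by rewrite ge_min lexx.
have aMN : a * (M + N + 1) <= eps.
  by rewrite -ler_pdivlMr// ge_min lexx orbT.
have [P hP] := hF _ a0; have [Q hQ] := hG _ a0.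
exists (P * Q) => z hz; rewrite hornerM.
have h1 := hP z hz; have h2 := hQ z hz; have h3 := hM z hz; have h4 := hN z hz.
rewrite (_ : _ - _ = F z * (G z - Q.[z]) + (F z - P.[z]) * G z -
   (F z - P.[z]) * (G z - Q.[z])); last by ring.
apply: le_trans (cmodB _ _) _; rewrite !cmodM.
have k1 := cmodD (F z * (G z - Q.[z])) ((F z - P.[z]) * G z).
rewrite !cmodM in k1; apply: le_trans (lerD k1 (lexx _)) _; apply: le_trans aMN.
have c1 : cmod (F z) * cmod (G z - Q.[z]) <= M * a by rewrite ler_pM ?cmod_ge0.
have c2 : cmod (F z - P.[z]) * cmod (G z) <= a * N by rewrite ler_pM ?cmod_ge0.
have c3 : cmod (F z - P.[z]) * cmod (G z - Q.[z]) <= a * 1.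
  by rewrite ler_pM ?cmod_ge0// (le_trans h2).
by lra.
Qed.

Lemma papp_eq F G z0 d : (forall z, cmod (z - z0) <= d -> F z = G z) ->
  papp F z0 d -> papp G z0 d.
Proof. by move=> FG hF eps /hF[P hP]; exists P => z hz; rewrite -FG// hP. Qed.

Lemma papp_lim F z0 d : (forall eps : R, 0 < eps -> exists2 G, papp G z0 d &
   forall z, cmod (z - z0) <= d -> cmod (F z - G z) <= eps) -> papp F z0 d.
Proof.
move=> h eps e0; have e2 : 0 < eps / 2 by rewrite divr_gt0.
have [G hG FG] := h _ e2; have [P hP] := hG _ e2; exists P => z hz.
by apply: le_trans (cmod_dist_trans (G z) _ _) _; have := FG z hz; have := hP z hz; lra.
Qed.

Lemma papp_subdisc F z0 (d e : R) : e <= d -> papp F z0 d -> papp F z0 e.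
Proof. by move=> ed; apply: papp_le; rewrite subrr cmod0 add0r. Qed.

Lemma lanl_eq F G z0 (d : R) : 0 < d -> (forall z, cmod (z - z0) <= d -> F z = G z) ->
  lanl F z0 -> lanl G z0.
Proof.
move=> d0 FG [e e0 he]; exists (Num.min d e); first by rewrite lt_min d0.
apply: (@papp_eq F) => [z|].
  by rewrite le_min => /andP[zd _]; exact: FG.
by apply: papp_subdisc he; rewrite ge_min lexx orbT.
Qed.

Lemma lanlP2 F G z0 : lanl F z0 -> lanl G z0 -> exists2 d : R, 0 < d &
  papp F z0 d /\ papp G z0 d.
Proof.
move=> [d d0 hd] [e e0 he]; exists (Num.min d e); first by rewrite lt_min d0.
by split; [apply: papp_subdisc hd|apply: papp_subdisc he]; rewrite ge_min lexx ?orbT.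
Qed.

Lemma lanlD F G z0 : lanl F z0 -> lanl G z0 -> lanl (fun z => F z + G z) z0.
Proof. by move=> hF hG; have [d d0 [? ?]] := lanlP2 hF hG; exists d => //; exact: pappD. Qed.

Lemma lanlM F G z0 : lanl F z0 -> lanl G z0 -> lanl (fun z => F z * G z) z0.
Proof. by move=> hF hG; have [d d0 [? ?]] := lanlP2 hF hG; exists d => //; exact: pappM. Qed.

Lemma lanl_poly P z0 : lanl (fun z => P.[z]) z0.
Proof. by exists 1 => //; exact: papp_poly. Qed.

Lemma lanl_cst c z0 : lanl (fun=> c) z0.
Proof. by apply: (lanl_eq ltr01 _ (lanl_poly c%:P z0)) => z _; rewrite hornerC. Qed.

Lemma lanlZ c F z0 : lanl F z0 -> lanl (fun z => c * F z) z0.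
Proof. by move=> hF; apply: lanlM => //; exact: lanl_cst. Qed.

Lemma lanlB F G z0 : lanl F z0 -> lanl G z0 -> lanl (fun z => F z - G z) z0.
Proof.
move=> hF /(lanlZ (-1)) hG; apply: (lanl_eq ltr01 _ (lanlD hF hG)) => z _.
by rewrite mulN1r.
Qed.

Lemma lanlX F z0 n : lanl F z0 -> lanl (fun z => F z ^+ n) z0.
Proof.
move=> hF; elim: n => [|n IH]; first exact: lanl_cst.
by apply: (lanl_eq ltr01 _ (lanlM hF IH)) => z _; rewrite exprS.
Qed.

Lemma lanl_continuous F z0 (eps : R) : lanl F z0 -> 0 < eps ->
  exists2 eta : R, 0 < eta & forall z, cmod (z - z0) <= eta -> cmod (F z - F z0) <= eps.
Proof.
move=> [d d0 hF] /(papp_continuous hF)[eta eta0 h].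
exists (Num.min d eta) => [|z]; first by rewrite lt_min d0.
by rewrite le_min => /andP[zd ze]; apply: h => //; rewrite subrr cmod0 ltW.
Qed.

Lemma lanl_neq0 F z0 : lanl F z0 -> F z0 != 0 -> exists2 eta : R, 0 < eta &
  forall z, cmod (z - z0) <= eta -> cmod (F z0) / 2 <= cmod (F z).
Proof.
move=> hF; rewrite -cmod_gt0 => F0.
have [|eta eta0 h] := lanl_continuous hF (eps := cmod (F z0) / 2); first by rewrite divr_gt0.
exists eta => // z /h; rewrite cmod_distC => h1.
by have := cmod_sub_ge (F z0) (F z); lra.
Qed.

(** Neumann series: with c = F z0 and q = 1 - F / c, the modulus of q is at most 1/2 near z0, and 1
    / F is the uniform limit of the partial sums of q^k divided by c. *)
Lemma lanlV F z0 : lanl F z0 -> F z0 != 0 -> lanl (fun z => (F z)^-1) z0.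
Proof.
move=> hF F0; have c0 : 0 < cmod (F z0) by rewrite cmod_gt0.
set c := F z0 in F0 c0.
have [|eta eta0 h] := lanl_continuous hF (eps := cmod c / 2); first by rewrite divr_gt0.
pose q z := 1 - c^-1 * F z.
have hq : lanl q z0 by apply: lanlB; [exact: lanl_cst|exact: lanlZ].
have [d d0 hd] := hq; pose e := Num.min d eta.
exists e; first by rewrite lt_min d0.
have hqe : papp q z0 e by apply: papp_subdisc hd; rewrite ge_min lexx.
have q2 z : cmod (z - z0) <= e -> cmod (q z) <= 2^-1.
  rewrite le_min => /andP[_ /h hz].
  have -> : q z = c^-1 * (c - F z) by rewrite /q mulrBr mulVf.
  rewrite cmodM cmodV cmod_distC mulrC ler_pdivrMr//; move: hz; rewrite -/c; lra.
apply: papp_lim => eps eps0.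
have [N hN] := halving_small (2 / cmod c) eps0.
exists (fun z => c^-1 * \sum_(k < N) q z ^+ k) => [|z hz].
  apply: pappM; first by apply: (papp_eq _ (papp_poly (c^-1)%:P z0 e)) => z _; rewrite hornerC.
  elim: N {hN} => [|N IH].
    by apply: (papp_eq _ (papp_poly 0 z0 e)) => z _; rewrite big_ord0 horner0.
  have hX : papp (fun z => q z ^+ N) z0 e.
    elim: N {IH} => [|N IH].
      by apply: (papp_eq _ (papp_poly 1 z0 e)) => z _; rewrite hornerC.
    by apply: (papp_eq _ (pappM hqe IH)) => z _; rewrite exprS.
  by apply: (papp_eq _ (pappD IH hX)) => z _; rewrite big_ord_recr.
have Fz : F z = c * (1 - q z) by rewrite /q opprB addrC subrK mulVKf.
have q1 : 2^-1 <= cmod (1 - q z).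
  by have := cmod_sub_ge 1 (q z); have := q2 z hz; rewrite cmod1; lra.
have q10 : 1 - q z != 0 by rewrite -cmod_gt0; lra.
rewrite Fz (_ : _ - _ = c^-1 * (1 - q z)^-1 * q z ^+ N); last first.
  have := subrX1 (q z) N; set S := \sum_(_ < _) _ => hS.
  have -> : q z ^+ N = 1 + (q z - 1) * S by rewrite -hS addrC subrK.
  by field; rewrite q10 F0.
rewrite !cmodM !cmodV cmodX.
apply: le_trans (ltW hN).
have i1 : (cmod (1 - q z))^-1 <= 2.
  by rewrite -[leRHS]invrK lef_pV2 ?posrE ?invr_gt0//; lra.
have i2 : cmod (q z) ^+ N <= (2 ^+ N)^-1.
  by rewrite -exprVn lerXn2r ?nnegrE ?cmod_ge0 ?invr_ge0 ?q2.
rewrite [2 / _]mulrC ler_pM ?mulr_ge0 ?invr_ge0 ?exprn_ge0 ?cmod_ge0//.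
by rewrite ler_wpM2l ?invr_ge0 ?cmod_ge0.
Qed.

Lemma lanl_comp_poly H P z0 : lanl H P.[z0] -> lanl (fun z => H P.[z]) z0.
Proof.
move=> [d d0 hH]; have [L L0 hL] := poly_lipschitz P (cmod z0 + 1).
pose e : R := Num.min 1 (d / (L + 1)).
have L1 : 0 < L + 1 by rewrite ltr_wpDl.
exists e; first by rewrite lt_min ltr01 divr_gt0.
move=> eps /hH[Q hQ]; exists (Q \Po P) => z; rewrite le_min => /andP[z1 z2].
rewrite horner_comp; apply: hQ.
have zb : cmod z <= cmod z0 + 1 by have := cmodD (z - z0) z0; rewrite subrK; lra.
apply: le_trans (hL z z0 zb _) _; first by rewrite lerDl.
move: z2; rewrite ler_pdivlMr// => z2; apply: le_trans z2.
by rewrite mulrC ler_wpM2l ?cmod_ge0// lerDl.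
Qed.

End LocallyAnalytic.

(** * The maximum principle, removable singularities and orders of zeros *)

Section MaximumPrinciple.
Context {R : realType}.
Notation C := R[i].
Implicit Types (F G H f : C -> C) (z w : C) (P Q : {poly C}).

(** Compactness and extreme values are taken in the product topology of R * R, and transported to
    complex numbers by this map. *)
Definition toC (p : R * R) : C := p.1 +i* p.2.

Definition ccont (g : C -> R) : Prop := forall z (e : R), 0 < e ->
  exists2 d : R, 0 < d & forall w, cmod (w - z) <= d -> `|g w - g z| <= e.

Lemma ccont_toC (g : C -> R) (p : R * R) : (forall e : R, 0 < e -> exists2 d : R, 0 < d &
  forall w, cmod (w - toC p) <= d -> `|g w - g (toC p)| <= e) ->
  {for p, continuous (fun q : R * R => g (toC q) : R)}.
Proof.
move=> hg; apply/cvgrPdist_le => e e0; have [d d0 hd] := hg e e0.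
have d2 : 0 < d / 2 by rewrite divr_gt0.
apply/(@nbhs_ballP _ (R * R)%type); exists (d / 2) => //= q [/= q1 q2].
rewrite distrC; apply: hd; apply: le_trans (cmod_le _) _.
rewrite ReB ImB /= distrC [`|q.2 - _|]distrC.
move: q1 q2; rewrite /ball/= => q1 q2; lra.
Qed.

Lemma ccont_cmodB (a : C) : ccont (fun z => cmod (z - a)).
Proof.
move=> z e e0; exists e => // w h; apply: le_trans h.
rewrite ler_norml; apply/andP; split.
  have := cmod_sub_ge (z - a) (w - a).
  by rewrite (_ : z - a - (w - a) = z - w) 1?[cmod (z - w)]cmod_distC; [lra|ring].
by have := cmod_sub_ge (w - a) (z - a); rewrite (_ : w - a - (z - a) = w - z); [lra|ring].
Qed.

Lemma compact_sublevel (g h : C -> R) (r : R) : ccont g -> ccont h ->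
  (forall z, g z <= 0 -> h z <= 0 -> cmod z <= r) ->
  compact [set p | g (toC p) <= 0 /\ h (toC p) <= 0].
Proof.
move=> cg ch gh.
have cl (k : C -> R) : ccont k -> closed [set p | k (toC p) <= 0].
  move=> ck; apply: (@preimage_closed _ _ (fun q => k (toC q)) [set x | x <= 0]).
    by move=> p _; apply: ccont_toC; exact: ck.
  by have := @closed_le R 0; rewrite (_ : [set x | _] = [set x : R | x <= 0]).
apply: (@subclosed_compact _ _ (`[- r, r]%classic `*` `[- r, r]%classic)).
- exact: closedI (cl g cg) (cl h ch).
- by apply: compact_setX; exact: segment_compact.
move=> p [gp hp]; have pr := gh _ gp hp.
have h1 := le_trans (cmod_Re (toC p)) pr; have h2 := le_trans (cmod_Im (toC p)) pr.
by split; rewrite /= in_itv/= -ler_norml.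
Qed.

Lemma compact_disc z0 (r : R) : compact [set p | cmod (toC p - z0) - r <= 0].
Proof.
have c0 : ccont (fun z => cmod (z - z0) - r).
  move=> z e e0; have [d d0 hd] := ccont_cmodB z0 z e0; exists d => // w /hd.
  by rewrite opprB addrA subrK.
have := @compact_sublevel _ _ (r + cmod z0) c0 c0.
rewrite (_ : [set p | _ /\ _] = [set p | cmod (toC p - z0) - r <= 0]).
  apply => z + _; have := cmodD (z - z0) z0; rewrite subrK; lra.
by apply/seteqP; split=> p /= => [[]|].
Qed.

Lemma lanl_cmod_cont f z (e : R) : lanl f z -> 0 < e -> exists2 d : R, 0 < d &
  forall w, cmod (w - z) <= d -> `|cmod (f w) - cmod (f z)| <= e.
Proof.
move=> hf /(lanl_continuous hf)[d d0 hd]; exists d => // w /hd h.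
have h1 := cmod_sub_ge (f w) (f z); have h2 := cmod_sub_ge (f z) (f w).
by rewrite [cmod (f z - f w)]cmod_distC in h2; rewrite ler_norml; apply/andP; split; lra.
Qed.

(* The perturbation eta |z|^2 makes |f| strictly subharmonic, so that its maximum
   violates the mean value inequality at an inner point. *)
Lemma max_principle f (K B : C -> Prop) (M : R) :
  compact [set p | K (toC p)] -> (forall z, K z -> lanl f z) ->
  (forall z, K z -> ~ B z -> exists2 d : R, 0 < d &
     forall w, cmod (w - z) <= d -> K w) ->
  (forall z, K z -> B z -> cmod (f z) <= M) ->
  forall z, K z -> cmod (f z) <= M.
Proof.
move=> cK hf inK fB z1 Kz1.
have toCK z : toC (complex.Re z, complex.Im z) = z by case: z.
pose N z := cmod z ^+ 2.
have K0 : [set p | K (toC p)] !=set0.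
  by exists (complex.Re z1, complex.Im z1); rewrite /= toCK.
have cN (eta : R) z (e : R) : 0 < eta -> 0 < e -> exists2 d : R, 0 < d &
    forall w, cmod (w - z) <= d -> `|eta * N w - eta * N z| <= e.
  move=> eta0 e0; have : lanl (fun z => eta%:C * (z * z)) z.
    have hX : lanl (fun z => z) z.
      by apply: (lanl_eq ltr01 _ (lanl_poly 'X z)) => w _; rewrite hornerX.
    by apply: lanlZ; exact: lanlM.
  move=> /(lanl_cmod_cont)/(_ e0)[d d0 hd]; exists d => // w /hd.
  by rewrite !cmodM cmod_real (gtr0_norm eta0) /N !expr2.
have main (eta : R) : 0 < eta -> exists2 z2, K z2 &
    (forall z, K z -> cmod (f z) + eta * N z <= cmod (f z2) + eta * N z2) /\ B z2.
  move=> eta0; pose phi z := cmod (f z) + eta * N z.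
  have cphi : {within [set p | K (toC p)], continuous (fun p => phi (toC p))}.
    apply: continuous_in_subspaceT => p; rewrite inE /= => Kp.
    apply: ccont_toC => e e0; have e2 : 0 < e / 2 by rewrite divr_gt0.
    have [d1 d10 h1] := lanl_cmod_cont (hf _ Kp) e2.
    have [d2 d20 h2] := cN eta (toC p) _ eta0 e2.
    exists (Num.min d1 d2) => [|w]; first by rewrite lt_min d10.
    rewrite le_min => /andP[/h1 k1 /h2 k2].
    rewrite /phi opprD addrACA (le_trans (ler_normD _ _))//; lra.
  have [p Kp hp] := compact_EVT_max K0 cK cphi.
  rewrite inE /= in Kp.
  have hmax z : K z -> phi z <= phi (toC p).
    by move=> Kz; have := hp (complex.Re z, complex.Im z); rewrite inE /= toCK; exact.
  exists (toC p) => //; split => //; apply: contrapT => nB.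
  have [d d0 hd] := inK _ Kp nB; set z := toC p in Kp hmax nB hd.
  have [d' d'0 pf] := hf _ Kp.
  (* On the circle of radius [r] the perturbation gains [eta * r ^+ 2] on average, while replacing
     [f] by a polynomial costs half of that; this contradicts maximality at the centre. *)
  pose r := Num.min d d'; have r0 : 0 < r by rewrite lt_min d0.
  have [|P hP] := pf (eta * r ^+ 2 / 4); first by rewrite divr_gt0// mulr_gt0// exprn_gt0.
  (* Large enough for the discrete mean of [P] to be exact, and greater than 1 as the mean of
     squares requires. *)
  pose n := (size P).+2.
  have [om pr] := @prim_root_exists R n isT.
  have hk k : cmod (z + r%:C * om ^+ k - z) = r.
    rewrite addrAC subrr add0r cmodM cmod_real cmodX gtr0_norm//.
    by rewrite (cmod_unity _ (prim_expr_order pr))// expr1n mulr1.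
  have rd : r <= d by rewrite ge_min lexx.
  have rd' : r <= d' by rewrite ge_min lexx orbT.
  have S1 : \sum_(k < n) phi (z + r%:C * om ^+ k) <= n%:R * phi z.
    rewrite -[n in n%:R]card_ord mulr_natl -sumr_const; apply: ler_sum => k _.
    by apply: hmax; apply: hd; rewrite hk.
  have n0 : 0 < (n%:R : R) by rewrite ltr0n.
  rewrite /phi big_split/= -mulr_sumr mean_cmod_sqr// in S1.
  have eps : cmod (f z - P.[z]) <= eta * r ^+ 2 / 4.
    by apply: hP; rewrite subrr cmod0 ltW.
  have S2 : n%:R * (cmod (f z) - eta * r ^+ 2 / 2) <=
      \sum_(k < n) cmod (f (z + r%:C * om ^+ k)).
    have h1 : n%:R * cmod P.[z] <= \sum_(k < n) cmod P.[z + r%:C * om ^+ k].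
      rewrite -cmod_nat -cmodM -(mean_poly z r%:C pr) ?cmod_sum//.
      by rewrite /n leqW.
    have h2 : \sum_(k < n) cmod P.[z + r%:C * om ^+ k] <=
        \sum_(k < n) (cmod (f (z + r%:C * om ^+ k)) + eta * r ^+ 2 / 4).
      apply: ler_sum => k _; have := hP (z + r%:C * om ^+ k); rewrite hk => /(_ rd').
      have := cmod_sub_ge P.[z + r%:C * om ^+ k] (f (z + r%:C * om ^+ k)).
      by rewrite cmod_distC; lra.
    rewrite big_split/= sumr_const card_ord -mulr_natl in h2.
    have h3 : n%:R * (cmod (f z) - eta * r ^+ 2 / 4) <= n%:R * cmod P.[z].
      rewrite ler_pM2l//; have := cmod_sub_ge (f z) P.[z]; lra.
    lra.
  have : 0 < n%:R * (eta * r ^+ 2) by rewrite mulr_gt0// mulr_gt0// exprn_gt0.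
  by move: S1 S2; rewrite /N; lra.
rewrite -subr_le0.
have [S S0 hS] : exists2 S : R, 0 <= S & forall z, K z -> N z <= S.
  have cNp : {within [set p | K (toC p)], continuous (fun p => N (toC p))}.
    apply: continuous_in_subspaceT => p _.
    apply: ccont_toC => e e0; have [d d0 h] := cN 1 (toC p) e ltr01 e0.
    by exists d => // w /h; rewrite !mul1r.
  have [p Kp hp] := compact_EVT_max K0 cK cNp.
  exists (N (toC p)) => [|z Kz]; first by rewrite exprn_ge0// cmod_ge0.
  by have := hp (complex.Re z, complex.Im z); rewrite inE /= toCK; exact.
apply: (@le0_halving _ _ S) => n.
have [|z2 Kz2 [h2 Bz2]] := main (2 ^+ n)^-1; first by rewrite invr_gt0 exprn_gt0.
have := h2 _ Kz1; have := fB _ Kz2 Bz2; have := hS _ Kz2.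
have p0 : 0 < ((2 : R) ^+ n)^-1 by rewrite invr_gt0 exprn_gt0.
have : 0 <= N z1 by rewrite exprn_ge0// cmod_ge0.
by move: (_^-1) p0 (N z1) (N z2) => p p0 a b *; nra.
Qed.

Lemma max_disc f z0 (r M : R) : (forall z, cmod (z - z0) <= r -> lanl f z) ->
  (forall z, cmod (z - z0) = r -> cmod (f z) <= M) ->
  forall z, cmod (z - z0) <= r -> cmod (f z) <= M.
Proof.
move=> hf fM z zr.
apply: (@max_principle f (fun z => cmod (z - z0) <= r) (fun z => cmod (z - z0) = r)) => //.
  rewrite (_ : [set p | _] = [set p | cmod (toC p - z0) - r <= 0]).
    exact: compact_disc.
  by apply/seteqP; split=> p /=; rewrite subr_le0.
move=> w wr /eqP wn; have wlt : cmod (w - z0) < r by rewrite lt_neqAle wn.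
exists (r - cmod (w - z0)) => [|u hu]; first by rewrite subr_gt0.
  have := cmod_dist_trans w u z0; move: hu wlt; move: (cmod (u - w)) (cmod (u - z0)) => s t; lra.
by move=> w _; exact: fM.
Qed.

Definition anl F : Prop := forall z, lanl F z.

Lemma anl_poly P : anl (fun z => P.[z]).
Proof. by move=> z; exact: lanl_poly. Qed.

Lemma poly_quot P z0 : exists Q, [/\ forall z, P.[z] - P.[z0] = (z - z0) * Q.[z],
  Q.[z0] = (deriv P).[z0] & (size Q <= size P)%N].
Proof.
have : root (P - P.[z0]%:P) z0 by rewrite rootE !hornerE subrr.
case/factor_theorem => Q hQ; exists Q; split.
- move=> z; have : (P - P.[z0]%:P).[z] = (Q * ('X - z0%:P)).[z] by rewrite hQ.
  by rewrite !hornerE => ->; rewrite mulrC.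
- have : deriv (P - P.[z0]%:P) = deriv (Q * ('X - z0%:P)) by rewrite hQ.
  rewrite derivB derivC subr0 derivM derivXsubC mulr1 => ->.
  by rewrite !hornerE subrr mulr0 add0r.
have [->|Q0] := eqVneq Q 0; first by rewrite size_poly0.
have : (size ((P - P.[z0]%:P)%R : {poly C}) <= maxn (size P) 1)%N.
  rewrite (leq_trans (size_polyD _ _))// size_polyN geq_max leq_maxl/=.
  by rewrite (leq_trans (size_polyC_leq1 _))// leq_maxr.
rewrite hQ size_Mmonic ?monicXsubC// size_XsubC addn2 /= leq_max => /orP[/ltnW//|].
by rewrite ltnS leqn0 size_poly_eq0 (negbTE Q0).
Qed.

Definition quot F (z0 l z : C) : C := if z == z0 then l else F z / (z - z0).

(** Removable singularity. Let Q_n be the divided differences at z0 of polynomials P_n tending to F.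
    On the circle of radius d, Q_m - Q_n is controlled by P_m - P_n divided by d; by the maximum
    principle the same bound holds inside, so the Q_n converge uniformly on the disc, also at z0. *)
Lemma papp_quot F z0 (d : R) : 0 < d -> papp F z0 d -> F z0 = 0 ->
  exists l, papp (quot F z0 l) z0 d.
Proof.
move=> d0 hF F0.
have e0 n : 0 < ((2 : R) ^+ n)^-1 by rewrite invr_gt0 exprn_gt0.
have [P hP] := choice (fun n => hF _ (e0 n)).
have [Q hQ] := choice (fun n => poly_quot (P n) z0).
have P0 n : cmod (P n).[z0] <= (2 ^+ n)^-1.
  have := hP n z0; rewrite subrr cmod0 F0 sub0r cmodN; apply; exact: ltW.
have QQ m n z : cmod (z - z0) <= d ->
    cmod ((Q m).[z] - (Q n).[z]) <= 2 / d / 2 ^+ m + 2 / d / 2 ^+ n.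
  move=> hz; rewrite -hornerN -hornerD.
  apply: (@max_disc (fun z => (Q m - Q n).[z]) z0 d) hz.
    by move=> w _; exact: lanl_poly.
  move=> w wd; rewrite -(ler_pM2l d0) -{1}wd -cmodM hornerD hornerN mulrBr.
  have [<- _ _] := hQ m; have [<- _ _] := hQ n.
  have wd' : cmod (w - z0) <= d by rewrite wd.
  have h1 := hP m w wd'; have h2 := hP n w wd'; have k1 := P0 m; have k2 := P0 n.
  rewrite (_ : _ - _ = ((F w - (P n).[w]) - (F w - (P m).[w])) -
    ((P m).[z0] - (P n).[z0])); last by ring.
  have := cmodB ((F w - (P n).[w]) - (F w - (P m).[w])) ((P m).[z0] - (P n).[z0]).
  have := cmodB (F w - (P n).[w]) (F w - (P m).[w]).
  have := cmodB (P m).[z0] (P n).[z0].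
  rewrite (_ : d * (2 / d / 2 ^+ m + 2 / d / 2 ^+ n) = 2 * (2 ^+ m)^-1 + 2 * (2 ^+ n)^-1).
    lra.
  have := expf_neq0 m (lt0r_neq0 (ltr0n R 2)); have := expf_neq0 n (lt0r_neq0 (ltr0n R 2)).
  by move: (2 ^+ m) (2 ^+ n) => x y y0 x0; field; rewrite x0 y0 gt_eqF.
have [l hl] : exists l, forall n, cmod ((Q n).[z0] - l) <= 2 * (2 / d / 2 ^+ n).
  apply: cauchy_limit => [eps eps0|m n]; first exact: halving_small.
  by apply: QQ; rewrite subrr cmod0 ltW.
exists l => eps eps0; have [n hn] := halving_small (4 / d) eps0.
exists (Q n) => z hz; apply: le_trans (ltW hn).
rewrite /quot; case: eqVneq => [->|zz0].
  rewrite cmod_distC; apply: le_trans (hl n) _.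
  by rewrite mulrA [2 * (2 / d)]mulrA -natrM.
have c0 : 0 < cmod (z - z0) by rewrite cmod_gt0 subr_eq0.
have z0n : z - z0 != 0 by rewrite subr_eq0.
apply: (@le_trans _ _ (2 / d / 2 ^+ n)); last first.
  by rewrite ler_wpM2r ?invr_ge0 ?exprn_ge0// ler_wpM2r ?invr_ge0 ?ltW//; lra.
rewrite -subr_le0; apply: (@le0_halving _ _ (2 / d + 2 / cmod (z - z0))) => m.
have h1 := QQ m n z hz.
have h2 : cmod (F z / (z - z0) - (Q m).[z]) <= 2 / cmod (z - z0) / 2 ^+ m.
  have -> : F z / (z - z0) - (Q m).[z] = (F z - (P m).[z] + (P m).[z0]) / (z - z0).
    have [hQm _ _] := hQ m; apply: (mulfI z0n); rewrite mulrBr -hQm mulrCA divff// mulr1.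
    by rewrite [RHS]mulrCA divff// mulr1; ring.
  rewrite cmodM cmodV ler_pdivrMr// mulrAC divfK ?gt_eqF// .
  apply: le_trans (cmodD _ _) _.
  by have := hP m z hz; have := P0 m; lra.
have := cmodD (F z / (z - z0) - (Q m).[z]) ((Q m).[z] - (Q n).[z]).
rewrite addrA subrK mulrDl; lra.
Qed.

Lemma anl_quot F z0 : anl F -> F z0 = 0 ->
  exists G, anl G /\ forall z, F z = (z - z0) * G z.
Proof.
move=> hF F0; have [d d0 hd] := hF z0; have [l hl] := papp_quot d0 hd F0.
exists (quot F z0 l); split => z; last first.
  rewrite /quot; case: eqVneq => [->|zz0]; first by rewrite F0 subrr mul0r.
  by rewrite mulrC divfK// subr_eq0.
have [->|zz0] := eqVneq z z0; first by exists d.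
have c0 : 0 < cmod (z - z0) by rewrite cmod_gt0 subr_eq0.
have c2 : 0 < cmod (z - z0) / 2 by rewrite divr_gt0.
apply: (@lanl_eq _ (fun z => F z * (z - z0)^-1) _ z _ c2).
  move=> w hw; rewrite /quot; case: eqVneq => [wz|//].
  move: hw; rewrite wz cmod_distC => ht; exfalso.
  by clear - c0 ht; lra.
apply: lanlM; first exact: hF.
apply: lanlV; last by rewrite subr_eq0.
by apply: (lanl_eq ltr01 _ (lanl_poly ('X - z0%:P) z)) => w _; rewrite !hornerE.
Qed.

(** The difference quotient is [G] itself, so continuity of [G] at the point is all that is
    needed. *)
Lemma cderiveE F G z0 : lanl G z0 -> (forall z, F z = F z0 + (z - z0) * G z) ->
  cderive F z0 = G z0.
Proof.
move=> hG hF; rewrite /cderive /derive1; apply: (@cvg_lim R[i]^o) => //.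
apply/(@cvgrPdist_le _ R[i]^o) => e e0.
have ee : e = (complex.Re e)%:C.
  by case: e e0 => a b; rewrite ltcE /= => /andP[/eqP -> _].
have e0' : 0 < complex.Re e by move: e0; rewrite {1}ee ltcR.
have [d d0 hd] := lanl_continuous hG e0'.
apply/nbhs_ballP; exists d%:C; first by rewrite /= ltcR.
move=> h /= hh hn0; rewrite (_ : _ *: _ = G (h + z0)); last first.
  rewrite hF addrK addrAC subrr add0r; exact: mulKf.
rewrite cmodE ee lecR /= cmod_distC; apply: hd.
rewrite addrK; move: hh; rewrite /ball/= sub0r normrN cmodE ltcR; exact: ltW.
Qed.

Lemma anl_sub F c : anl F -> anl (fun z => F z - c).
Proof. by move=> hF z; apply: lanlB; [exact: hF|exact: lanl_cst]. Qed.

Lemma anl_taylor1 F z0 : anl F -> exists G, anl G /\ forall z, F z = F z0 + (z - z0) * G z.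
Proof.
move=> hF; have [|G [hG FG]] := anl_quot (anl_sub (F z0) hF) (z0 := z0).
  by rewrite subrr.
by exists G; split => // z; rewrite -FG addrC subrK.
Qed.

(** The derivative of an approximating polynomial approximates the derivative: at each point both
    are values of divided differences, compared by the maximum principle on a circle of radius d /
    2. The accuracy eps d / 4 occurs twice and is divided by d / 2. *)
Lemma anl_cderive F : anl F -> anl (cderive F).
Proof.
move=> hF z0; have [d d0 hd] := hF z0; exists (d / 2); first by rewrite divr_gt0.
move=> eps eps0.
have [|P hP] := hd (eps * d / 4); first by rewrite divr_gt0// mulr_gt0.
exists (deriv P) => z hz.
have [G [hG FG]] := anl_taylor1 z hF; rewrite (cderiveE (hG z) FG).
have [Q [hQ <- _]] := poly_quot P z.
rewrite -hornerN.
have := @max_disc (fun w => G w - Q.[w]) z (d / 2) eps; rewrite hornerN; apply.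
- by move=> w _; apply: lanlB; [exact: hG|exact: lanl_poly].
- move=> w wd; have d2 : 0 < d / 2 by rewrite divr_gt0.
  rewrite -(ler_pM2l d2) -{1}wd -cmodM mulrBr -hQ.
  have -> : (w - z) * G w = F w - F z by rewrite (FG w) addrAC subrr add0r.
  have wd' : cmod (w - z0) <= d by have := cmod_dist_trans z w z0; lra.
  have zd' : cmod (z - z0) <= d by lra.
  have := cmodB (F w - P.[w]) (F z - P.[z]); have := hP w wd'; have := hP z zd'.
  rewrite (_ : F w - P.[w] - (F z - P.[z]) = F w - F z - (P.[w] - P.[z])); last by ring.
  lra.
by rewrite subrr cmod0 divr_ge0// ltW.
Qed.

Lemma cderive_pow F G z0 k : anl G -> (forall z, F z = (z - z0) ^+ k.+1 * G z) ->
  forall z, cderive F z = (z - z0) ^+ k * (k.+1%:R * G z + (z - z0) * cderive G z).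
Proof.
move=> hG FG z; have [G1 [hG1 GG]] := anl_taylor1 z hG.
rewrite (cderiveE (hG1 z) GG).
have [Q [hQ Qz _]] := poly_quot (('X - z0%:P) ^+ k.+1) z.
have hQ' w : (w - z0) ^+ k.+1 - (z - z0) ^+ k.+1 = (w - z) * Q.[w].
  by rewrite -hQ !horner_exp !hornerE.
have Qz' : Q.[z] = k.+1%:R * (z - z0) ^+ k.
  rewrite Qz deriv_exp derivXsubC mul1r hornerMn horner_exp !hornerE.
  by rewrite /= mulr_natl.
have hH : lanl (fun w => (z - z0) ^+ k.+1 * G1 w + Q.[w] * G w) z.
  by apply: lanlD; [exact/lanlZ/hG1|apply: lanlM; [exact: lanl_poly|exact: hG]].
rewrite (cderiveE hH) ?Qz'; first by rewrite exprS; ring.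
move=> w; rewrite !FG; have -> : (w - z0) ^+ k.+1 = (z - z0) ^+ k.+1 + (w - z) * Q.[w].
  by rewrite -hQ' addrCA subrr addr0.
have E := GG w; rewrite mulrDl.
rewrite (_ : (z - z0) ^+ k.+1 * G w = (z - z0) ^+ k.+1 * (G z + (w - z) * G1 w)); last by rewrite -E.
by ring.
Qed.

Lemma anl_eq_punctured F G z0 : anl F -> anl G ->
  (forall z, z != z0 -> F z = G z) -> F z0 = G z0.
Proof.
move=> hF hG FG; apply/eqP; rewrite -subr_eq0; apply/negPn/negP => n0.
have hD : lanl (fun z => F z - G z) z0 by exact: lanlB.
have [eta eta0 h] := lanl_neq0 hD n0.
have : cmod (z0 + eta%:C - z0) <= eta.
  by rewrite addrAC subrr add0r cmod_real gtr0_norm.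
move/h; rewrite (FG (z0 + _)); last first.
  by rewrite -subr_eq0 addrAC subrr add0r -cmod_eq0 cmod_real normr_eq0 gt_eqF.
rewrite subrr cmod0; rewrite -cmod_gt0 in n0.
by move=> ht; clear - n0 ht; lra.
Qed.

(** This translates the vanishing of successive derivatives, by which multiplicities are encoded,
    into divisibility. For the inductive step, F = (z - z0)^(k+1) G and F' = (z - z0)^(k+1) R give
    (k+1) G + (z - z0) G' = (z - z0) R off z0; by continuity G vanishes at z0 and one more factor
    splits off. *)
Lemma vanishing_order k F z0 : anl F ->
  (forall i, (i <= k)%N -> cderiven i F z0 = 0) <->
  exists G, anl G /\ forall z, F z = (z - z0) ^+ k.+1 * G z.
Proof.
have S i F' : cderiven i.+1 F' = cderiven i (cderive F') by rewrite /cderiven /derive1n iterSr.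
elim: k F => [|k IH] F hF.
  split=> [h|[G [hG FG]] i].
    by have [G [hG FG]] := anl_quot hF (h 0%N isT); exists G.
  by rewrite leqn0 => /eqP ->; rewrite /cderiven /= FG subrr expr0n/= mul0r.
split=> [h|[G [hG FG]] i].
  have [G [hG FG]] : exists G, anl G /\ forall z, F z = (z - z0) ^+ k.+1 * G z.
    by apply/IH => // i ik; apply: h; exact: leqW.
  have [Rr [hRr FR]] : exists G, anl G /\ forall z, cderive F z = (z - z0) ^+ k.+1 * G z.
    apply/IH; first exact: anl_cderive.
    by move=> i ik; rewrite -S; exact: h.
  have G0 : G z0 = 0.
    have E : forall z, z != z0 -> k.+1%:R * G z + (z - z0) * cderive G z = (z - z0) * Rr z.
      move=> z zz0; have zk : (z - z0) ^+ k != 0 by rewrite expf_neq0// subr_eq0.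
      apply: (mulfI zk); rewrite -(cderive_pow hG FG) FR exprS; ring.
    have aX H : anl H -> anl (fun z => (z - z0) * H z).
      move=> hH z; apply: lanlM => //.
      by apply: (lanl_eq ltr01 _ (lanl_poly ('X - z0%:P) z)) => w _; rewrite !hornerE.
    have hA : anl (fun z => k.+1%:R * G z + (z - z0) * cderive G z).
      by move=> z; apply: lanlD; [exact/lanlZ/hG|exact/aX/anl_cderive].
    have := anl_eq_punctured hA (aX Rr hRr) E.
    by rewrite subrr !mul0r addr0 => /eqP; rewrite mulf_eq0 pnatr_eq0 /= => /eqP.
  have [G' [hG' GG']] := anl_quot hG G0; exists G'; split => // z.
  by rewrite FG GG' [in RHS]exprS; ring.
case: i => [_|i].
  by rewrite /cderiven /= FG subrr expr0n/= mul0r.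
rewrite ltnS S; move: i; apply/IH; first exact: anl_cderive.
exists (fun z => k.+2%:R * G z + (z - z0) * cderive G z); split.
  move=> z; apply: lanlD; first exact/lanlZ/hG.
  apply: lanlM; last exact: anl_cderive.
  by apply: (lanl_eq ltr01 _ (lanl_poly ('X - z0%:P) z)) => w _; rewrite !hornerE.
exact: cderive_pow.
Qed.

Lemma anl_bounded_disc F (r : R) : anl F -> exists2 M : R, 0 <= M &
  forall z, cmod z <= r -> cmod (F z) <= M.
Proof.
move=> hF; have [r0|r0] := leP 0 r; last first.
  by exists 0 => // z; have := cmod_ge0 z; lra.
have cF : {within [set p | cmod (toC p - 0) - r <= 0], continuous (fun p => cmod (F (toC p)))}.
  apply: continuous_in_subspaceT => p _; apply: (@ccont_toC (fun z => cmod (F z))) => e.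
  exact: lanl_cmod_cont.
have K0 : [set p | cmod (toC p - 0) - r <= 0] !=set0.
  exists (0 : R, 0 : R); change (cmod (0 - 0 : C) - r <= 0).
  by rewrite subr0 cmod0 subr_le0.
have [p _ hp] := compact_EVT_max K0 (@compact_disc 0 r) cF.
exists (cmod (F (toC p))) => [|z zr]; first exact: cmod_ge0.
have toCz : toC (complex.Re z, complex.Im z) = z by case: (z).
have := hp (complex.Re z, complex.Im z); rewrite toCz; apply.
rewrite inE; change (cmod (toC (complex.Re z, complex.Im z) - 0) - r <= 0).
by rewrite toCz subr0 subr_le0.
Qed.

(** A Schwarz lemma with many zeros. On the circle of radius 5r every factor z - a has modulus at
    least 4r, and on the disc of radius r at most 2r; with k zeros the maximum principle gives |G|
    <= M / 2^k there. *)
Lemma anl_many_zeros G (r : R) : 0 < r -> anl G ->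
  (forall k, exists zs G1, [/\ size zs = k, forall a, a \in zs -> cmod a <= r,
     anl G1 & forall z, G z = \prod_(a <- zs) (z - a) * G1 z]) ->
  forall z, cmod z <= r -> G z = 0.
Proof.
move=> r0 hG h z zr; have [M M0 hM] := anl_bounded_disc (5 * r) hG.
apply/eqP; rewrite -cmod_eq0 eq_le cmod_ge0 andbT.
apply: (@le0_halving _ _ M) => k; have [zs [G1 [sz zsr hG1 GG1]]] := h k.
have r5 : 0 < (4 * r) ^+ k by rewrite exprn_gt0// mulr_gt0.
have upper (w : C) (u : R) : (forall a, a \in zs -> cmod (w - a) <= u) ->
    cmod (\prod_(a <- zs) (w - a)) <= u ^+ k.
  rewrite -sz; elim: zs {sz zsr GG1} => [|a s IH] hs; first by rewrite big_nil cmod1 expr0.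
  rewrite big_cons cmodM /= exprS ler_pM ?cmod_ge0//; first by rewrite hs// mem_head.
  by apply: IH => b bs; rewrite hs// in_cons bs orbT.
have lower (w : C) (u : R) : 0 <= u -> (forall a, a \in zs -> u <= cmod (w - a)) ->
    u ^+ k <= cmod (\prod_(a <- zs) (w - a)).
  move=> u0; rewrite -sz; elim: zs {sz zsr GG1 upper} => [|a s IH] hs.
    by rewrite big_nil cmod1 expr0.
  rewrite big_cons cmodM /= exprS ler_pM ?exprn_ge0//; first by rewrite hs// mem_head.
  by apply: IH => b bs; rewrite hs// in_cons bs orbT.
have G1M : cmod (G1 z) <= M / (4 * r) ^+ k.
  apply: (@max_disc G1 0 (5 * r)) => [w _|w|]; [exact: hG1| |rewrite subr0; lra].
  rewrite subr0 => wr; have := hM w; rewrite wr => /(_ (lexx _)).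
  rewrite GG1 cmodM ler_pdivlMr// [cmod (G1 w) * _]mulrC => hle.
  apply: le_trans hle; rewrite ler_wpM2r ?cmod_ge0//.
  apply: lower => [|a /zsr ar]; first by rewrite mulr_ge0// ltW.
  have := cmod_sub_ge w a; rewrite wr; lra.
have pz : cmod (\prod_(a <- zs) (z - a)) <= (2 * r) ^+ k.
  by apply: upper => a /zsr ar; have := cmodB z a; lra.
rewrite GG1 cmodM; apply: le_trans (ler_pM (cmod_ge0 _) (cmod_ge0 _) pz G1M) _.
rewrite le_eqVlt; apply/orP; left; apply/eqP.
rewrite (_ : 4 * r = 2 * (2 * r)); last by ring.
rewrite [X in M / X]exprMn.
have := expf_neq0 k (lt0r_neq0 (ltr0n R 2)).
have : (2 * r) ^+ k != 0 by rewrite expf_neq0// gt_eqF// mulr_gt0.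
by move: ((2 * r) ^+ k) (2 ^+ k) => x y x0 y0; field; rewrite x0 y0.
Qed.

Definition entire_order F z0 k : Prop :=
  exists G, [/\ anl G, G z0 != 0 & forall z, F z = (z - z0) ^+ k * G z].

(** If every order failed, z0 would count as arbitrarily many zeros in a fixed disc, and F would
    vanish at z1. *)
Lemma anl_order F z0 : anl F -> (exists z, F z != 0) -> exists k, entire_order F z0 k.
Proof.
move=> hF [z1 Fz1]; apply: contrapT => nk.
have step k : exists G, anl G /\ forall z, F z = (z - z0) ^+ k * G z.
  elim: k => [|k [G [hG FG]]]; first by exists F; split => // z; rewrite expr0 mul1r.
  have G0 : G z0 = 0 by apply/eqP/negPn/negP => G0; apply: nk; exists k, G.
  have [H [hH GH]] := anl_quot hG G0; exists H; split => // z.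
  by rewrite FG GH exprS; ring.
move/eqP: Fz1; apply.
apply: (@anl_many_zeros F (1 + cmod z0 + cmod z1)) => //.
- by have := cmod_ge0 z0; have := cmod_ge0 z1; lra.
- move=> k; have [G [hG FG]] := step k; exists (nseq k z0), G; split => //.
  + by rewrite size_nseq.
  + by move=> a /nseqP[-> _]; have := cmod_ge0 z1; lra.
  + by move=> z; rewrite FG big_nseq -Monoid.iteropE.
- by have := cmod_ge0 z0; lra.
Qed.

Lemma anl_zeros_quot F zs : anl F -> uniq zs -> (forall a, a \in zs -> F a = 0) ->
  exists G, anl G /\ forall z, F z = \prod_(a <- zs) (z - a) * G z.
Proof.
elim: zs F => [|a zs IH] F hF /=; first by exists F; split => // z; rewrite big_nil mul1r.
case/andP => az uz h; have [G [hG FG]] := anl_quot hF (h a (mem_head _ _)).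
have [|H [hH GH]] := IH G hG uz.
  move=> b bz; have := h b; rewrite in_cons bz orbT => /(_ isT)/eqP.
  rewrite FG mulf_eq0 subr_eq0 => /orP[/eqP ba|/eqP//].
  by move: az; rewrite -ba bz.
by exists H; split => // z; rewrite FG GH big_cons mulrA.
Qed.

Lemma anl_finite_zeros F (r : R) : anl F -> (exists z, F z != 0) ->
  finite_set [set z | F z = 0 /\ cmod z <= r].
Proof.
move=> hF [z1 Fz1]; apply: contrapT => inf.
move/eqP: Fz1; apply.
pose r' := 1 + `|r| + cmod z1.
have rr' : r <= r' by have := ler_norm r; rewrite /r'; have := cmod_ge0 z1; lra.
apply: (@anl_many_zeros F r') => //.
- by rewrite /r'; have := normr_ge0 r; have := cmod_ge0 z1; lra.
- move=> k; have [B Bs Bk] := infinite_set_fset k inf.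
  have [G [hG FG]] : exists G, anl G /\ forall z, F z = \prod_(a <- take k (finmap.enum_fset B)) (z - a) * G z.
    apply: anl_zeros_quot => //; first exact/take_uniq/finmap.fset_uniq.
    by move=> a /mem_take aB; have [] := Bs a aB.
  exists (take k (finmap.enum_fset B)), G; split => //.
  + by rewrite size_takel.
  + by move=> a /mem_take /Bs [_ ar]; exact: le_trans ar rr'.
- by rewrite /r'; have := normr_ge0 r; lra.
Qed.

End MaximumPrinciple.

(** * Lower bounds for polynomials on circles *)

Section MinimumModulus.
Context {R : realType}.
Notation C := R[i].
Implicit Types (z w : C) (P : {poly C}).

(** The [d]-th finite difference with step [h] of a polynomial of degree at most [d] is the constant
    Q_d d! h^d, and it is a combination of the sampled values with total weight 2^d. *)
Lemma finite_difference_bound d (Q : {poly R}) (x h E : R) :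
  (size Q <= d.+1)%N -> 0 <= h ->
  (forall i, (i <= d)%N -> `|Q.[x + i%:R * h]| <= E) ->
  `|Q`_d| * d`!%:R * h ^+ d <= 2 ^+ d * E.
Proof.
move=> sQ h0; elim: d Q E sQ => [|d IH] Q E sQ hE.
  rewrite fact0 expr0 !mulr1 mul1r; have := hE 0%N isT.
  by rewrite [in X in X -> _](size1_polyC sQ) hornerC.
pose D : {poly R} := \sum_(i < d.+1) h ^+ i.+1 *: Q^`N(i.+1).
have coefD j : D`_j = \sum_(i < d.+1) h ^+ i.+1 * (Q`_(i.+1 + j) *+ 'C(i.+1 + j, i.+1)).
  by rewrite coef_sum; apply: eq_bigr => i _; rewrite coefZ coef_nderivn.
have Dd : D`_d = h * (Q`_d.+1 *+ d.+1).
  rewrite coefD big_ord_recl big1 ?addr0 => [|i _]; first by rewrite /= expr1 add1n bin1.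
  by rewrite /bump/= [Q`__]nth_default ?mul0rn ?mulr0// (leq_trans sQ)// !addSn !ltnS leq_addl.
have sD : (size D <= d.+1)%N.
  apply/leq_sizeP => j dj; rewrite coefD big1// => i _.
  rewrite nth_default ?mul0rn ?mulr0// (leq_trans sQ)// addSn ltnS.
  by rewrite (leq_trans dj)// leq_addl.
have hD y : D.[y] = Q.[y + h] - Q.[y].
  rewrite (nderiv_taylor_wide (mulrC _ _) sQ) big_ord_recl nderivn0 expr0 mulr1.
  rewrite addrAC subrr add0r horner_sum; apply: eq_bigr => i _.
  by rewrite hornerZ mulrC lift0.
have hD2 i : (i <= d)%N -> `|D.[x + i%:R * h]| <= 2 * E.
  move=> id; rewrite hD; apply: le_trans (ler_normB _ _) _.
  have -> : x + i%:R * h + h = x + i.+1%:R * h by rewrite -[i.+1%:R]natr1; ring.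
  by have := hE i (leqW id); have := hE i.+1 id; lra.
have := IH D (2 * E) sD hD2; rewrite Dd.
have -> : `|h * (Q`_d.+1 *+ d.+1)| * d`!%:R * h ^+ d =
    `|Q`_d.+1| * (d.+1)`!%:R * h ^+ d.+1.
  by rewrite normrM (ger0_norm h0) normrMn factS natrM exprS -mulr_natr; ring.
by rewrite mulrA -exprSr.
Qed.

(** A weak Stirling bound, by induction from (1 + 1/d)^d <= e. *)
Lemma expnn_fact d : d%:R ^+ d <= expR 1 ^+ d * d`!%:R :> R.
Proof.
elim: d => [|d IH]; first by rewrite fact0 !expr0 mulr1.
have [->|d0] := posnP d.
  by rewrite !expr1 mulr1; have := expR_ge1Dx (1 : R); lra.
have dp : 0 < (d%:R : R) by rewrite ltr0n.
have h1 : (d.+1%:R : R) ^+ d <= expR 1 * d%:R ^+ d.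
  have -> : expR (1 : R) = expR d%:R^-1 ^+ d.
    by rewrite -expRM_natl mulfV// gt_eqF.
  rewrite -exprMn lerXn2r ?nnegrE ?mulr_ge0 ?expR_ge0//.
  rewrite -ler_pdivrMr//; apply: le_trans (expR_ge1Dx _).
  by rewrite -natr1 mulrDl mulfV ?gt_eqF// mul1r.
rewrite exprS factS natrM exprS.
have h2 : expR 1 * d%:R ^+ d <= expR 1 * (expR 1 ^+ d * d`!%:R) :> R.
  by rewrite ler_wpM2l// expR_ge0.
have := ler_wpM2l (ltW (ltr0Sn R d)) (le_trans h1 h2).
by move/le_trans; apply; rewrite le_eqVlt; apply/orP; left; apply/eqP; ring.
Qed.

(** A monic polynomial of degree d cannot be small at all the d + 1 points L + i L / d: its d-th
    difference is d! (L / d)^d, at least (L / e)^d, and at most 2^d times the largest value. *)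
Lemma radius_far_from_points (s : seq R) (L : R) : 0 < L -> exists t : R,
  L <= t <= 2 * L /\ (L / (2 * expR 1)) ^+ size s <= `|\prod_(a <- s) (t - a)|.
Proof.
move=> L0; pose d := size s; pose h := L / d%:R.
have h0 : 0 <= h by rewrite divr_ge0// ltW.
pose Q : {poly R} := \prod_(a <- s) ('X - a%:P).
have Qt (t : R) : \prod_(a <- s) (t - a) = Q.[t].
  by rewrite horner_prod; apply: eq_bigr => a _; rewrite !hornerE.
have sQ : size Q = d.+1 by rewrite size_prod_XsubC.
have lQ : Q`_d = 1 by have := monic_prod_XsubC s xpredT id; rewrite monicE lead_coefE -/Q sQ => /eqP.
have e0 : 0 < expR (1 : R) by exact: expR_gt0.
apply: contrapT => nt.
pose E := (L / (2 * expR 1)) ^+ d.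
have hE i : (i <= d)%N -> `|Q.[L + i%:R * h]| < E.
  move=> id; rewrite ltNge; apply/negP => hQ; apply: nt; exists (L + i%:R * h).
  rewrite Qt; split => //; apply/andP; split.
    by rewrite lerDl mulr_ge0.
  rewrite mulrDl mul1r lerD2l; have [d0|d0] := posnP d.
    by move: id; rewrite d0 leqn0 => /eqP ->; rewrite mul0r ltW.
  have dp : 0 < (d%:R : R) by rewrite ltr0n.
  by rewrite /h mulrA ler_pdivrMr// mulrC ler_pM2l// ler_nat.
have [m hm] : exists2 m : R, m < E & forall i, (i <= d)%N -> `|Q.[L + i%:R * h]| <= m.
  pose m := \big[Num.max/`|Q.[L + 0 * h]|]_(i < d.+1) `|Q.[L + i%:R * h]|.
  exists m => [|i id].
    rewrite /m; elim/big_ind : _ => [|u v hu hv|i _]; first exact: (hE 0%N).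
      by rewrite gt_max hu.
    by apply: hE; rewrite -ltnS.
  by rewrite /m; apply: (le_bigmax _ (fun i : 'I_d.+1 => `|Q.[L + i%:R * h]|) (Ordinal (id : (i < d.+1)%N))).
move=> hmi; have := finite_difference_bound (eq_leq sQ) h0 hmi.
rewrite lQ normr1 mul1r leNgt => /negP; apply.
have p0 : 0 < (2 : R) ^+ d by rewrite exprn_gt0.
apply: (@lt_le_trans _ _ (2 ^+ d * E)); first by rewrite ltr_pM2l.
have L0d : 0 < L ^+ d by rewrite exprn_gt0.
have [d0|d0] := posnP d; first by rewrite /E d0 !expr0 !mulr1.
have dd : 0 < (d%:R : R) ^+ d by rewrite exprn_gt0// ltr0n.
rewrite /E /h !expr_div_n exprMn.
have ed : 0 < expR (1 : R) ^+ d by rewrite exprn_gt0.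
have := expnn_fact d; move: p0 L0d dd ed.
move: (2 ^+ d) (L ^+ d) (d%:R ^+ d) (expR 1 ^+ d) (d`!%:R : R) => p l D e f p0 l0 D0 e0' hD.
rewrite (_ : p * (l / (p * e)) = l / e); last by field; rewrite !gt_eqF.
rewrite mulrA [f * l]mulrC -mulrA ler_pM2l// ler_pdivlMr// mulrC ler_pdivrMr//.
by rewrite mulrC.
Qed.

(** Roots of modulus at least 2r lose at most a factor 3 between z0 and z. For the remaining ones
    |z0 - a| <= 3r, while a good radius in [r / 2, r] keeps the product of the | |z| - |a| | above
    (r / (4e))^k, where k is their number. The quotient of 3r and r / (4e) is the constant 12e. *)
Lemma poly_min_modulus P z0 (r : R) : 0 < r -> cmod z0 <= r -> exists2 t : R,
  r / 2 <= t <= r & forall z, cmod z = t ->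
    cmod P.[z0] <= (12 * expR 1) ^+ (size P).-1 * cmod P.[z].
Proof.
move=> r0 z0r; have [s Ps] := closed_field_poly_normal P.
have [->|P0] := eqVneq P 0.
  by exists r => [|z _]; [rewrite lexx andbT; lra|rewrite !horner0 cmod0 mulr0].
have lP : lead_coef P != 0 by rewrite lead_coef_eq0.
have sP : (size P).-1 = size s.
  by rewrite Ps size_scale// size_prod_XsubC.
have Pz z : P.[z] = lead_coef P * \prod_(a <- s) (z - a).
  rewrite {1}Ps hornerZ horner_prod; congr (_ * _).
  by apply: eq_bigr => a _; rewrite !hornerE.
pose small (a : C) := cmod a < 2 * r.
have r2 : 0 < r / 2 by rewrite divr_gt0.
have [t [tr ht]] := radius_far_from_points [seq cmod a | a <- s & small a] r2.
have e1 : 1 <= expR (1 : R) by have := expR_ge1Dx (1 : R); lra.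
exists t => [|z zt].
  by move: tr; rewrite mulrCA mulfV ?mulr1.
rewrite sP !Pz !cmodM mulrCA ler_wpM2l ?cmod_ge0//.
have A0 : 0 <= 12 * expR (1 : R) by rewrite mulr_ge0// expR_ge0.
have t2 : t <= r by move: tr => /andP[_]; lra.
have t0 : 0 <= t by rewrite -zt cmod_ge0.
have Hsmall (u : seq C) : (forall a, a \in u -> small a) ->
    cmod (\prod_(a <- u) (z0 - a)) <= (3 * r) ^+ size u.
  elim: u => [|a u IH] hu; first by rewrite big_nil cmod1 expr0.
  rewrite big_cons cmodM exprS ler_pM ?cmod_ge0//.
    by have := hu a (mem_head _ _); have := cmodB z0 a; rewrite /small; lra.
  by apply: IH => b bu; apply: hu; rewrite in_cons bu orbT.
have Hsmall2 (u : seq C) :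
    `|\prod_(a <- [seq cmod a | a <- u]) (t - a)| <= cmod (\prod_(a <- u) (z - a)).
  elim: u => [|a u IH]; first by rewrite !big_nil normr1 cmod1.
  rewrite /= !big_cons normrM cmodM ler_pM// ler_norml.
  have h1 := cmod_sub_ge z a; have h2 := cmod_sub_ge a z.
  by rewrite [cmod (a - z)]cmod_distC in h2; rewrite -zt; apply/andP; split; lra.
have Hlarge (u : seq C) : (forall a, a \in u -> ~~ small a) ->
    cmod (\prod_(a <- u) (z0 - a)) <= (12 * expR 1) ^+ size u * cmod (\prod_(a <- u) (z - a)).
  elim: u => [|a u IH] hu; first by rewrite !big_nil cmod1 expr0 mulr1.
  rewrite !big_cons !cmodM exprS mulrACA ler_pM ?cmod_ge0//; last first.
    by apply: IH => b bu; apply: hu; rewrite in_cons bu orbT.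
  have := hu a (mem_head _ _); rewrite /small -leNgt => ra.
  have h1 := cmodB z0 a; have h2 := cmod_sub_ge a z; rewrite cmod_distC zt in h2.
  have h3 : 3 * cmod (z - a) <= 12 * expR 1 * cmod (z - a).
    by rewrite ler_wpM2r ?cmod_ge0//; lra.
  by apply: le_trans h3; lra.
pose s1 := [seq a <- s | small a]; pose s2 := [seq a <- s | ~~ small a].
have split_prod w : \prod_(a <- s) (w - a) = \prod_(a <- s1) (w - a) * \prod_(a <- s2) (w - a).
  by rewrite (bigID small) /= !big_filter.
rewrite !split_prod !cmodM (_ : size s = size s1 + size s2)%N; last first.
  by rewrite !size_filter count_predC.
rewrite exprD mulrACA ler_pM ?cmod_ge0//; last first.
  by apply: Hlarge => a; rewrite mem_filter => /andP[].
apply: (@le_trans _ _ ((3 * r) ^+ size s1)).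
  by apply: Hsmall => a; rewrite mem_filter => /andP[].
rewrite size_map in ht; have := le_trans ht (Hsmall2 s1).
move/(ler_wpM2l (exprn_ge0 (size s1) A0)); apply: le_trans.
rewrite -exprMn (_ : 12 * expR 1 * (r / 2 / (2 * expR 1)) = 3 * r)//; field.
by rewrite gt_eqF// expR_gt0.
Qed.

End MinimumModulus.

(** * Quotients of entire functions of order 1/4 *)

Section Quotients.
Context {R : realType}.
Notation C := R[i].
Implicit Types (F G H : C -> C) (z w : C) (P : {poly C}).

Lemma natr_above (x : R) : exists n : nat, x <= n%:R.
Proof.
exists (Num.bound `|x|); apply: le_trans (ler_norm x) _.
by rewrite ltW// archi_boundP.
Qed.

(** On a bounded set [rho] may be fixed, and [th] equal to 2 already gives convergence in [N]. *)
Lemma ord4_anl F : ord4 F -> anl F.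
Proof.
case=> M [B [M0 B0 hF]] z0; exists 1 => // eps eps0.
pose rho := 2 + cmod z0.
have rho1 : 1 <= rho by rewrite /rho; have := cmod_ge0 z0; lra.
have [N hN] := halving_small (M * expR (2 * (B * rho))) eps0.
have [P [_ hP]] := hF N; exists P => z zd.
apply: le_trans (ltW hN); apply: hP => //; first by rewrite ler1n.
have h : rho <= rho ^+ 4 by rewrite exprS ler_peMr ?exprn_ege1//; lra.
apply: le_trans h; rewrite /rho.
by have := cmodD (z - z0) z0; rewrite subrK; lra.
Qed.

(** For [N] equal to 0 the approximating polynomial is zero, so the rate of approximation is itself
    a growth bound. *)
Lemma ord4_growth F : ord4 F -> exists M B : R, [/\ 0 <= M, 0 <= B &
  forall rho z, 1 <= rho -> cmod z <= rho ^+ 4 -> cmod (F z) <= M * expR (B * rho)].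
Proof.
case=> M [B [M0 B0 hF]]; exists M, B; split => // rho z rho1 zr.
have [P [+ hP]] := hF 0%N; rewrite leqn0 size_poly_eq0 => /eqP P0.
have := hP 1 rho z (lexx _) rho1 zr.
by rewrite P0 horner0 subr0 expr0 divr1 mul1r.
Qed.

Lemma ord4_min_modulus G z0 : ord4 G -> G z0 != 0 ->
  exists2 kap : R, 0 < kap & exists c m0 : nat, forall m, (m0 <= m)%N ->
    exists2 t : R, m%:R ^+ 4 / 2 <= t & forall z, cmod z = t ->
      cmod z <= m%:R ^+ 4 /\ kap <= cmod (G z) * expR (c * m)%:R.
Proof.
case=> M [B [M0 B0 hG]] Gz0; pose A : R := 12 * expR 1.
have e1 : 1 <= expR (1 : R) by have := expR_ge1Dx (1 : R); lra.
have A1 : 1 <= A by rewrite /A; lra.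
have A0 : 0 < A by lra.
(* The error must beat the factor A^N lost in [poly_min_modulus]; the additional factor e^N then
   absorbs the exponential growth in m. *)
pose th := A * expR 1.
have th1 : 1 <= th by rewrite /th mulr_ege1.
pose g := cmod (G z0) / 2.
have g0 : 0 < g by rewrite divr_gt0// cmod_gt0.
have [b hb] := natr_above (th * B); have [c hc] := natr_above (2 * M / g).
have [a ha] := natr_above A; have [m1 hm1] := natr_above (cmod z0).
exists (g / 2); first by rewrite divr_gt0.
(* The degree is proportional to m, that is, to the fourth root of the radius: b m absorbs exp (th B
   m), and c absorbs the constant 2 M / g. *)
exists (a * (b + c))%N, m1.+1 => m m1m; pose N := (b * m + c)%N.
have mR : (1 : R) <= m%:R by rewrite ler1n (leq_trans _ m1m).
have m4 : m%:R <= m%:R ^+ 4 :> R by rewrite exprS ler_peMr ?exprn_ege1//; lra.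
have z0m : cmod z0 <= m%:R ^+ 4.
  by apply: le_trans m4; apply: le_trans hm1 _; rewrite ler_nat ltnW.
have [P [sP hP]] := hG N.
have AN : 0 < A ^+ N by rewrite exprn_gt0.
have err z : cmod z <= m%:R ^+ 4 -> cmod (G z - P.[z]) <= g / 2 / A ^+ N.
  move=> zm; apply: le_trans (hP th m%:R z th1 mR zm) _.
  have -> : M * expR (th * (B * m%:R)) / th ^+ N =
      M * expR (th * (B * m%:R)) / expR 1 ^+ N / A ^+ N.
    have -> : th ^+ N = A ^+ N * expR 1 ^+ N by rewrite exprMn.
    by rewrite invfM [RHS]mulrAC -[RHS]mulrA.
  rewrite ler_pM2r ?invr_gt0//.
  rewrite ler_pdivrMr ?exprn_gt0 ?expR_gt0//.
  have hMc : M <= g / 2 * expR c%:R.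
    have := le_trans hc (le_trans _ (expR_ge1Dx (c%:R : R))).
    by rewrite ler_pdivrMr// => /(_ _); rewrite lerDr => /(_ ler01); lra.
  have hE : expR (th * (B * m%:R)) <= expR (b%:R * m%:R).
    by rewrite ler_expR mulrA ler_wpM2r.
  apply: le_trans (ler_pM M0 (expR_ge0 _) hMc hE) _.
  rewrite -expRM_natl mulr1 natrD natrM expRD -[leLHS]mulrA.
  by rewrite [expR c%:R * _]mulrC.
have [t /andP[t1 t2] ht] := poly_min_modulus P (lt_le_trans ltr01 (le_trans mR m4)) z0m.
exists t => // z zt; split; first by rewrite zt.
have zm : cmod z <= m%:R ^+ 4 by rewrite zt.
have Pz0 : g <= cmod P.[z0].
  have h1 := err _ z0m; have h2 : g / 2 / A ^+ N <= g / 2.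
    by rewrite ler_pdivrMr// ler_peMr ?exprn_ege1//; lra.
  by have := cmod_sub_ge (G z0) P.[z0]; move: h1 h2 g0; rewrite /g; lra.
have h3 : g <= A ^+ N * cmod P.[z].
  apply: le_trans Pz0 (le_trans (ht z zt) _); rewrite ler_wpM2r ?cmod_ge0//.
  rewrite ler_weXn2l//; apply: leq_trans sP; exact: leq_pred.
have h4 : g / 2 <= A ^+ N * cmod (G z).
  have := ler_wpM2l (ltW AN) (err z zm); rewrite mulrCA divff ?gt_eqF// mulr1.
  have := cmod_sub_ge P.[z] (G z); rewrite cmod_distC => /(ler_wpM2l (ltW AN)).
  by rewrite mulrBr; lra.
apply: le_trans h4 _; rewrite mulrC ler_wpM2l ?cmod_ge0//.
have AE : A <= expR a%:R by apply: le_trans ha _; have := expR_ge1Dx (a%:R : R); lra.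
apply: (@le_trans _ _ (expR a%:R ^+ N)); first by rewrite lerXn2r// nnegrE ?expR_ge0// ltW.
rewrite -expRM_natl -natrM ler_expR ler_nat mulnC -mulnA leq_mul2l; apply/orP; right.
rewrite mulnDl leq_add2l leq_pmulr// (leq_trans _ m1m)//.
Qed.

(** Divisibility stated locally: after removal of a common power of z - z0, the cofactor of [G] no
    longer vanishes at z0. *)
Definition zdvd G F : Prop := forall z0, exists k F1 G1, [/\ anl F1, anl G1, G1 z0 != 0,
  (forall z, F z = (z - z0) ^+ k * F1 z) & forall z, G z = (z - z0) ^+ k * G1 z].

(** At each point the quotient takes the value of the local quotient chosen there. Near z0 this
    agrees with the local quotient chosen at z0, since both multiply [G] to [F] and [G] is nonzero
    at nearby points other than z0. *)
Lemma zdvd_quotient F G : zdvd G F -> exists H, anl H /\ forall z, F z = H z * G z.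
Proof.
move=> GF; have [k hk] := choice GF; have [F1 hF1] := choice hk.
have [G1 h] := choice hF1.
pose H z := F1 z z / G1 z z; exists H; split => [z0|z]; last first.
  have [aF aG G0 FE GE] := h z; rewrite /H FE GE subrr.
  by rewrite mulrCA divfK.
have [aF aG G0 FE GE] := h z0.
have [eta eta0 heta] := lanl_neq0 (aG z0) G0.
apply: (lanl_eq eta0 (F := fun z => F1 z0 z * (G1 z0 z)^-1)); last first.
  by apply: lanlM; [exact: aF|apply: lanlV].
move=> z zz0; rewrite /H; have [->//|zn] := eqVneq z z0.
have G1z : G1 z0 z != 0.
  by rewrite -cmod_gt0; apply: lt_le_trans (heta z zz0); rewrite divr_gt0// cmod_gt0.
have z0n : (z - z0) ^+ k z0 != 0 by rewrite expf_neq0// subr_eq0.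
have Gz : G z != 0 by rewrite GE mulf_neq0.
have [_ _ G1zz FE' GE'] := h z.
have k0 : (z - z) ^+ k z != 0 by apply: contraNneq Gz => E; rewrite GE' E mul0r.
have E1 : (z - z0) ^+ k z0 * F1 z0 z = (z - z) ^+ k z * F1 z z by rewrite -FE -FE'.
have E2 : (z - z0) ^+ k z0 * G1 z0 z = (z - z) ^+ k z * G1 z z by rewrite -GE -GE'.
apply: (mulIf G1z); rewrite divfK// mulrAC; apply: (mulIf G1zz); rewrite divfK//.
apply: (mulfI (mulf_neq0 z0n k0)); rewrite mulrACA E1 -E2; ring.
Qed.

(* 4 (r/2 - x1)(r/2 - x2)(r/2 - x3) = - r^3 - Re z for the real parts x_i of the
   three cube roots of z, so that one of them is at least r/2. *)
Lemma cube_root_in_sector z : exists2 w : C, w ^+ 3 = z & cmod w <= 2 * complex.Re w.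
Proof.
have [w0 hw0] : exists w : C, w ^+ 3 = z.
  have [w] := @solve_monicpoly C 3 (fun i => if i is 0%N then z else 0) isT.
  rewrite !big_ord_recl big_ord0 /= expr0 mulr1 !mul0r !addr0 => <-; by exists w.
pose s : R := Num.sqrt 3; have s3 : s * s = 3 by rewrite -expr2 sqr_sqrtr.
pose om (e : R) : C := (- (1 / 2)) +i* (e * s / 2).
have om3 (e : R) : e * e = 1 -> om e ^+ 3 = 1.
  move=> e1; have : (e * s / 2) * (e * s / 2) = (e * e) * (s * s) / 4 by field.
  rewrite e1 s3 mul1r.
  rewrite /om; move: (e * s / 2) => t tt.
  apply: complex_ext; rewrite !exprS expr0 mulr1 !(ReM, ImM) /=.
    by transitivity (- (1 / 8) + 3 / 2 * (t * t)); [field|rewrite tt; field].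
  by transitivity (t * (3 / 4 - t * t)); [field|rewrite tt subrr mulr0].
case: w0 hw0 => x y hw; set w0 := x +i* y in hw *.
pose r := cmod w0; have r0 : 0 <= r := cmod_ge0 w0.
have r2 : r * r = x * x + y * y by rewrite -expr2 /r cmod_sqr /= !expr2.
have Rz : - (r * r * r) <= complex.Re z.
  have := cmod_Re z; rewrite -hw cmodX -/r ler_norml => /andP[+ _].
  by rewrite !exprS expr0 mulr1 mulrA.
have Rz' : complex.Re z = x * x * x - 3 * (x * (y * y)).
  by rewrite -hw !exprS expr0 mulr1 !(ReM, ImM) /=; ring.
have hom (e : R) : e * e = 1 -> (om e * w0) ^+ 3 = z.
  by move=> e1; rewrite exprMn om3// mul1r hw.
have cmo (e : R) : e * e = 1 -> cmod (om e * w0) = r.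
  by move=> e1; rewrite cmodM (cmod_unity (n := 3) _ (om3 _ e1))// mul1r.
apply: contrapT => nw.
have lt0 (w : C) : w ^+ 3 = z -> cmod w = r -> 2 * complex.Re w < r.
  by move=> w3 wr; rewrite ltNge; apply/negP => h; apply: nw; exists w => //; rewrite wr.
have h0 := lt0 w0 hw erefl.
have h1 := lt0 (om 1 * w0) (hom 1 (mulr1 1)) (cmo 1 (mulr1 1)).
have h2 := lt0 (om (-1) * w0) (hom (-1) _) (cmo (-1) _).
have m1 : (-1 : R) * -1 = 1 by ring.
have {}h2 := h2 m1 m1.
move: h0 h1 h2; rewrite !ReM /= => h0 h1 h2.
have p1 : 0 < r - 2 * x by lra.
have p2 : 0 < r + x + s * y by lra.
have p3 : 0 < r + x - s * y by lra.
have := mulr_gt0 (mulr_gt0 p1 p2) p3.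
have -> : (r - 2 * x) * (r + x + s * y) * (r + x - s * y) =
   (r - 2 * x) * (r * r + 2 * r * x + x * x - s * s * (y * y)) by ring.
rewrite s3; have -> : (r - 2 * x) * (r * r + 2 * r * x + x * x - 3 * (y * y)) =
  r * r * r - 3 * r * (x * x + y * y) - 2 * (x * x * x - 3 * (x * (y * y))) by ring.
rewrite -r2 -Rz'; lra.
Qed.

Lemma ccont_sector : ccont (fun w : C => cmod w - 2 * complex.Re w).
Proof.
move=> z e e0; exists (e / 3) => [|w hw]; first by rewrite divr_gt0.
have h1 := cmod_sub_ge z w; have h2 := cmod_sub_ge w z; rewrite cmod_distC in h1.
have := cmod_Re (w - z); rewrite ReB !ler_norml => /andP[h3 h4].
by apply/andP; split; lra.
Qed.

(* Phragmen-Lindelof: H (w^3) has order less than one in the sector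
   |w| <= 2 Re w, where (1 + eps w / n)^n plays the role of exp (eps w). *)
Lemma sector_bound H (K : nat) (M K0 : R) (m0 : nat) : (0 < K)%N -> 0 <= M ->
  anl H -> (forall m, (m0 <= m)%N -> forall z, cmod z <= m%:R ^+ 4 / 2 ->
     cmod (H z) <= M * expR (K * m)%:R) ->
  (forall x : R, 0 <= x -> cmod (H (- x)%:C) <= K0) ->
  forall z, cmod (H z) <= Num.max M K0 * expR 1.
Proof.
move=> Kp M0 hH hM hray z; have [zeta zeta3 zS] := cube_root_in_sector z.
pose u := cmod zeta; have u0 : 0 <= u := cmod_ge0 _.
have e0 : 0 < expR (1 : R) := expR_gt0 1.
(* With this value eps u < 1, so (1 + eps u / n)^n is at most e at the point of interest. *)
pose eps := (1 + u)^-1; have u1 : 0 < 1 + u by lra.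
have eps0 : 0 < eps by rewrite invr_gt0.
have [m1 hm1] := natr_above (4 * K%:R * expR 1 * (1 + u)).
have [m2 hm2] := natr_above (2 * u).
pose m := (maxn (maxn m0 m1) m2).+1.
have m0m : (m0 <= m)%N by rewrite ltnW// ltnS !leq_max leqnn.
have m1m : (m1 <= m)%N by rewrite ltnW// ltnS !leq_max leqnn orbT.
have m2m : (m2 <= m)%N by rewrite ltnW// ltnS !leq_max leqnn !orbT.
have mR : (1 : R) <= m%:R by rewrite ler1n.
(* For |w| = r the modulus of w^3 is at most (m^3)^4 / 2, so the growth bound at m^3 is M e^n. The
   compensating factor has modulus at least 1 + eps m^4 / (4n) = 1 + m / (4 K (1 + u)), which the
   choice of [m1] makes larger than e. *)
pose r : R := m%:R ^+ 4 / 2; pose n := (K * m ^ 3)%N.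
have nR : (0 : R) < n%:R by rewrite ltr0n muln_gt0 Kp expn_gt0.
have r0 : 0 < r by rewrite divr_gt0// exprn_gt0//; lra.
have m4 : m%:R <= m%:R ^+ 4 :> R by rewrite exprS ler_peMr ?exprn_ege1//; lra.
have ur : u <= r.
  have : (m2%:R : R) <= m%:R by rewrite ler_nat.
  by rewrite /r; lra.
pose b w : C := 1 + (eps / n%:R)%:C * w.
have en0 : 0 < eps / n%:R by rewrite divr_gt0.
have Reb w : complex.Re (b w) = 1 + eps / n%:R * complex.Re w.
  by rewrite /b ReD ReM /= mul0r subr0.
have b_ge w : cmod w <= 2 * complex.Re w -> 1 + eps / n%:R * (cmod w / 2) <= cmod (b w).
  move=> wS; apply: le_trans (le_trans (ler_norm _) (cmod_Re (b w))).
  by rewrite Reb lerD2l ler_pM2l//; lra.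
have b1 w : cmod w <= 2 * complex.Re w -> 1 <= cmod (b w).
  move/b_ge; apply: le_trans; rewrite lerDl; apply: mulr_ge0 (ltW en0) _.
  by rewrite divr_ge0// cmod_ge0.
pose f w := H (w ^+ 3) * (b w)^-1 ^+ n.
have fE w : cmod (f w) = cmod (H (w ^+ 3)) / cmod (b w) ^+ n.
  by rewrite cmodM cmodX cmodV exprVn.
have fbound : forall w, cmod w <= 2 * complex.Re w /\ cmod w <= r ->
    cmod (f w) <= Num.max M K0.
  apply: (@max_principle _ f _ (fun w => cmod w = 2 * complex.Re w \/ cmod w = r)).
  - rewrite (_ : [set p | _] = [set p | cmod (toC p) - 2 * complex.Re (toC p) <= 0 /\
        cmod (toC p) - r <= 0]); last first.
      by apply/seteqP; split=> p /=; rewrite !subr_le0.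
    apply: (@compact_sublevel R (fun w => cmod w - 2 * complex.Re w)
      (fun w => cmod w - r) r) => [|w e ee|w _]; first exact: ccont_sector.
      have [d d0 hd] := ccont_cmodB 0 w ee; exists d => // v /hd.
      by rewrite !subr0 opprB addrA subrK.
    by rewrite subr_le0.
  - move=> w [wS wr]; apply: lanlM.
      have := lanl_comp_poly (P := 'X^3) (hH ('X^3).[w]).
      by apply: lanl_eq ltr01 _ => v _; rewrite hornerXn.
    apply: lanlX; apply: lanlV; last first.
      by rewrite -cmod_gt0; apply: lt_le_trans (b1 w wS).
    have := lanl_poly (1 + (eps / n%:R)%:C *: 'X) w.
    by apply: lanl_eq ltr01 _ => v _; rewrite !hornerE.
  - move=> w [wS wr] nB.
    have w1 : cmod w < 2 * complex.Re w.
      by rewrite lt_neqAle wS andbT; apply/eqP => E; apply: nB; left.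
    have w2 : cmod w < r by rewrite lt_neqAle wr andbT; apply/eqP => E; apply: nB; right.
    exists (Num.min ((2 * complex.Re w - cmod w) / 3) (r - cmod w)) => [|v].
      by rewrite lt_min subr_gt0 w2 andbT divr_gt0// subr_gt0.
    rewrite le_min => /andP[v1 v2]; have v3 := cmodD (v - w) w; rewrite subrK in v3.
    have := cmod_Re (v - w); rewrite ReB ler_norml => /andP[v4 _].
    by split; lra.
  move=> w [wS wr]; rewrite fE => -[wE|wE].
    have -> : w ^+ 3 = (- (8 * complex.Re w ^+ 3))%:C.
      have := cmod_sqr w; rewrite wE; case: w {wS wr wE} => x y /= E.
      have E2 : y * y = 3 * (x * x) by move: E; rewrite !expr2; lra.
      apply: complex_ext; rewrite !exprS !expr0 !mulr1 !(ReM, ImM) /=.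
        by transitivity (x * (x * x) - 3 * (x * (y * y))); [ring|rewrite E2; ring].
      by transitivity (3 * (x * x) * y - y * (y * y)); [ring|rewrite E2; ring].
    have w0 : 0 <= complex.Re w by have := cmod_ge0 w; lra.
    rewrite le_max; apply/orP; right.
    have := hray (8 * complex.Re w ^+ 3) (mulr_ge0 (ler0n R 8) (exprn_ge0 3 w0)).
    apply: le_trans; rewrite ler_pdivrMr ?exprn_gt0 ?(lt_le_trans ltr01 (b1 w wS))//.
    by rewrite ler_peMr ?cmod_ge0// exprn_ege1// b1.
  rewrite le_max; apply/orP; left.
  rewrite ler_pdivrMr ?exprn_gt0 ?(lt_le_trans ltr01 (b1 w wS))//.
  have h1 : cmod (w ^+ 3) <= (m ^ 3)%:R ^+ 4 / 2.
    rewrite cmodX wE /r natrX -exprM expr_div_n -exprM ler_wpM2l ?exprn_ge0//.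
    by rewrite lef_pV2 ?posrE// -natrX ler_nat.
  apply: le_trans (hM _ _ _ h1) _.
    by rewrite (leq_trans m0m)// -[leqLHS]expn1 leq_pexp2l.
  rewrite ler_wpM2l// -/n -[n%:R]mulr1 expRM_natl lerXn2r ?nnegrE ?expR_ge0 ?cmod_ge0//.
  apply: le_trans (b_ge w wS); rewrite wE /r.
  have -> : eps / n%:R * (m%:R ^+ 4 / 2 / 2) = m%:R / (4 * K%:R * (1 + u)).
    rewrite /n /eps natrM natrX; field.
    by rewrite !gt_eqF ?ltr0n// ltr0n.
  have := le_trans hm1 (_ : m1%:R <= m%:R); rewrite ler_nat => /(_ m1m) hm.
  have : expR 1 <= m%:R / (4 * K%:R * (1 + u)).
    by rewrite ler_pdivlMr ?mulr_gt0 ?ltr0n// mulrC; move: hm; rewrite mulrAC.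
  lra.
have := fbound zeta (conj zS ur); rewrite fE zeta3.
have bp : 0 < cmod (b zeta) by apply: lt_le_trans (b1 _ zS).
rewrite ler_pdivrMr ?exprn_gt0// => /le_trans; apply.
rewrite ler_wpM2l//; first by rewrite le_max M0.
have -> : expR (1 : R) = expR n%:R^-1 ^+ n by rewrite -expRM_natl mulfV// gt_eqF.
rewrite lerXn2r ?nnegrE ?expR_ge0 ?cmod_ge0//.
apply: le_trans (expR_ge1Dx _); apply: le_trans (cmodD _ _) _.
rewrite cmod1 lerD2l cmodM cmod_real gtr0_norm// -/u /eps.
by rewrite mulrAC mulrC ler_piMr ?invr_ge0 ?ler0n// ler_pdivrMl//; lra.
Qed.

(** The divided difference at 0 is at most 2K / r on the circle of radius r, hence inside it by the
    maximum principle. *)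
Lemma liouville H (K : R) : anl H -> (forall z, cmod (H z) <= K) -> forall z, H z = H 0.
Proof.
move=> hH hK z; have [G [hG HG]] := anl_taylor1 0 hH.
suff G0 : G z = 0 by rewrite HG G0 mulr0 addr0.
have K0 : 0 <= K by apply: le_trans (hK 0); exact: cmod_ge0.
apply/eqP; rewrite -cmod_eq0 eq_le cmod_ge0 andbT.
apply: (@le0_halving _ _ (2 * K)) => n.
pose r := 2 ^+ n + cmod z; have p0 : 0 < (2 : R) ^+ n by rewrite exprn_gt0.
have r0 : 0 < r by rewrite /r; have := cmod_ge0 z; lra.
apply: (@le_trans _ _ (2 * K / r)); last first.
  rewrite ler_wpM2l ?mulr_ge0// lef_pV2 ?posrE// /r lerDl; exact: cmod_ge0.
apply: (@max_disc _ G 0 r) => [w _|w|]; [exact: hG| |rewrite subr0 /r; lra].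
rewrite subr0 => wr; rewrite ler_pdivlMr// -wr -cmodM mulrC -[w in w * _]subr0.
rewrite (_ : (w - 0) * G w = H w - H 0); last by rewrite [in RHS]HG addrAC subrr add0r.
by have := cmodB (H w) (H 0); have := hK w; have := hK 0; lra.
Qed.

(** The lower bound on circles transfers the growth of F to F / G by the maximum principle. The
    quotient is bounded on the ray, hence bounded everywhere, hence constant, and its limit along
    the ray is 0. *)
Lemma entire_ratio_vanishing F G (M B : R) : anl F -> 0 <= M ->
  (forall rho z, 1 <= rho -> cmod z <= rho ^+ 4 -> cmod (F z) <= M * expR (B * rho)) ->
  ord4 G -> zdvd G F ->
  (forall eps : R, 0 < eps -> exists X : R, forall x, X <= x ->
     G (- x)%:C != 0 /\ cmod (F (- x)%:C) <= eps * cmod (G (- x)%:C)) ->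
  forall z, F z = 0.
Proof.
move=> aF M0 gF oG GF ray; have [H [aH FH]] := zdvd_quotient GF.
have Hray (eps : R) : 0 < eps -> exists X : R, forall x, X <= x -> cmod (H (- x)%:C) <= eps.
  move=> /ray[X hX]; exists X => x /hX[Gx]; rewrite FH cmodM ler_pM2r//.
  by rewrite cmod_gt0.
have [z0 Gz0] : exists z0, G z0 != 0.
  by have [X hX] := ray 1 ltr01; have [G0 _] := hX X (lexx _); exists (- X)%:C.
have [kap kap0 [c [m0 hG]]] := ord4_min_modulus oG Gz0.
have [b hb] := natr_above B.
have hH m : (m0.+1 <= m)%N -> forall z, cmod z <= m%:R ^+ 4 / 2 ->
    cmod (H z) <= M / kap * expR ((b + c).+1 * m)%:R.
  move=> m0m z zm; have [t mt ht] := hG m (ltnW m0m).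
  apply: (@max_disc _ H 0 t) => [w _|w|]; [exact: aH| |rewrite subr0; exact: le_trans zm mt].
  rewrite subr0 => wt; have [wm hw] := ht w wt.
  have mR : (1 : R) <= m%:R by rewrite ler1n (leq_trans _ m0m).
  have := gF m%:R w mR wm; rewrite FH cmodM => hF.
  rewrite mulrAC ler_pdivlMr//; apply: le_trans (ler_wpM2l (cmod_ge0 _) hw) _.
  rewrite mulrA; apply: le_trans (ler_wpM2r (expR_ge0 _) hF) _.
  rewrite -mulrA ler_wpM2l// -expRD ler_expR.
  have h1 : B * m%:R <= (b * m)%:R by rewrite natrM ler_wpM2r.
  have : ((b * m)%:R + (c * m)%:R : R) <= ((b + c).+1 * m)%:R.
    by rewrite -natrD ler_nat -mulnDl leq_mul2r leqnSn orbT.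
  lra.
have [K1 hK1] : exists K1 : R, forall x, 0 <= x -> cmod (H (- x)%:C) <= K1.
  have [X hX] := Hray 1 ltr01; have [N N0 hN] := anl_bounded_disc X aH.
  exists (Num.max N 1) => x x0; have [xX|xX] := leP X x.
    by rewrite le_max hX ?orbT.
  by rewrite le_max hN// cmod_real normrN ger0_norm// ltW.
have Mk : 0 <= M / kap by rewrite divr_ge0// ltW.
have bd := sector_bound (ltn0Sn _) Mk aH hH hK1.
have H0 := liouville aH bd.
have Hz z : H z = 0.
  apply/eqP; rewrite -cmod_eq0 eq_le cmod_ge0 andbT.
  apply: (@le0_halving _ _ 1) => n; rewrite div1r.
  have p0 : 0 < ((2 : R) ^+ n)^-1 by rewrite invr_gt0 exprn_gt0.
  by have [X hX] := Hray _ p0; have := hX X (lexx _); rewrite H0 -(H0 z).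
by move=> z; rewrite FH Hz mul0r.
Qed.

End Quotients.

(** * Characteristic functions and weight numbers *)

Section Brackets.
Context {R : realType}.
Notation C := R[i].
Implicit Types (L : problem R) (lam mu z : C) (Y Z : nat -> R -> C).

Lemma sys4_formU_exists L lam (u : nat -> C) :
  exists Y, sys4 L lam Y /\ forall s, (1 <= s <= 4)%N -> formU L s Y = u s.
Proof.
have [Y [hY Y0]] := sys4_exists L lam (fun i => match i with
  | 0 => u 3%N | 1 => u 4%N | 2 => u 1%N - coef_a L * u 4%N + coef_b L * u 3%N
  | _ => u 2%N - coef_b L * u 4%N - coef_c L * u 3%N end).
exists Y; split => // -[|[|[|[|[|s]]]]] // _; rewrite /formU !Y0//; ring.
Qed.

Lemma formU_unique L lam Y Z : sys4 L lam Y -> sys4 L lam Z ->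
  (forall s, (1 <= s <= 4)%N -> formU L s Y = formU L s Z) ->
  forall i t, (i < 4)%N -> 0 <= t <= 1 -> Y i t = Z i t.
Proof.
move=> hY hZ h; apply: (sys4_unique hY hZ).
have h3 := h 3%N isT; have h4 := h 4%N isT; rewrite /= in h3 h4.
have h1 := h 1%N isT; have h2 := h 2%N isT; rewrite /= h3 h4 in h1 h2.
move=> [|[|[|[|]]]] // _.
  by move: h1 => /addIr/addIr.
by move: h2 => /addIr/addIr.
Qed.

Lemma solC_spec L k lam : sys4 L lam (solC L k lam) /\
  forall s, (1 <= s <= 4)%N -> formU L s (solC L k lam) = (s == k)%:R.
Proof.
have [Y [hY U]] := sys4_formU_exists L lam (fun s => (s == k)%:R).
have [] := @xgetPex _ (fun _ _ => 0 : C) [set Y | is_solution L lam Y /\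
  forall s, (1 <= s <= 4)%N -> formU L s Y = (s == k)%:R].
  by exists Y; split => //; exact/is_solutionP.
by rewrite -/(solC L k lam) => /is_solutionP.
Qed.

Lemma sys4_sum L lam n (v : 'I_n -> C) (Y : nat -> nat -> R -> C) :
  (forall k, sys4 L lam (Y k)) -> sys4 L lam (fun i x => \sum_(k < n) v k * Y k i x).
Proof.
move=> hY; elim: n v => [|n IH] v.
  have := sys4_lin 0 0 (hY 0%N) (hY 0%N); congr (sys4 _ _ _).
  by apply/funext => i; apply/funext => x; rewrite big_ord0 !mul0r addr0.
have := sys4_lin 1 (v ord_max) (IH (fun k => v (widen_ord (leqnSn n) k))) (hY n).
congr (sys4 _ _ _); apply/funext => i; apply/funext => x.
by rewrite big_ord_recr /= mul1r.
Qed.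

Lemma formU_lin L s (al be : C) Y Z :
  formU L s (fun i x => al * Y i x + be * Z i x) = al * formU L s Y + be * formU L s Z.
Proof. by case: s => [|[|[|[|[|s]]]]] //=; ring. Qed.

Lemma formU_sum L n (v : 'I_n -> C) (Y : nat -> nat -> R -> C) s :
  formU L s (fun i x => \sum_(k < n) v k * Y k i x) = \sum_(k < n) v k * formU L s (Y k).
Proof.
elim: n v => [|n IH] v.
  rewrite big_ord0; case: s => [|[|[|[|[|s]]]]] //=; rewrite !big_ord0//; ring.
rewrite big_ord_recr /= -IH -[X in X + _]mul1r -formU_lin; congr formU.
by apply/funext => i; apply/funext => x; rewrite big_ord_recr /= mul1r.
Qed.

(** For equal spectral parameters the bracket has the same value at both ends. At 0 the
    contributions of a, b, c cancel, that of b because it enters [U_1] and [U_2] with opposite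
    signs; in the forms U the bracket is again a standard symplectic form. *)
Lemma bracket_same L lam Y Z : sys4 L lam Y -> sys4 L lam Z ->
  formV 4 Y * formV 1 Z - formV 1 Y * formV 4 Z -
  formV 3 Y * formV 2 Z + formV 2 Y * formV 3 Z =
  formU L 2 Y * formU L 3 Z - formU L 1 Y * formU L 4 Z +
  formU L 4 Y * formU L 1 Z - formU L 3 Y * formU L 2 Z.
Proof.
move=> hY hZ; have := lagrange_identity hY hZ; rewrite subrr mul0r addr0.
rewrite /bracket /formV /= => ->; rewrite /formU; ring.
Qed.

Lemma formU_solC L lam k s : (s < 4)%N -> formU L s.+1 (solC L k.+1 lam) = (s == k)%:R.
Proof. by move=> s4; have [_ ->] := solC_spec L k.+1 lam. Qed.

(** Pairing with C_k isolates one form of [Z]: the index 1 is dual to 4, and 2 is dual to 3. *)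
Lemma formU_bracket L lam Z : sys4 L lam Z ->
  let br k := formV 4 (solC L k lam) * formV 1 Z - formV 1 (solC L k lam) * formV 4 Z -
    formV 3 (solC L k lam) * formV 2 Z + formV 2 (solC L k lam) * formV 3 Z in
  [/\ formU L 1 Z = br 4%N, formU L 2 Z = - br 3%N, formU L 3 Z = br 2%N &
      formU L 4 Z = - br 1%N].
Proof.
move=> hZ br.
have B k : br k.+1 = (1%N == k)%:R * formU L 3 Z - (0%N == k)%:R * formU L 4 Z +
    (3 == k)%:R * formU L 1 Z - (2 == k)%:R * formU L 2 Z.
  have [hk _] := solC_spec L k.+1 lam.
  by rewrite /br (bracket_same hk hZ) !formU_solC.
rewrite !B; move: (formU L 1 Z) (formU L 2 Z) (formU L 3 Z) (formU L 4 Z) => u1 u2 u3 u4.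
by split; rewrite /=; ring.
Qed.

(* A combination of the C_k all of whose forms V_s vanish is orthogonal for the
   bracket to every C_k, hence zero. *)
Lemma sys4_formV_exists L lam (u : 'I_4 -> C) :
  exists Y, sys4 L lam Y /\ forall s : 'I_4, formV s.+1 Y = u s.
Proof.
pose A : 'M[C]_4 := \matrix_(k, s) formV s.+1 (solC L k.+1 lam).
pose comb (v : 'rV[C]_4) i x : C := \sum_(k < 4) v 0 k * solC L k.+1 lam i x.
have hc v : sys4 L lam (comb v).
  by apply: (@sys4_sum _ _ _ _ (fun k => solC L k.+1 lam)) => k; have [] := solC_spec L k.+1 lam.
have V v (s : 'I_4) : formV s.+1 (comb v) = (v *m A) 0 s.
  by rewrite mxE; apply: eq_bigr => k _; rewrite mxE.
have U v (s : 'I_4) : formU L s.+1 (comb v) = v 0 s.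
  rewrite (@formU_sum L _ _ (fun k => solC L k.+1 lam)) (bigD1 s)// big1 => [|k ks].
    by rewrite formU_solC// eqxx mulr1 /= addr0.
  by rewrite formU_solC// eq_sym (inj_eq val_inj) (negbTE ks) mulr0.
have uA : A \in unitmx.
  rewrite -row_free_unit; apply: inj_row_free => v vA.
  have V0 s : (s < 4)%N -> formV s.+1 (comb v) = 0.
    by move=> s4; rewrite (V v (Ordinal s4)) vA mxE.
  apply/rowP => s; rewrite mxE -U.
  have [h1 h2 h3 h4] := formU_bracket (hc v).
  rewrite !V0// !mulr0 !subrr !addr0 ?oppr0 in h1 h2 h3 h4.
  by case: s => -[|[|[|[|]]]].
exists (comb ((\row_s u s) *m invmx A)); split => // s.
by rewrite V mulmxKV// mxE.
Qed.

Lemma solS_spec L k lam : sys4 L lam (solS L k lam) /\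
  forall s, (1 <= s <= 4)%N -> formV s (solS L k lam) = (s == k)%:R.
Proof.
have [Y [hY V]] := sys4_formV_exists L lam (fun s => (s.+1 == k)%:R).
have [] := @xgetPex _ (fun _ _ => 0 : C) [set Y | is_solution L lam Y /\
  forall s, (1 <= s <= 4)%N -> formV s Y = (s == k)%:R].
  exists Y; split => [|s /andP[]]; first exact/is_solutionP.
  by case: s => // s _ s4; have := V (Ordinal (s4 : (s < 4)%N)).
by rewrite -/(solS L k lam) => /is_solutionP.
Qed.

Lemma formV_solS L lam k s : (s < 4)%N -> formV s.+1 (solS L k.+1 lam) = (s == k)%:R.
Proof. by move=> s4; have [_ ->] := solS_spec L k.+1 lam. Qed.

Lemma det_mx2 (A : 'M[C]_2) : \det A = A 0 0 * A 1 1 - A 0 1 * A 1 0.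
Proof.
rewrite (expand_det_row _ 0) !big_ord_recl big_ord0 addr0.
rewrite /cofactor !det_mx11 !mxE /= expr0 expr1 mul1r mulN1r mulrN.
by congr (_ * A _ _ - A _ _ * A _ _); apply: val_inj.
Qed.

Lemma Delta22E L lam : Delta L 2 2 lam =
  formV 2 (solC L 3 lam) * formV 1 (solC L 4 lam) -
  formV 2 (solC L 4 lam) * formV 1 (solC L 3 lam).
Proof. by rewrite /Delta det_mx2 !mxE. Qed.

Lemma Delta32E L lam : Delta L 3 2 lam =
  formV 2 (solC L 2 lam) * formV 1 (solC L 4 lam) -
  formV 2 (solC L 4 lam) * formV 1 (solC L 2 lam).
Proof. by rewrite /Delta det_mx2 !mxE. Qed.

Lemma Delta42E L lam : Delta L 4 2 lam =
  formV 2 (solC L 3 lam) * formV 1 (solC L 2 lam) -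
  formV 2 (solC L 2 lam) * formV 1 (solC L 3 lam).
Proof. by rewrite /Delta det_mx2 !mxE. Qed.

Lemma Delta33E L lam : Delta L 3 3 lam = formV 1 (solC L 4 lam).
Proof. by rewrite /Delta det_mx11 !mxE. Qed.

(** By duality the values U_s(S_k) are, up to sign, values V_1 or V_2 of the C_k, and the two
    determinants coincide up to sign. *)
Lemma spectrum_charE L lam :
  [/\ spectrum_char L 1 2 lam = - Delta L 2 2 lam,
      spectrum_char L 1 3 lam = Delta L 3 2 lam &
      spectrum_char L 2 3 lam = Delta L 4 2 lam].
Proof.
have [hS3 _] := solS_spec L 3 lam; have [hS4 _] := solS_spec L 4 lam.
have [a1 a2 a3 a4] := formU_bracket hS3; have [b1 b2 b3 b4] := formU_bracket hS4.
rewrite /spectrum_char a1 a2 a3 b1 b2 b3 !formV_solS// Delta22E Delta32E Delta42E.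
by split; rewrite /=; ring.
Qed.

End Brackets.

(** * Normalized eigenfunctions and their weight numbers *)

Section WeightNumbers.
Context {R : realType}.
Notation C := R[i].
Implicit Types (L : problem R) (lam mu z : C) (Y Z : nat -> R -> C) (f g : C -> C).

Lemma Delta_minors L lam :
  [/\ Delta L 2 2 lam = minors (solC L 4 lam) (solC L 3 lam) 0 1,
      Delta L 3 2 lam = minors (solC L 4 lam) (solC L 2 lam) 0 1 &
      Delta L 4 2 lam = minors (solC L 2 lam) (solC L 3 lam) 0 1].
Proof.
by rewrite Delta22E Delta32E Delta42E /minors /formV /=; split; ring.
Qed.

Lemma solC_init L k lam :
  [/\ solC L k lam 0%N 0 = (3%N == k)%:R, solC L k lam 1%N 0 = (4 == k)%:R,
   solC L k lam 2 0 = (1%N == k)%:R - coef_a L * (4 == k)%:R + coef_b L * (3 == k)%:R &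
   solC L k lam 3 0 = (2 == k)%:R - coef_b L * (4 == k)%:R - coef_c L * (3 == k)%:R].
Proof.
have [_ U] := solC_spec L k lam.
have U1 := U 1%N isT; have U2 := U 2%N isT; have U3 := U 3%N isT; have U4 := U 4%N isT.
by split; rewrite -?U1 -?U2 -?U3 -?U4 /formU; ring.
Qed.

(** The forms U do not involve the spectral parameter, so the initial values of the C_k are
    independent of it. *)
Lemma minors_solC_init L j k lam lam' i :
  minors (solC L j lam) (solC L k lam) i 0 = minors (solC L j lam') (solC L k lam') i 0.
Proof.
have [a0 a1 a2 a3] := solC_init L j lam; have [b0 b1 b2 b3] := solC_init L k lam.
have [c0 c1 c2 c3] := solC_init L j lam'; have [d0 d1 d2 d3] := solC_init L k lam'.
by rewrite /minors a0 a1 a2 a3 b0 b1 b2 b3 c0 c1 c2 c3 d0 d1 d2 d3.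
Qed.

Lemma minors_solC_ord4 L j k : ord4 (fun lam => minors (solC L j lam) (solC L k lam) 0 1).
Proof.
apply: (@minors_ord4 _ L _ _ (fun i => minors (solC L j 0) (solC L k 0) i 0)) => lam.
split; [exact: (proj1 (solC_spec L j lam))|exact: (proj1 (solC_spec L k lam))|].
by move=> i _; exact: minors_solC_init.
Qed.

Lemma Delta_ord4 L : [/\ ord4 (Delta L 2 2), ord4 (Delta L 3 2) & ord4 (Delta L 4 2)].
Proof.
split; [have := minors_solC_ord4 L 4 3|have := minors_solC_ord4 L 4 2|
        have := minors_solC_ord4 L 2 3]; congr ord4; apply/funext => lam;
  by have [h1 h2 h3] := Delta_minors L lam; rewrite ?h1 ?h2 ?h3.
Qed.

(** A pointwise Lipschitz condition. It is all that is needed to identify a value at an eigenvalue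
    by continuity, and it is easier to verify for integrals of solutions than analyticity. *)
Definition lip f z0 : Prop := exists2 B : R, 0 <= B &
  forall z, cmod (z - z0) <= 1 -> cmod (f z - f z0) <= cmod (z - z0) * B.

Lemma lipB f g z0 : lip f z0 -> lip g z0 -> lip (fun z => f z - g z) z0.
Proof.
move=> [A A0 hA] [B B0 hB]; exists (A + B) => [|z zz]; first exact: addr_ge0.
rewrite (_ : _ - _ = (f z - f z0) - (g z - g z0)); last by ring.
by apply: le_trans (cmodB _ _) _; rewrite mulrDr lerD ?hA ?hB.
Qed.

Lemma lipM f g z0 : lip f z0 -> lip g z0 -> lip (fun z => f z * g z) z0.
Proof.
move=> [A A0 hA] [B B0 hB].
exists (A * B + (A * cmod (g z0) + cmod (f z0) * B)) => [|z zz].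
  by rewrite !addr_ge0 ?mulr_ge0 ?cmod_ge0.
have hf := hA z zz; have hg := hB z zz.
rewrite (_ : _ - _ = (f z - f z0) * (g z - g z0) +
  ((f z - f z0) * g z0 + f z0 * (g z - g z0))); last by ring.
apply: le_trans (cmodD _ _) _; rewrite [leRHS]mulrDr lerD//.
  rewrite cmodM; apply: le_trans (ler_pM (cmod_ge0 _) (cmod_ge0 _) hf hg) _.
  rewrite mulrACA ler_wpM2r ?mulr_ge0//.
  by rewrite -[leRHS]mulr1 ler_wpM2l ?cmod_ge0.
apply: le_trans (cmodD _ _) _; rewrite !cmodM [leRHS]mulrDr lerD//.
  by rewrite mulrA ler_wpM2r ?cmod_ge0.
by rewrite mulrCA ler_wpM2l ?cmod_ge0.
Qed.

Lemma solC_lip L k lam0 : exists2 B : R, 0 <= B &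
  forall lam, cmod (lam - lam0) <= 1 -> forall i t, (i < 4)%N -> 0 <= t <= 1 ->
  cmod (solC L k lam i t - solC L k lam0 i t) <= cmod (lam - lam0) * B.
Proof.
have [B B0 hB] := sys4_lipschitz L (fun i => solC L k lam0 i 0) lam0.
exists B => // lam hl; apply: hB hl _ _ _.
- exact: (proj1 (solC_spec L k lam)).
- exact: (proj1 (solC_spec L k lam0)).
have [a0 a1 a2 a3] := solC_init L k lam; have [b0 b1 b2 b3] := solC_init L k lam0.
by move=> [|[|[|[|]]]] // _; rewrite ?a0 ?a1 ?a2 ?a3 ?b0 ?b1 ?b2 ?b3.
Qed.

Lemma lip_formV L k s lam0 : (1 <= s <= 4)%N -> lip (fun lam => formV s (solC L k lam)) lam0.
Proof.
move=> /andP[s1 s4]; have [B B0 hB] := solC_lip L k lam0; exists B => // lam hl.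
by apply: hB => //; [case: s s1 s4|rewrite ler01 lexx].
Qed.

Lemma lip_integral L k lam0 (f : R -> C) : cbm f ->
  lip (fun lam => cI 0 1 (fun x => f x * solC L k lam 0%N x)) lam0.
Proof.
move=> hf; have [M M0 hM] := cbm_bounded hf; have [B B0 hB] := solC_lip L k lam0.
have sb lam : cbm (solC L k lam 0%N) by have [[y0 _ _ _] _] := solC_spec L k lam; exact: W11_bm y0.
have t01 : (0 : R) <= 0 by []; have t11 : (1 : R) <= 1 by [].
exists (M * B) => [|lam hl]; first exact: mulr_ge0.
have c1 := cbm_L1 (cbmM hf (sb lam)); have c0 := cbm_L1 (cbmM hf (sb lam0)).
rewrite -cIB//.
have := @cI_le _ (fun x => f x * solC L k lam 0%N x - f x * solC L k lam0 0%N x)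
  (fun=> cmod (lam - lam0) * (M * B)) 0 1 (cL1B c1 c0) (rbm_L1 (rbm_cst _)) t01 t11.
rewrite rIcst ?ler01// subr0 mulr1; apply => s s01.
rewrite -mulrBr cmodM mulrCA; apply: ler_pM; rewrite ?cmod_ge0 ?hM//.
exact: hB.
Qed.

Lemma anl_lip_eq D W z0 : anl D -> lip W z0 -> (forall z, z != z0 -> D z = W z) ->
  D z0 = W z0.
Proof.
move=> aD [B B0 hB] DW; apply/eqP; rewrite -subr_eq0; apply/negPn/negP => n0.
rewrite -cmod_gt0 in n0; set c := cmod _ in n0.
have c4 : 0 < c / 4 by rewrite divr_gt0.
have [d d0 hd] := lanl_continuous (aD z0) c4.
pose eta := Num.min d (Num.min 1 (c / 4 / (B + 1))).
have B1 : 0 < B + 1 by lra.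
have eta0 : 0 < eta by rewrite !lt_min d0 ltr01 divr_gt0.
have e1 : eta <= d by rewrite ge_min lexx.
have e2 : eta <= 1 by rewrite !ge_min lexx orbT.
have e3 : eta * B <= c / 4.
  have : eta <= c / 4 / (B + 1) by rewrite !ge_min lexx !orbT.
  by rewrite ler_pdivlMr// mulrDr mulr1; move: eta0; lra.
have ze : cmod (z0 + eta%:C - z0) = eta.
  by rewrite addrAC subrr add0r cmod_real gtr0_norm.
have zn : z0 + eta%:C != z0 by rewrite -subr_eq0 -cmod_eq0 ze gt_eqF.
have := hd (z0 + eta%:C); rewrite ze => /(_ e1) h1.
have := hB (z0 + eta%:C); rewrite ze => /(_ e2) h2; rewrite -DW// in h2.
have := cmodB (D (z0 + eta%:C) - W z0) (D (z0 + eta%:C) - D z0).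
rewrite (_ : _ - _ = D z0 - W z0); last by ring.
by rewrite -/c; lra.
Qed.

Lemma eigenfunction_comb L mu Z : sys4 L mu Z -> formU L 1 Z = 0 -> formU L 2 Z = 0 ->
  forall i t, (i < 4)%N -> 0 <= t <= 1 ->
  Z i t = Z 0%N 0 * solC L 3 mu i t + Z 1%N 0 * solC L 4 mu i t.
Proof.
move=> hZ z1 z2; have [h3 u3] := solC_spec L 3 mu; have [h4 u4] := solC_spec L 4 mu.
apply: (formU_unique hZ (sys4_lin _ _ h3 h4)) => s s14.
rewrite formU_lin u3// u4//; case: s s14 => [|[|[|[|[|]]]]] // _;
by rewrite ?z1 ?z2 ?mulr0 ?mulr1 ?addr0 ?add0r.
Qed.

(** The separation condition enters here, with k = 2: the eigenvalue is not a zero of Delta_33,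
    which is V_1(C_4). *)
Lemma separation_formV L mu : separation L -> Delta L 2 2 mu = 0 ->
  formV 1 (solC L 4 mu) != 0.
Proof.
move=> sep D0; apply/eqP => V0; apply: (sep 2%N isT mu); split => //.
by rewrite Delta33E.
Qed.

Lemma cintegral01 (f : R -> C) : cintegral `[0, 1] f = cI 0 1 f.
Proof. by rewrite cI.unlock. Qed.

(** If Y(0) vanished, Y would be the multiple Y'(0) C_4; since V_1(Y) = 0 and V_1(C_4) is nonzero, Y
    would vanish identically. *)
Lemma eigenfunction_neq0 L mu Y : separation L -> Delta L 2 2 mu = 0 ->
  sys4 L mu Y -> formU L 1 Y = 0 -> formU L 2 Y = 0 -> formV 1 Y = 0 ->
  cI 0 1 (fun x => Y 0%N x ^+ 2) != 0 -> Y 0%N 0 != 0.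
Proof.
move=> sep D0 hY U1 U2 V1; apply: contraNneq => g0.
have YE := eigenfunction_comb hY U1 U2; have V14 := separation_formV sep D0.
have : Y 0%N 0 * formV 1 (solC L 3 mu) + Y 1%N 0 * formV 1 (solC L 4 mu) = 0.
  by rewrite -V1 /formV /= [in RHS]YE// ler01 lexx.
move/eqP; rewrite g0 mul0r add0r mulf_eq0 (negbTE V14) orbF => /eqP x0.
rewrite -(@cI0 R 0 1); apply/eqP; apply: eq_cI => s s01.
by rewrite YE// g0 x0 !mul0r addr0 expr0n.
Qed.

(* The solution z = Delta_32 C_3 + Delta_42 C_4 - Delta_22 C_2 satisfies all boundary
   conditions except U_2(z) = - Delta_22, so that its Lagrange identity with an
   eigenfunction Y at mu reads Y(0) Delta_22 (lam) = (lam - mu) int Y z. *)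
Lemma eigenfunction_identity L mu Y : separation L -> Delta L 2 2 mu = 0 ->
  sys4 L mu Y -> formU L 1 Y = 0 -> formU L 2 Y = 0 -> formV 1 Y = 0 -> formV 2 Y = 0 ->
  Y 0%N 0 != 0 -> exists kap, [/\ Delta L 3 2 mu = kap * Y 0%N 0,
    Delta L 4 2 mu = kap * Y 1%N 0 &
    cderive (Delta L 2 2) mu * Y 0%N 0 = kap * cI 0 1 (fun x => Y 0%N x ^+ 2)].
Proof.
move=> sep D0 hY U1 U2 V1 V2; have V14 := separation_formV sep D0.
set g := Y 0%N 0; set x := Y 1%N 0.
have t11 : 0 <= (1 : R) <= 1 by rewrite ler01 lexx.
move=> g0; have YE := eigenfunction_comb hY U1 U2; rewrite -/g -/x in YE.
have V1E : g * formV 1 (solC L 3 mu) + x * formV 1 (solC L 4 mu) = 0.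
  by rewrite -V1 /formV /= [in RHS]YE.
pose zsol lam i t : C := Delta L 3 2 lam * solC L 3 lam i t +
  1 * (Delta L 4 2 lam * solC L 4 lam i t + - Delta L 2 2 lam * solC L 2 lam i t).
have zs lam : sys4 L lam (zsol lam).
  have h k := proj1 (solC_spec L k lam).
  exact: sys4_lin (h _) (sys4_lin _ _ (h _) (h _)).
have zU lam s : (1 <= s <= 4)%N -> formU L s (zsol lam) =
    Delta L 3 2 lam * (s == 3)%:R + (Delta L 4 2 lam * (s == 4)%:R - Delta L 2 2 lam * (s == 2)%:R).
  move=> s14; have h k := proj2 (solC_spec L k lam) s s14.
  have -> : formU L s (zsol lam) = Delta L 3 2 lam * formU L s (solC L 3 lam) +
    1 * formU L s (fun i t => Delta L 4 2 lam * solC L 4 lam i t + - Delta L 2 2 lam * solC L 2 lam i t).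
    exact: (@formU_lin _ L s _ _ (solC L 3 lam)).
  by rewrite formU_lin !h mul1r mulNr.
have zV1 lam : formV 1 (zsol lam) = 0.
  by rewrite /formV /zsol /= Delta22E Delta32E Delta42E /formV /=; ring.
have zV2 lam : formV 2 (zsol lam) = 0.
  by rewrite /formV /zsol /= Delta22E Delta32E Delta42E /formV /=; ring.
pose W lam := cI 0 1 (fun t => Y 0%N t * zsol lam 0%N t).
have GW lam : g * Delta L 2 2 lam = (lam - mu) * W lam.
  have := lagrange_identity hY (zs lam).
  have -> : bracket Y (zsol lam) 1 = 0.
    rewrite /bracket; move: (zV1 lam) (zV2 lam) V1 V2; rewrite /formV /= => -> -> -> ->.
    by rewrite !mulr0 !mul0r !subr0 addr0.
  have -> : bracket Y (zsol lam) 0 = - formU L 3 Y * formU L 2 (zsol lam).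
    transitivity (formU L 2 Y * formU L 3 (zsol lam) - formU L 1 Y * formU L 4 (zsol lam) +
      formU L 4 Y * formU L 1 (zsol lam) - formU L 3 Y * formU L 2 (zsol lam)).
      by rewrite /bracket /formU; ring.
    have z1 : formU L 1 (zsol lam) = 0 by rewrite zU// !mulr0 subrr addr0.
    by rewrite U1 U2 z1; ring.
  have z2 : formU L 2 (zsol lam) = - Delta L 2 2 lam by rewrite zU// !mulr0 mulr1 !add0r.
  rewrite z2 -/(W lam) => E; apply/eqP; rewrite -subr_eq0; apply/eqP.
  by rewrite E /formU -/g; ring.
have lipW : lip W mu.
  have Yb : cbm (Y 0%N) by case: hY => y0 _ _ _; exact: W11_bm y0.
  have sb k lam : cbm (solC L k lam 0%N) by have [[y0 _ _ _] _] := solC_spec L k lam; exact: W11_bm y0.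
  have WE lam : W lam = Delta L 3 2 lam * cI 0 1 (fun t => Y 0%N t * solC L 3 lam 0%N t) -
     (Delta L 2 2 lam * cI 0 1 (fun t => Y 0%N t * solC L 2 lam 0%N t) -
      Delta L 4 2 lam * cI 0 1 (fun t => Y 0%N t * solC L 4 lam 0%N t)).
    have h k := cbm_L1 (cbmM Yb (sb k lam)).
    rewrite -!cIZ ?lexx// -!cIB ?lexx//; try exact: cL1Z; last by apply: cL1B; exact: cL1Z.
    by apply: eq_cI => s _; rewrite /zsol; ring.
  have lV := fun k s (h : (1 <= s <= 4)%N) => @lip_formV L k s mu h.
  have [l2 [l3 l4]] : lip (Delta L 2 2) mu /\ lip (Delta L 3 2) mu /\ lip (Delta L 4 2) mu.
    have -> : Delta L 2 2 = fun lam => formV 2 (solC L 3 lam) * formV 1 (solC L 4 lam) -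
      formV 2 (solC L 4 lam) * formV 1 (solC L 3 lam) by apply/funext => lam; rewrite Delta22E.
    have -> : Delta L 3 2 = fun lam => formV 2 (solC L 2 lam) * formV 1 (solC L 4 lam) -
      formV 2 (solC L 4 lam) * formV 1 (solC L 2 lam) by apply/funext => lam; rewrite Delta32E.
    have -> : Delta L 4 2 = fun lam => formV 2 (solC L 3 lam) * formV 1 (solC L 2 lam) -
      formV 2 (solC L 2 lam) * formV 1 (solC L 3 lam) by apply/funext => lam; rewrite Delta42E.
    by split; [|split]; apply: lipB; apply: lipM; exact: lV.
  rewrite (funext WE).
  by apply: lipB; [|apply: lipB]; apply: lipM => //; exact: lip_integral.
have [oD _ _] := Delta_ord4 L; have a2 := ord4_anl oD.
have [D [aD DE]] := anl_taylor1 mu a2; rewrite D0 in DE.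
have {}DE z : Delta L 2 2 z = (z - mu) * D z by rewrite DE add0r.
have cD : cderive (Delta L 2 2) mu = D mu.
  by apply: cderiveE (aD mu) _ => z; rewrite D0 add0r DE.
(* Off [mu] the Lagrange identity may be divided by z - mu; the value at [mu] follows by continuity
   of both sides. *)
have gD : g * D mu = W mu.
  apply: (@anl_lip_eq (fun z => g * D z)) => // [z|z zmu]; first by apply: lanlZ; exact: aD.
  have zn : z - mu != 0 by rewrite subr_eq0.
  by apply: (mulfI zn); rewrite -GW DE; ring.
have z3 := zU mu 3 isT; have z4 := zU mu 4 isT.
rewrite /= D0 mul0r ?mulr0 ?mulr1 ?subr0 ?addr0 ?add0r in z3 z4.
have zE := eigenfunction_comb (zs mu).
rewrite !zU// D0 !mulr0 !mul0r subrr !addr0 in zE.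
have {}zE := zE erefl erefl; rewrite z3 z4 in zE.
have zV : Delta L 3 2 mu * formV 1 (solC L 3 mu) + Delta L 4 2 mu * formV 1 (solC L 4 mu) = 0.
  by rewrite -(zV1 mu) /formV /= [in RHS]zE.
(* At [mu] both Y and z lie in the span of C_3 and C_4 and satisfy V_1 = 0, a nontrivial condition
   because V_1(C_4) is nonzero. They are therefore proportional, with factor [kap]. *)
pose kap := Delta L 3 2 mu / g.
have D3 : Delta L 3 2 mu = kap * g by rewrite divfK.
have D4 : Delta L 4 2 mu = kap * x.
  apply: (mulIf V14); apply/eqP; rewrite -subr_eq0; apply/eqP.
  transitivity ((Delta L 3 2 mu * formV 1 (solC L 3 mu) + Delta L 4 2 mu * formV 1 (solC L 4 mu)) -
    kap * (g * formV 1 (solC L 3 mu) + x * formV 1 (solC L 4 mu))).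
    by rewrite D3; ring.
  by rewrite zV V1E mulr0 subrr.
exists kap; split => //; rewrite cD mulrC gD.
have Yb : cbm (Y 0%N) by case: hY => y0 _ _ _; exact: W11_bm y0.
rewrite -cIZ ?lexx//; last by apply: cbm_L1; apply: cbm_eq (cbmM Yb Yb) => s _; rewrite expr2.
by apply: eq_cI => s s01; rewrite zE// YE// D3 D4; ring.
Qed.

Lemma eigenfunction_weights L mu Y : separation L -> Delta L 2 2 mu = 0 ->
  normalized_eigenfunction L mu Y ->
  [/\ Y 0%N 0 != 0, Delta L 3 2 mu = cderive (Delta L 2 2) mu * Y 0%N 0 ^+ 2 &
      Delta L 4 2 mu = cderive (Delta L 2 2) mu * Y 1%N 0 * Y 0%N 0].
Proof.
move=> sep D0 [/is_solutionP hY [U1 U2] [V1 V2]]; rewrite cintegral01 => nY.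
have g0 : Y 0%N 0 != 0.
  by apply: eigenfunction_neq0 sep D0 hY U1 U2 V1 _; rewrite nY oner_eq0.
have [kap [-> ->]] := eigenfunction_identity sep D0 hY U1 U2 V1 V2 g0.
by rewrite nY mulr1 => kE; split => //; rewrite -kE; ring.
Qed.

(** For complex y the integral of y^2 could vanish. It does not here: the identity writes the
    nonzero number Delta_22'(mu) y(0) as a multiple of it. A complex square root then normalizes
    y. *)
Lemma normalized_eigenfunction_exists L mu : simple_eigenvalues L -> separation L ->
  Delta L 2 2 mu = 0 -> exists Y, normalized_eigenfunction L mu Y.
Proof.
move=> simp sep D0; have V14 := separation_formV sep D0.
pose y i t := formV 1 (solC L 4 mu) * solC L 3 mu i t + - formV 1 (solC L 3 mu) * solC L 4 mu i t.
have hs k := solC_spec L k mu.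
have hy : sys4 L mu y by apply: sys4_lin; [exact: (proj1 (hs _))|exact: (proj1 (hs _))].
have yU s : (1 <= s <= 4)%N -> formU L s y = formV 1 (solC L 4 mu) * (s == 3)%:R -
    formV 1 (solC L 3 mu) * (s == 4)%:R.
  by move=> s14; rewrite formU_lin (proj2 (hs _))// (proj2 (hs _))// mulNr.
have U1 : formU L 1 y = 0 by rewrite yU// !mulr0 subrr.
have U2 : formU L 2 y = 0 by rewrite yU// !mulr0 subrr.
have y0 : y 0%N 0 = formV 1 (solC L 4 mu).
  by transitivity (formU L 3 y) => //; rewrite yU// mulr0 mulr1 subr0.
have V1 : formV 1 y = 0 by rewrite /y /formV /=; ring.
have V2 : formV 2 y = 0 by rewrite -D0 Delta22E /y /formV /=; ring.
have g0 : y 0%N 0 != 0 by rewrite y0.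
have [kap [_ _ kE]] := eigenfunction_identity sep D0 hy U1 U2 V1 V2 g0.
set N := cI _ _ _ in kE.
have N0 : N != 0.
  by apply/eqP => N0; move/eqP: kE; rewrite N0 mulr0 mulf_eq0 (negbTE g0) orbF (negbTE (simp _ D0)).
have [r hr] : exists r : C, r ^+ 2 = N^-1.
  have [w] := @solve_monicpoly C 2 (fun i => if i is 0%N then N^-1 else 0) isT.
  rewrite !big_ord_recl big_ord0 /= expr0 mulr1 !mul0r !addr0 => <-; by exists w.
have lin s : formU L s (fun i t => r * y i t + 0 * y i t) = r * formU L s y + 0 * formU L s y.
  exact: (@formU_lin _ L s r 0 y y).
exists (fun i t => r * y i t + 0 * y i t); split.
- by apply/is_solutionP; exact: sys4_lin.
- by rewrite !lin U1 U2 !mulr0 addr0.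
- by move: V1 V2; rewrite /formV /= => -> ->; rewrite !mulr0 addr0.
rewrite cintegral01.
have yb : cbm (y 0%N) by case: hy => h _ _ _; exact: W11_bm h.
rewrite (_ : (fun x => _) = fun x => r ^+ 2 * y 0%N x ^+ 2); last first.
  by apply/funext => x; ring.
rewrite cIZ ?lexx//; first by rewrite hr mulVf.
by apply: cbm_L1; apply: cbm_eq (cbmM yb yb) => s _; rewrite expr2.
Qed.

End WeightNumbers.

(** * Uniqueness *)

Section Uniqueness.
Context {R : realType}.
Notation C := R[i].
Implicit Types (L : problem R) (lam mu z : C) (F G : C -> C) (tau : R).

(** The leading term [phi] depends only on [tau], not on the problem; [sc] is its order of
    magnitude, and the error is smaller by a factor [tau]. *)
Definition ray_asymp F (phi sc : R -> R) : Prop := exists2 C1 : R, 0 <= C1 &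
  forall tau, 1 <= tau -> cmod (F (lray tau) - (phi tau)%:C) <= C1 * sc tau / tau.

Lemma ray_vanishing F G (M B : R) : anl F -> 0 <= M ->
  (forall rho z, 1 <= rho -> cmod z <= rho ^+ 4 -> cmod (F z) <= M * expR (B * rho)) ->
  ord4 G -> zdvd G F ->
  (forall eps : R, 0 < eps -> exists T : R, forall tau, T <= tau ->
     G (lray tau) != 0 /\ cmod (F (lray tau)) <= eps * cmod (G (lray tau))) ->
  forall z, F z = 0.
Proof.
move=> aF M0 gF oG GF h; apply: (entire_ratio_vanishing aF M0 gF oG GF) => eps /h[T hT].
pose T1 := Num.max T 0; have T0 : 0 <= T1 by rewrite le_max lexx orbT.
exists (T1 ^+ 4 / 4) => x hx.
have x0 : 0 <= 4 * x by have := exprn_ge0 4 T0; lra.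
pose tau := Num.sqrt (Num.sqrt (4 * x)).
have tx : tau ^+ 4 = 4 * x by rewrite (exprM tau 2 2) !sqr_sqrtr// sqrtr_ge0.
have -> : (- x)%:C = lray tau.
  by rewrite /lray tx; congr (- _)%:C; lra.
apply: hT; apply: (@le_trans _ _ T1); first by rewrite le_max lexx.
rewrite -(@ler_pXn2r _ 4%N)// ?nnegrE ?sqrtr_ge0// tx; lra.
Qed.

(** The threshold 6 makes the lower bounds on the leading terms valid, and 32 b makes the error at
    most half of the lower bound sc / 16. *)
Lemma ray_asymp_neq0 F (phi sc : R -> R) : ray_asymp F phi sc ->
  (forall tau, 6 <= tau -> 0 < sc tau /\ sc tau / 16 <= `|phi tau|) ->
  exists T : R, forall tau, T <= tau -> sc tau / 32 <= cmod (F (lray tau)) /\ 0 < sc tau.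
Proof.
move=> [b b0 hF] low; exists (6 + 32 * b) => tau ht.
have t6 : 6 <= tau by lra.
have t0 : 0 < tau by lra.
have [sc0 lo] := low tau t6.
have h1 : b * sc tau / tau <= sc tau / 32.
  rewrite ler_pdivrMr//; have : sc tau * (32 * b) <= sc tau * tau by rewrite ler_pM2l//; lra.
  lra.
have hp : sc tau / 16 <= cmod ((phi tau)%:C : C).
  by rewrite cmod_real.
have := cmod_sub_ge (phi tau)%:C (F (lray tau)); rewrite cmod_distC.
have := hF tau; have t1 : 1 <= tau by lra.
by move=> /(_ t1); split => //; lra.
Qed.

(** Functions with the same leading term differ by a multiple of sc / tau on the ray, which is
    negligible against [G] as soon as [G] is at least of the order [sc]. *)
Lemma ray_asymp_vanishing F F' G (phi sc phiG scG : R -> R) :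
  ord4 F -> ord4 F' -> ord4 G -> zdvd G (fun z => F z - F' z) ->
  ray_asymp F phi sc -> ray_asymp F' phi sc -> ray_asymp G phiG scG ->
  (forall tau, 6 <= tau -> 0 < scG tau /\ scG tau / 16 <= `|phiG tau|) ->
  (forall tau, 1 <= tau -> sc tau <= scG tau) ->
  F = F'.
Proof.
move=> oF oF' oG GF [c c0 hF] [c' c'0 hF'] /ray_asymp_neq0 h /h{h}[T hT] scle.
suff : forall z, F z - F' z = 0.
  by move=> h; apply/funext => z; apply/eqP; rewrite -subr_eq0 h.
have [M [B [M0 B0 gF]]] := ord4_growth oF; have [M' [B' [M'0 B'0 gF']]] := ord4_growth oF'.
apply: (@ray_vanishing _ G (M + M') (B + B')) => //.
- by move=> z; apply: lanlB; exact: ord4_anl.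
- exact: addr_ge0.
- move=> rho z rho1 zr; apply: le_trans (cmodB _ _) _; rewrite [leRHS]mulrDl lerD//.
    apply: le_trans (gF _ _ rho1 zr) _; rewrite ler_wpM2l// ler_expR ler_wpM2r//; lra.
  apply: le_trans (gF' _ _ rho1 zr) _; rewrite ler_wpM2l// ler_expR ler_wpM2r//; lra.
move=> eps eps0; exists (Num.max T (Num.max 1 (32 * (c + c') / eps))) => tau.
rewrite !ge_max => /and3P[/hT[h2 sc0] t1 ht]; have sl := scle tau t1.
have t0 : 0 < tau by lra.
split; first by rewrite -cmod_gt0; apply: lt_le_trans h2; rewrite divr_gt0.
apply: le_trans (ler_wpM2l (ltW eps0) h2).
have -> : F (lray tau) - F' (lray tau) =
  (F (lray tau) - (phi tau)%:C) - (F' (lray tau) - (phi tau)%:C) by ring.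
apply: le_trans (cmodB _ _) _.
apply: le_trans (lerD (hF tau t1) (hF' tau t1)) _.
rewrite -!mulrDl ler_pdivrMr//.
apply: (@le_trans _ _ ((c + c') * scG tau)); first by rewrite ler_wpM2l ?addr_ge0.
rewrite (_ : eps * (scG tau / 32) * tau = (eps * tau / 32) * scG tau); last by ring.
rewrite ler_pM2r//.
by move: ht; rewrite ler_pdivrMr//; lra.
Qed.

Lemma zdvd_simple F G : anl F -> anl G ->
  (forall z, G z = 0 -> cderive G z != 0 /\ F z = 0) -> zdvd G F.
Proof.
move=> aF aG h z0; have [G0|G0] := eqVneq (G z0) 0; last first.
  by exists 0%N, F, G; split => // z; rewrite expr0 mul1r.
have [dG F0] := h z0 G0.
have [F1 [aF1 FE]] := anl_quot aF F0; have [G1 [aG1 GE]] := anl_quot aG G0.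
have c : cderive G z0 = G1 z0 by apply: cderiveE (aG1 z0) _ => w; rewrite G0 add0r.
by exists 1%N, F1, G1; split => //; rewrite -c.
Qed.

Lemma zdvd_vanishing F G : anl F -> anl G -> (exists z, G z != 0) ->
  (forall z k, (forall i, (i <= k)%N -> cderiven i G z = 0) ->
     forall i, (i <= k)%N -> cderiven i F z = 0) -> zdvd G (fun z => F z - G z).
Proof.
move=> aF aG nG h z0; have [k [G1 [aG1 G10 GE]]] := anl_order z0 aG nG.
have [F1 [aF1 FE]] : exists F1, anl F1 /\ forall z, F z = (z - z0) ^+ k * F1 z.
  case: k GE => [|k] GE; first by exists F; split => // z; rewrite expr0 mul1r.
  apply/(vanishing_order _ _ aF); apply: h; apply/(vanishing_order _ _ aG).
  by exists G1.
exists k, (fun z => F1 z - G1 z), G1; split => // [z|z].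
  by apply: lanlB; [exact: aF1|exact: aG1].
by rewrite FE GE mulrBr.
Qed.

(** The pairs are oriented so that the leading initial minor is positive; the signs record that
    Delta_22 and Delta_42 use the opposite order. *)
Lemma Delta_ray L :
  [/\ ray_asymp (Delta L 2 2) (fun tau => - free22 tau 0 1) expR,
   ray_asymp (Delta L 3 2) (fun tau => free32 tau 0 1) (fun tau => expR tau / tau ^+ 3) &
   ray_asymp (Delta L 4 2) (fun tau => - free42 tau 0 1)
     (fun tau => expR tau / tau ^+ 2)].
Proof.
pose c j k i := minors (solC L j 0) (solC L k 0) i 0.
have lin j k lam : linsol 5 (A5 L lam) (c j k) (minors (solC L j lam) (solC L k lam)).
  have := minors_linsol (proj1 (solC_spec L j lam)) (proj1 (solC_spec L k lam)).
  by congr linsol; apply/funext => i; exact: minors_solC_init.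
have [a0 a1 a2 a3] := solC_init L 2 0; have [b0 b1 b2 b3] := solC_init L 3 0.
have [d0 d1 d2 d3] := solC_init L 4 0.
have ce i j k := erefl (c j k i).
split.
- have [|C1 C10 h] := @ray22 R L (c 3 4).
    by rewrite /c /minors b0 b1 d0 d1 /=; ring.
  exists C1 => // tau t1; have := h tau _ t1 (lin 3 4 (lray tau)).
  have [-> _ _] := Delta_minors L (lray tau); rewrite /minors -cmodN rmorphN /=.
  by congr (cmod _ <= _); ring.
- have [||||C1 C10 h] := @ray32 R L (c 4 2).
  + by rewrite /c /minors a0 a1 d0 d1 /=; ring.
  + by rewrite /c /minors a0 a2 d0 d2 /=; ring.
  + by rewrite /c /minors a0 a1 a2 a3 d0 d1 d2 d3 /=; ring.
  + by rewrite /c /minors a1 a3 d1 d3 /=; ring.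
  exists C1 => // tau t1; have := h tau _ t1 (lin 4 2 (lray tau)).
  by have [_ -> _] := Delta_minors L (lray tau).
have [||||C1 C10 h] := @ray42 R L (c 3 2).
- by rewrite /c /minors a0 a1 b0 b1 /=; ring.
- by rewrite /c /minors a0 a2 b0 b2 /=; ring.
- rewrite /c /minors a0 a1 a2 a3 b0 b1 b2 b3 /=.
  by rewrite rmorphM /= fmorphV /= rmorph_nat; field.
- by rewrite /c /minors a1 a3 b1 b3 /=; ring.
exists C1 => // tau t1; have := h tau _ t1 (lin 3 2 (lray tau)).
have [_ _ ->] := Delta_minors L (lray tau); rewrite /minors -cmodN rmorphN /=.
by congr (cmod _ <= _); ring.
Qed.

Lemma expR_ge6 tau : 6 <= tau -> 6 <= expR tau.
Proof. by have := expR_ge1Dx tau; lra. Qed.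

Lemma free22_lower tau : 6 <= tau -> 0 < expR tau /\ expR tau / 16 <= `|- free22 tau 0 1|.
Proof.
move=> t6; have t0 : 0 < tau by lra.
split; first exact: expR_gt0.
by have [h _ _] := free_lower t0 (expR_ge6 t6); rewrite normrN (le_trans h)// ler_norm.
Qed.

Lemma free32_lower tau : 6 <= tau ->
  0 < expR tau / tau ^+ 3 /\ expR tau / tau ^+ 3 / 16 <= `|free32 tau 0 1|.
Proof.
move=> t6; have t0 : 0 < tau by lra.
split; first by rewrite divr_gt0 ?expR_gt0 ?exprn_gt0.
by have [_ h _] := free_lower t0 (expR_ge6 t6); rewrite (le_trans h)// ler_norm.
Qed.

Lemma free42_lower tau : 6 <= tau ->
  0 < expR tau / tau ^+ 2 /\ expR tau / tau ^+ 2 / 16 <= `|- free42 tau 0 1|.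
Proof.
move=> t6; have t0 : 0 < tau by lra.
split; first by rewrite divr_gt0 ?expR_gt0 ?exprn_gt0.
by have [_ _ h] := free_lower t0 (expR_ge6 t6); rewrite normrN (le_trans h)// ler_norm.
Qed.

Lemma expR_div_le n tau : 1 <= tau -> expR tau / tau ^+ n <= expR tau.
Proof.
move=> t1; rewrite ler_pdivrMr ?exprn_gt0//; last by lra.
by rewrite ler_peMr ?expR_ge0// exprn_ege1.
Qed.

Lemma Delta22_unique L L' : simple_eigenvalues L ->
  (forall mu, Delta L 2 2 mu = 0 -> Delta L' 2 2 mu = 0) -> Delta L 2 2 = Delta L' 2 2.
Proof.
move=> simp h; have [oD _ _] := Delta_ord4 L; have [oD' _ _] := Delta_ord4 L'.
have [r _ _] := Delta_ray L; have [r' _ _] := Delta_ray L'.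
apply: (ray_asymp_vanishing oD oD' oD _ r r' r free22_lower) => //.
apply: zdvd_simple; [|exact: ord4_anl|].
  by move=> z; apply: lanlB; exact: ord4_anl.
by move=> z Dz; split; [exact: simp|rewrite Dz h// subrr].
Qed.

(** An interpolation statement: the difference is divisible by Delta_22, which is larger on the ray
    by a factor tau^3. *)
Lemma Delta32_unique L L' : simple_eigenvalues L ->
  (forall mu, Delta L 2 2 mu = 0 -> Delta L 3 2 mu = Delta L' 3 2 mu) ->
  Delta L 3 2 = Delta L' 3 2.
Proof.
move=> simp h; have [oD oD3 _] := Delta_ord4 L; have [_ oD3' _] := Delta_ord4 L'.
have [r r3 _] := Delta_ray L; have [_ r3' _] := Delta_ray L'.
apply: (ray_asymp_vanishing oD3 oD3' oD _ r3 r3' r free22_lower).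
  apply: zdvd_simple; [|exact: ord4_anl|].
    by move=> z; apply: lanlB; exact: ord4_anl.
  by move=> z Dz; split; [exact: simp|rewrite h// subrr].
by move=> tau; exact: expR_div_le.
Qed.

Lemma Delta42_unique L L' : simple_eigenvalues L ->
  (forall mu, Delta L 2 2 mu = 0 -> Delta L 4 2 mu = Delta L' 4 2 mu) ->
  Delta L 4 2 = Delta L' 4 2.
Proof.
move=> simp h; have [oD _ oD4] := Delta_ord4 L; have [_ _ oD4'] := Delta_ord4 L'.
have [r _ r4] := Delta_ray L; have [_ _ r4'] := Delta_ray L'.
apply: (ray_asymp_vanishing oD4 oD4' oD _ r4 r4' r free22_lower).
  apply: zdvd_simple; [|exact: ord4_anl|].
    by move=> z; apply: lanlB; exact: ord4_anl.
  by move=> z Dz; split; [exact: simp|rewrite h// subrr].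
by move=> tau; exact: expR_div_le.
Qed.

(** Here the divisor is [F] itself, whose zeros may be multiple; divisibility of F' - F by F
    therefore comes from the comparison of vanishing derivatives. *)
Lemma spectrum_unique F F' (phi sc : R -> R) : ord4 F -> ord4 F' ->
  ray_asymp F phi sc -> ray_asymp F' phi sc ->
  (forall tau, 6 <= tau -> 0 < sc tau /\ sc tau / 16 <= `|phi tau|) ->
  (forall z k, (forall i, (i <= k)%N -> cderiven i F z = 0) ->
     forall i, (i <= k)%N -> cderiven i F' z = 0) -> F = F'.
Proof.
move=> oD oD' r r' low h; symmetry.
apply: (ray_asymp_vanishing oD' oD oD _ r' r r low) => //.
apply: zdvd_vanishing => //; [exact: ord4_anl|exact: ord4_anl|].
have [T hT] := ray_asymp_neq0 r low; have [h1 h2] := hT T (lexx _).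
by exists (lray T); rewrite -cmod_gt0; apply: lt_le_trans h1; rewrite divr_gt0.
Qed.

(** The exponent [B] is arbitrary; a value below 1 makes a polynomial negligible against exp tau on
    the ray. Each factor uses half of [B], through rho <= (8 / B) exp (B rho / 8) raised to the
    fourth power. *)
Lemma prod_growth (s : seq C) (B : R) : 0 < B -> exists2 M : R, 0 <= M &
  forall rho z, 1 <= rho -> cmod z <= rho ^+ 4 ->
    cmod (\prod_(a <- s) (z - a)) <= M * expR (B * rho).
Proof.
elim: s B => [|a s IH] B B0.
  exists 1 => // rho z rho1 _; rewrite big_nil cmod1 mul1r.
  have := expR_ge1Dx (B * rho); have : 0 <= B * rho by rewrite mulr_ge0//; lra.
  lra.
have B2 : 0 < B / 2 by rewrite divr_gt0.
have [M M0 hM] := IH _ B2; pose K := (8 / B) ^+ 4.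
have K0 : 0 <= K by rewrite exprn_ge0// divr_ge0// ltW.
have a0 : 0 <= 1 + cmod a by rewrite addr_ge0// cmod_ge0.
exists ((1 + cmod a) * K * M) => [|rho z rho1 zr]; first by rewrite mulr_ge0// mulr_ge0.
have r4 : rho ^+ 4 <= K * expR (B / 2 * rho).
  have -> : expR (B / 2 * rho) = expR (B / 8 * rho) ^+ 4.
    by rewrite -expRM_natl; congr expR; field.
  have B8 : 0 < 8 / B by rewrite divr_gt0.
  rewrite -exprMn lerXn2r ?nnegrE ?(mulr_ge0 (ltW B8) (expR_ge0 _))//; first by lra.
  have -> : rho = 8 / B * (B / 8 * rho) by field; rewrite gt_eqF.
  rewrite [in leRHS](_ : B / 8 * (8 / B * (B / 8 * rho)) = B / 8 * rho); last by field; rewrite gt_eqF.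
  by rewrite ler_pM2l//; have := expR_ge1Dx (B / 8 * rho); lra.
have r1 : 1 <= rho ^+ 4 by rewrite exprn_ege1.
have za : cmod (z - a) <= (1 + cmod a) * (K * expR (B / 2 * rho)).
  apply: le_trans (ler_wpM2l a0 r4); apply: le_trans (cmodB _ _) _.
  by have := ler_wpM2l (cmod_ge0 a) r1; rewrite mulr1 mulrDl mul1r; lra.
rewrite big_cons cmodM.
apply: le_trans (ler_pM (cmod_ge0 _) (cmod_ge0 _) za (hM _ _ rho1 zr)) _.
have -> : expR (B * rho) = expR (B / 2 * rho) * expR (B / 2 * rho).
  by rewrite -expRD; congr expR; field.
by rewrite le_eqVlt; apply/orP; left; apply/eqP; ring.
Qed.

(* Otherwise P / Delta_22 is entire for some polynomial P <> 0, and it tends to 0 on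
   the ray. *)
Lemma Delta22_infinite_zeros L : simple_eigenvalues L ->
  infinite_set [set mu | Delta L 2 2 mu = 0].
Proof.
move=> simp /finite_seqP[s sE]; have [oD _ _] := Delta_ord4 L; have [r _ _] := Delta_ray L.
pose P z : C := \prod_(a <- s) (z - a).
have aP : anl P.
  have -> : P = fun z => (\prod_(a <- s) ('X - a%:P)).[z].
    by apply/funext => z; rewrite horner_prod; apply: eq_bigr => a _; rewrite !hornerE.
  exact: anl_poly.
have half0 : 0 < (1 / 2 : R) by rewrite divr_gt0.
have [M M0 hM] := prod_growth s half0.
have [T hT] := ray_asymp_neq0 r free22_lower.
have P0 : forall z, P z = 0.
  apply: (@ray_vanishing _ (Delta L 2 2) M (1 / 2)) => //.
  - apply: zdvd_simple => //; first exact: ord4_anl.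
    move=> z Dz; split; first exact: simp.
    have zs : z \in s by have : [set mu | Delta L 2 2 mu = 0] z by []; rewrite sE.
    by rewrite /P (big_rem z)//= subrr mul0r.
  move=> eps eps0; exists (Num.max (Num.max T 1) (64 * M / eps)) => tau.
  rewrite !ge_max => /andP[/andP[tT t1] te].
  have [h1 h2] := hT tau tT; have t0 : 0 < tau by lra.
  split; first by rewrite -cmod_gt0; apply: lt_le_trans h1; rewrite divr_gt0.
  apply: le_trans (ler_wpM2l (ltW eps0) h1).
  have tr : cmod (lray tau) <= tau ^+ 4.
    have p4 := exprn_ge0 4 (ltW t0).
    by rewrite cmod_real normrN ger0_norm ?divr_ge0//; lra.
  apply: le_trans (hM tau _ t1 tr) _.
  have -> : expR tau = expR (1 / 2 * tau) * expR (1 / 2 * tau).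
    by rewrite -expRD; congr expR; field.
  rewrite (_ : eps * (_ * _ / 32) = eps * expR (1 / 2 * tau) / 32 * expR (1 / 2 * tau)); last by ring.
  rewrite ler_pM2r ?expR_gt0//.
  have := expR_ge1Dx (1 / 2 * tau); move: te; rewrite ler_pdivrMr// => te he.
  have := ler_wpM2l (ltW eps0) he; rewrite mulrDr; lra.
(* A point whose modulus exceeds that of every root, so that the product cannot vanish there. *)
pose w : C := (1 + \sum_(a <- s) cmod a)%:C.
have wS : 0 <= \sum_(a <- s) cmod a by rewrite sumr_ge0// => a _; exact: cmod_ge0.
have /eqP := P0 w; rewrite /P prodf_seq_eq0 => /hasP[a as_ /andP[_]].
rewrite subr_eq0 => /eqP wa.
have : cmod a <= \sum_(a <- s) cmod a.
  by rewrite (big_rem a)//= lerDl sumr_ge0// => b _; exact: cmod_ge0.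
by rewrite -{1}wa cmod_real ger0_norm; lra.
Qed.

(** The zeros are finite in number in every disc, hence countable, and infinite in number. Equality
    of the weight data asserts the existence of numberings, so one has to be produced from the
    spectra. *)
Lemma numbering_exists L : simple_eigenvalues L -> exists lam : nat -> C, numbering L lam.
Proof.
move=> simp; have [oD _ _] := Delta_ord4 L; have a := ord4_anl oD.
have inf := Delta22_infinite_zeros simp.
have nz : exists z, Delta L 2 2 z != 0.
  have [r _ _] := Delta_ray L; have [T hT] := ray_asymp_neq0 r free22_lower.
  have [h1 h2] := hT T (lexx _); exists (lray T).
  by rewrite -cmod_gt0; apply: lt_le_trans h1; rewrite divr_gt0.
have cnt : countable [set mu | Delta L 2 2 mu = 0].
  have -> : [set mu | Delta L 2 2 mu = 0] =
      \bigcup_(n in [set: nat]) [set z | Delta L 2 2 z = 0 /\ cmod z <= n%:R].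
    apply/seteqP; split => [z z0|z [n _ []]//].
    by have [n hn] := natr_above (cmod z); exists n.
  apply: bigcup_countable => // n _; apply: finite_set_countable.
  exact: anl_finite_zeros.
have /(@card_set_bijP nat R[i]^o)[lam [fn inj surj]] : ([set: nat] #= [set mu | Delta L 2 2 mu = 0])%card.
  by rewrite card_eq_le; apply/andP; split; [exact/infiniteP|].
exists lam; split.
  by move=> m n; apply: inj; rewrite inE.
by apply/seteqP; split => [z [n _ <-]|z /surj[n _ <-]]; [exact: fn|exists n].
Qed.

Lemma spectrum_char_fun L :
  [/\ spectrum_char L 1 2 = (fun lam => - Delta L 2 2 lam),
      spectrum_char L 1 3 = Delta L 3 2 & spectrum_char L 2 3 = Delta L 4 2].
Proof. by split; apply/funext => lam; have [h1 h2 h3] := spectrum_charE L lam. Qed.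

Lemma spectrum_le L L' j k : spectrum L j k = spectrum L' j k ->
  forall z m, (forall i, (i <= m)%N -> cderiven i (spectrum_char L j k) z = 0) ->
  forall i, (i <= m)%N -> cderiven i (spectrum_char L' j k) z = 0.
Proof.
move=> E z m h; have : spectrum L j k (z, m) by exact: h.
by rewrite E.
Qed.

(** For S_12 simplicity reduces the matter to the sets of zeros. Delta_32 and Delta_42 may have
    multiple zeros, and for them the multiplicities recorded in the spectra are used. *)
Lemma spectra_determine_Delta L L' : simple_eigenvalues L ->
  spectrum L 1 2 = spectrum L' 1 2 -> spectrum L 1 3 = spectrum L' 1 3 ->
  spectrum L 2 3 = spectrum L' 2 3 ->
  [/\ Delta L 2 2 = Delta L' 2 2, Delta L 3 2 = Delta L' 3 2 & Delta L 4 2 = Delta L' 4 2].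
Proof.
move=> simp S12 S13 S23.
have [_ oD3 oD4] := Delta_ord4 L; have [_ oD3' oD4'] := Delta_ord4 L'.
have [_ r3 r4] := Delta_ray L; have [_ r3' r4'] := Delta_ray L'.
have [c12 c13 c23] := spectrum_char_fun L; have [c12' c13' c23'] := spectrum_char_fun L'.
split.
- apply: Delta22_unique => // mu D0.
  have := spectrum_le S12; rewrite c12 c12' => /(_ mu 0%N) h.
  apply: oppr_inj; rewrite oppr0; apply: (h _ 0%N) => // i.
  by rewrite leqn0 => /eqP ->; rewrite /cderiven /= D0 oppr0.
- apply: (spectrum_unique oD3 oD3' r3 r3' free32_lower).
  by have := spectrum_le S13; rewrite c13 c13'.
apply: (spectrum_unique oD4 oD4' r4 r4' free42_lower).
by have := spectrum_le S23; rewrite c23 c23'.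
Qed.

Lemma numbering_zeros L (lam : nat -> C) mu : numbering L lam ->
  Delta L 2 2 mu = 0 <-> exists n, lam n = mu.
Proof.
move=> [_ E]; have <- : [set mu | Delta L 2 2 mu = 0] mu = (Delta L 2 2 mu = 0) by [].
by rewrite -E; split => [[n _ <-]|[n <-]]; exists n.
Qed.

Lemma Delta22_numbering L L' (lam lam' : nat -> C) : simple_eigenvalues L ->
  numbering L lam -> numbering L' lam' -> (forall n, lam n = lam' n) ->
  Delta L 2 2 = Delta L' 2 2.
Proof.
move=> simp nL nL' E; apply: Delta22_unique => // mu /(numbering_zeros _ nL)[n <-].
by apply/(numbering_zeros _ nL'); exists n; rewrite E.
Qed.

Lemma eigenfunction_sign L mu (Y : nat -> R -> C) : normalized_eigenfunction L mu Y ->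
  exists Y', [/\ normalized_eigenfunction L mu Y', Y' 0%N 0 = - Y 0%N 0 &
    Y' 1%N 0 = - Y 1%N 0].
Proof.
move=> [/is_solutionP hY [U1 U2] [V1 V2] nY].
exists (fun i t => -1 * Y i t + 0 * Y i t); split; last 2 first.
- by rewrite mul0r addr0 mulN1r.
- by rewrite mul0r addr0 mulN1r.
split.
- by apply/is_solutionP; exact: sys4_lin.
- by rewrite !formU_lin U1 U2 !mulr0 addr0.
- by move: V1 V2; rewrite /formV /= => -> ->; rewrite !mulr0 addr0.
rewrite -[RHS]nY; congr cintegral; apply/funext => x.
by rewrite mul0r addr0 mulN1r sqrrN.
Qed.

(** After division by the nonzero derivative, Delta_32 gives gamma^2, hence gamma up to sign;
    Delta_42 gives xi gamma, and since gamma is nonzero the sign of xi follows that of gamma. *)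
Lemma weights_determined L L' mu (Y Y' : nat -> R -> C) :
  simple_eigenvalues L -> separation L -> separation L' -> Delta L 2 2 = Delta L' 2 2 ->
  Delta L 2 2 mu = 0 -> normalized_eigenfunction L mu Y -> normalized_eigenfunction L' mu Y' ->
  Delta L 3 2 mu = Delta L' 3 2 mu -> Delta L 4 2 mu = Delta L' 4 2 mu ->
  (Y 0%N 0 = Y' 0%N 0 /\ Y 1%N 0 = Y' 1%N 0) \/
  (Y 0%N 0 = - Y' 0%N 0 /\ Y 1%N 0 = - Y' 1%N 0).
Proof.
move=> simp sep sep' DE D0 nY nY'; have D0' : Delta L' 2 2 mu = 0 by rewrite -DE.
have dD := simp mu D0.
have [g0 -> ->] := eigenfunction_weights sep D0 nY.
have [g0' -> ->] := eigenfunction_weights sep' D0' nY'; rewrite -DE.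
move=> /(mulfI dD)/eqP; rewrite eqf_sqr => E.
rewrite -!mulrA => /(mulfI dD) F; case/orP: E => /eqP E; [left|right]; split => //.
  by apply: (mulIf g0'); rewrite -{1}E.
by apply: (mulIf g0'); rewrite mulNr -F E; ring.
Qed.

End Uniqueness.

Theorem corollary7p5 (R : realType) :
  (forall (L : problem R), simple_eigenvalues L -> separation L ->
   forall (lam : nat -> R[i]) (Y : nat -> nat -> R -> R[i]),
   numbering L lam -> normalized_eigenfunctions L lam Y ->
   forall n : nat,
     Delta L 3 2 (lam n) =
       cderive (Delta L 2 2) (lam n) * weight_gamma Y n ^+ 2 /\
     Delta L 4 2 (lam n) =
       cderive (Delta L 2 2) (lam n) * weight_xi Y n * weight_gamma Y n) /\
  (forall (L L' : problem R),
   simple_eigenvalues L -> separation L ->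
   simple_eigenvalues L' -> separation L' ->
   [/\ (forall (lam lam' : nat -> R[i]) (Y Y' : nat -> nat -> R -> R[i]),
          numbering L lam -> normalized_eigenfunctions L lam Y ->
          numbering L' lam' -> normalized_eigenfunctions L' lam' Y' ->
          (forall n : nat, [/\ lam n = lam' n,
             weight_gamma Y n = weight_gamma Y' n &
             weight_xi Y n = weight_xi Y' n]) ->
          forall n : nat,
            Delta L 3 2 (lam n) = Delta L' 3 2 (lam' n) /\
            Delta L 4 2 (lam n) = Delta L' 4 2 (lam' n)),
       (forall (lam lam' : nat -> R[i]) (Y Y' : nat -> nat -> R -> R[i]),
          numbering L lam -> normalized_eigenfunctions L lam Y ->
          numbering L' lam' -> normalized_eigenfunctions L' lam' Y' ->
          (forall n : nat, [/\ lam n = lam' n,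
             Delta L 3 2 (lam n) = Delta L' 3 2 (lam' n) &
             Delta L 4 2 (lam n) = Delta L' 4 2 (lam' n)]) ->
          forall n : nat,
            (weight_gamma Y n = weight_gamma Y' n /\
             weight_xi Y n = weight_xi Y' n) \/
            (weight_gamma Y n = - weight_gamma Y' n /\
             weight_xi Y n = - weight_xi Y' n)) &
       (same_weight_data L L' <->
        [/\ spectrum L 1 2 = spectrum L' 1 2,
            spectrum L 1 3 = spectrum L' 1 3 &
            spectrum L 2 3 = spectrum L' 2 3])]).
Proof.
have weights (L : problem R) lam Y n : separation L -> numbering L lam ->
    normalized_eigenfunctions L lam Y ->
    Delta L 3 2 (lam n) = cderive (Delta L 2 2) (lam n) * weight_gamma Y n ^+ 2 /\
    Delta L 4 2 (lam n) = cderive (Delta L 2 2) (lam n) * weight_xi Y n * weight_gamma Y n.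
  move=> sep nL nY; have D0 : Delta L 2 2 (lam n) = 0 by apply/(numbering_zeros _ nL); exists n.
  by have [_ -> ->] := eigenfunction_weights sep D0 (nY n).
have weights_eq (L L' : problem R) lam lam' Y Y' : simple_eigenvalues L -> separation L ->
    separation L' -> numbering L lam -> normalized_eigenfunctions L lam Y ->
    numbering L' lam' -> normalized_eigenfunctions L' lam' Y' ->
    (forall n : nat, [/\ lam n = lam' n, weight_gamma Y n = weight_gamma Y' n &
       weight_xi Y n = weight_xi Y' n]) ->
    forall n : nat, Delta L 3 2 (lam n) = Delta L' 3 2 (lam' n) /\
            Delta L 4 2 (lam n) = Delta L' 4 2 (lam' n).
  move=> simp sep sep' nL nY nL' nY' E n.
  (* The derivative in the weight formulas belongs to the problem; it is the same for both because
     the zeros determine the whole function. *)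
  have DE : Delta L 2 2 = Delta L' 2 2.
    by apply: (Delta22_numbering simp nL nL') => m; have [] := E m.
  have [-> ->] := weights L lam Y n sep nL nY; have [-> ->] := weights L' lam' Y' n sep' nL' nY'.
  by have [-> -> ->] := E n; rewrite DE.
split; first by move=> L _ sep lam Y nL nY n; exact: weights.
move=> L L' simp sep simp' sep'; split.
- by move=> lam lam' Y Y' nL nY nL' nY'; exact: weights_eq.
- move=> lam lam' Y Y' nL nY nL' nY' E n.
  have DE : Delta L 2 2 = Delta L' 2 2.
    by apply: (Delta22_numbering simp nL nL') => m; have [] := E m.
  have D0 : Delta L 2 2 (lam n) = 0 by apply/(numbering_zeros _ nL); exists n.
  have [El E3 E4] := E n; have nYn' := nY' n; rewrite -El in E3 E4 nYn'.
  exact: (weights_determined simp sep sep' DE D0 (nY n) nYn').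
split.
  move=> [lam [Y [lam' [Y' [[nL nY] [nL' nY'] E]]]]].
  have DE : Delta L 2 2 = Delta L' 2 2.
    by apply: (Delta22_numbering simp nL nL') => m; have [] := E m.
  have W := weights_eq L L' lam lam' Y Y' simp sep sep' nL nY nL' nY' E.
  have E3 : Delta L 3 2 = Delta L' 3 2.
    apply: Delta32_unique => // mu /(numbering_zeros _ nL)[n <-].
    by have [-> _] := W n; have [-> _ _] := E n.
  have E4 : Delta L 4 2 = Delta L' 4 2.
    apply: Delta42_unique => // mu /(numbering_zeros _ nL)[n <-].
    by have [_ ->] := W n; have [-> _ _] := E n.
  have [c12 c13 c23] := spectrum_char_fun L; have [c12' c13' c23'] := spectrum_char_fun L'.
  by rewrite /spectrum c12 c13 c23 c12' c13' c23' DE E3 E4.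
move=> [S12 S13 S23]; have [DE E3 E4] := spectra_determine_Delta simp S12 S13 S23.
have [lam nL] := numbering_exists simp.
(* Once the determinants coincide, one numbering serves both problems. *)
have nL' : numbering L' lam by rewrite /numbering -DE.
have D0 n : Delta L 2 2 (lam n) = 0 by apply/(numbering_zeros _ nL); exists n.
have D0' n : Delta L' 2 2 (lam n) = 0 by rewrite -DE.
have [Y nY] := choice (fun n => normalized_eigenfunction_exists simp sep (D0 n)).
have ex n : exists Z, [/\ normalized_eigenfunction L' (lam n) Z, Y n 0%N 0 = Z 0%N 0 &
    Y n 1%N 0 = Z 1%N 0].
  have [Z nZ] := normalized_eigenfunction_exists simp' sep' (D0' n).
  have E3n : Delta L 3 2 (lam n) = Delta L' 3 2 (lam n) by rewrite E3.
  have E4n : Delta L 4 2 (lam n) = Delta L' 4 2 (lam n) by rewrite E4.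
  (* The weights agree up to a common sign, which may depend on [n]; where it is negative, the
     eigenfunction of the second problem is replaced by its opposite. *)
  case: (weights_determined simp sep sep' DE (D0 n) (nY n) nZ E3n E4n) => [[h0 h1]|[h0 h1]].
    by exists Z.
  have [Z' [nZ' z0 z1]] := eigenfunction_sign nZ.
  by exists Z'; split; rewrite ?h0 ?h1.
have [Y' nY'] := choice ex; exists lam, Y, lam, Y'; split => //.
  by split => // n; have [] := nY' n.
by move=> n; have [_ h0 h1] := nY' n.
Qed.
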